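(* (Integration) Let $\kappa\in(1,2)$, $\mathsf A\subset[0,\kappa)$ finite, $\lambda\in(0,1)$ and $I=[\lambda,\lambda^{-1}]$. Let $U$ be a bounded real function of $(x,y)\in\mathbb R^2\times\mathbb R^2$ that is periodic and continuous in the $y$-variable. Assume that there exist an $I$-valued function $a$ of $x\in\mathbb R^2$ and a constant $\overline M$ such that for all base points $x$ and all length scales $L\le1$, $T^{\frac14}\le1$ $$(T^{\frac14})^2\inf_{c\in\mathbb R}\|(\partial_2-a(x)\partial_1^2)U_T(x,\cdot)-c\|_{B_L(x)}\le\overline M\sum_{\beta\in\mathsf A}(T^{\frac14})^\beta L^{\kappa-\beta}.$$ Assume there also exist $\gamma\in C^0(\mathbb R^2\times\mathbb R^2)$ and a constant $\overline{\overline M}$ such that for all $x,y,z\in\mathbb R^2$ $$\big|U(x,z)-U(x,y)-U(y,z)+U(y,y)-\gamma(x,y)(z-y)_1\big|\le\overline{\overline M}\sum_{\beta\in\mathsf A}d^\beta(y,x)\,d^{\kappa-\beta}(z,y).$$ Then there exists a function $\nu$ of $x\in\mathbb R^2$ such that $$M_U:=\sup_{x\ne y}d^{-\kappa}(y,x)\,|U(x,y)-U(x,x)-\nu(x)(y-x)_1|\lesssim\overline M+\overline{\overline M}.$$ Moreover, $$\|\nu\|\le M_U\lesssim\overline M+\overline{\overline M},\qquad\sup_{x\ne y}d^{-(\kappa-1)}(y,x)\,|\nu(y)-\nu(x)+\gamma(x,y)|\lesssim M_U+\overline{\overline M}\lesssim\overline M+\overline{\overline M}.$$ Here $\lesssim$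 means up to a multiplicative constant that only depends on $\lambda$, $\kappa$ and $\mathsf A$.
   Context: $d(x,y)=|x_1-y_1|+\sqrt{|x_2-y_2|}$ on $\mathbb R^2$; $B_L(x)$ is the ball of radius $L$ around $x$ with respect to $d$, $\|\cdot\|_{B_L(x)}$ the supremum norm on it, and $\|\cdot\|$ the supremum norm on $\mathbb R^2$. $(z-y)_1=z_1-y_1$. ''Periodic'' means $[0,1)^2$-periodic, i.e. invariant under shifts by $\mathbb Z^2$. For $T>0$, $\psi_T$ is the Schwartz function with Fourier transform $\hat\psi_T(k)=\exp(-T(k_1^4+k_2^2))$, and $U_T(x,\cdot)$ is the convolution of $U(x,\cdot)$ with $\psi_T$ in the second argument $y$; the derivatives $\partial_1,\partial_2$ act on the $y$-variable. *)

(* Defs.v *)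
From mathcomp Require Import all_boot all_order all_algebra.
From mathcomp Require Import finmap complex.
From mathcomp Require Import all_classical all_reals all_analysis.

Set Implicit Arguments.
Unset Strict Implicit.
Unset Printing Implicit Defensive.

Import Order.TTheory GRing.Theory Num.Theory.
Import numFieldNormedType.Exports.

Local Open Scope classical_set_scope.
Local Open Scope ring_scope.

Definition pdist (R : realType) (x y : R * R) : R :=
  `|x.1 - y.1| + Num.sqrt `|x.2 - y.2|.

Definition pball (R : realType) (x : R * R) (L : R) : set (R * R) :=
  [set y | pdist x y < L].

Definition supnorm (R : realType) (B : set (R * R)) (f : R * R -> R) : \bar R :=
  ereal_sup [set (`|f y|)%:E | y in B].

Definition inf_const (R : realType) (B : set (R * R)) (f : R * R -> R) : \bar R :=
  ereal_inf [set supnorm B (fun y => f y - c) | c in [set: R]].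

Definition Z2periodic (R : realType) (f : R * R -> R) : Prop :=
  forall m n : int, periodic f (m%:~R, n%:~R).

Local Notation leb2 R := (@lebesgue_measure R \x @lebesgue_measure R)%E.

Definition d1 (R : realType) (f : R * R -> R) : R * R -> R :=
  fun y => 'D_((1, 0) : R * R) f y.

Definition d2 (R : realType) (f : R * R -> R) : R * R -> R :=
  fun y => 'D_((0, 1) : R * R) f y.

(* Since every d1^m d2^n f is differentiable, hence continuous, f is smooth and
   the order in which partial derivatives are taken is immaterial. *)
Definition schwartz (R : realType) (f : R * R -> R) : Prop :=
  forall m n : nat, let g := iter m (@d1 R) (iter n (@d2 R) f) in
    (forall y, differentiable g y) /\
    (forall p q : nat, exists C : R, forall y, `|y.1 ^+ p * y.2 ^+ q * g y| <= C).

(* f^(k) = \int exp(- i k.y) f(y) dy.  With this normalisation d1 and d2 become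
   multiplication by i k_1 and i k_2, so that exp(- T (k_1^4 + k_2^2)) is the
   symbol of the semigroup generated by - (d1^4 - d2^2). *)
Definition fourier (R : realType) (f : R * R -> R) (k : R * R) : R[i] :=
  Complex
    (\int[leb2 R]_(y in setT) (cos (k.1 * y.1 + k.2 * y.2) * f y))
    (- \int[leb2 R]_(y in setT) (sin (k.1 * y.1 + k.2 * y.2) * f y)).

(* By injectivity of the Fourier transform there is exactly one such f, and
   it is real-valued because the prescribed transform is real and even. *)
Definition is_psi (R : realType) (T : R) (f : R * R -> R) : Prop :=
  schwartz f /\
  forall k, fourier f k = Complex (expR (- (T * (k.1 ^+ 4 + k.2 ^+ 2)))) 0.

Definition convolution2 (R : realType) (f g : R * R -> R) : R * R -> R :=
  fun y => \int[leb2 R]_(z in setT) (f (y - z) * g z).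

Definition parab (R : realType) (alpha : R) (f : R * R -> R) : R * R -> R :=
  fun y => d2 f y - alpha * d1 (d1 f) y.

Definition sup_offdiag (R : realType) (F : R * R -> R * R -> R) : \bar R :=
  ereal_sup [set (F p.1 p.2)%:E | p in [set p : (R * R) * (R * R) | p.1 <> p.2]].

Definition modelling_sup (R : realType) (kappa : R) (U : R * R -> R * R -> R)
    (nu : R * R -> R) : \bar R :=
  sup_offdiag (fun x y => pdist y x `^ (- kappa) *
    `|U x y - U x x - nu x * (y - x).1|).

(* Main.v *)
Require Import Defs.
From mathcomp Require Import all_boot all_order all_algebra.
From mathcomp Require Import finmap complex.
From mathcomp Require Import all_classical all_reals all_analysis.
From mathcomp Require Import measurable_realfun.
From mathcomp Require Import ring lra.

(** The kernels psi_T are dilations of f = psi_1: trigonometric polynomials are dense in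
    the continuous periodic functions and see a kernel only through its Fourier transform,
    so convolution with psi_(s^4) is averaging against f dilated by s in the first and by
    s^2 in the second variable. These averages form a semigroup in which the scales s and r
    combine to (s^4 + r^4)^(1/4).

    Barriers and the maximum principle show that a solution of |v_t - a v_yy - c| <= F on a
    parabolic ball of radius L which is E-close to an affine function of y is, on the ball of
    radius r L, close to such a function up to a multiple of E r^2 + L^2 F. Call N admissible
    at scale r if every mollified U_(r^4)(x, .) is within N L^kappa of an affine function of
    y_1 on each ball of radius L >= r around x. By the three-point condition, passing from the
    scale r to eps L costs at most a multiple of N (eps L)^kappa + M L^kappa; as kappa < 2, the
    interior estimate then turns N into N / 2 + K M. Balls of radius of order one are handled
    by bounding the oscillation of all mollified functions simultaneously, comparing different
    base points. Starting from the trivial N of order r^(-kappa) the iteration reaches 3 K M,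
    uniformly in r, and r -> 0 gives slopes on all balls, which converge in Campanato's
    manner to nu. *)

Set Implicit Arguments.
Unset Strict Implicit.
Unset Printing Implicit Defensive.

Import Order.TTheory GRing.Theory Num.Theory.
Import numFieldNormedType.Exports.

Local Open Scope classical_set_scope.
Local Open Scope ring_scope.

(** * Maximum principles *)

Section MaximumPrinciple.
Variable R : realType.
Implicit Types (f : R -> R) (c d : R).

(** The hypothesis on the equation carries the factor $T^{1/2}$, so it degenerates as $T\to0$ and is
    informative on a ball of radius $L$ only for mollification at a scale comparable to $L$. This
    forces the passage to the scale eps L, whose cost involves the very quantity to be estimated;
    hence N stands on both sides and must be absorbed, which is legitimate because some finite N is
    known for each fixed r.

    The slopes are unknown, and so is gamma to the order required. Both enter only through terms
    linear in the first variable. Such terms are removed by the reflection symmetry of the kernel in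
    that variable, by second differences, or, where gamma itself has to be bounded, by evaluating at
    a shift by a period, which cancels all values of U.

    The constant has to be chosen before psi is given. Therefore one f with the transform of psi_1
    is fixed first, all constants are computed from f, and every later psi_T is identified with a
    dilation of f. *)

Definition has_deriv f c d : Prop := is_derive c (1 : R) f d.

Lemma is_derive_near f c d : has_deriv f c d -> forall e, 0 < e ->
  exists2 s, 0 < s & forall h, h != 0 -> `|h| < s ->
    `|(f (c + h) - f c) / h - d| < e.
Proof.
move=> [df <-] e e0.
have /cvgrPdist_lt/(_ e e0) := df.
move=> -[s /= s0 H]; exists s => // h h0 hs.
have := H h; rewrite /ball_ /= sub0r normrN => /(_ hs h0).
by rewrite /GRing.scale /= mulr1 distrC [h + c]addrC [h^-1 * _]mulrC.
Qed.

(** Only points to the left of [c] are compared, so that it applies to a maximum in time attained at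
    the final time. *)
Lemma is_derive_left_max f c d (e : R) : has_deriv f c d -> 0 < e ->
  (forall x, c - e < x -> x < c -> f x <= f c) -> 0 <= d.
Proof.
move=> fd e0 mx; rewrite leNgt; apply/negP => d0.
have /(is_derive_near fd)[s s0 H] : 0 < - d by lra.
pose h := - (Num.min e s / 2).
have m0 : 0 < Num.min e s by rewrite lt_min e0 s0.
have me : Num.min e s <= e by rewrite ge_min lexx.
have ms : Num.min e s <= s by rewrite ge_min lexx orbT.
have h0 : h < 0 by rewrite /h; lra.
have hs : `|h| < s by rewrite ltr0_norm // /h; lra.
have := H h (ltr0_neq0 h0) hs.
rewrite ltr_norml => /andP[_ Hd].
have q0 : (f (c + h) - f c) / h < 0 by lra.
have : f (c + h) <= f c by apply: mx; rewrite /h; lra.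
have : 0 < (f (c + h) - f c) / h * h by rewrite nmulr_rgt0.
by rewrite divfK ?ltr0_neq0 //; lra.
Qed.

Lemma is_derive_max0 f c d (e : R) : has_deriv f c d -> 0 < e ->
  (forall x, c - e < x -> x < c + e -> f x <= f c) -> d = 0.
Proof.
move=> fd e0 mx; apply/eqP; rewrite eq_le; apply/andP; split; last first.
  by apply: (is_derive_left_max fd e0) => x xc cx; apply: mx => //; lra.
rewrite leNgt; apply/negP => d0.
have [s s0 H] := is_derive_near fd d0.
pose h := Num.min e s / 2.
have m0 : 0 < Num.min e s by rewrite lt_min e0 s0.
have me : Num.min e s <= e by rewrite ge_min lexx.
have ms : Num.min e s <= s by rewrite ge_min lexx orbT.
have h0 : 0 < h by rewrite /h; lra.
have hs : `|h| < s by rewrite gtr0_norm // /h; lra.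
have := H h (lt0r_neq0 h0) hs.
rewrite ltr_norml => /andP[Hd _].
have q0 : 0 < (f (c + h) - f c) / h by lra.
have : f (c + h) <= f c by apply: mx; rewrite /h; lra.
have : 0 < (f (c + h) - f c) / h * h by rewrite mulr_gt0.
by rewrite divfK ?lt0r_neq0 //; lra.
Qed.

(** If [d > 0], then [f1], which vanishes at [c], is positive just to the right of [c], and the mean
    value theorem lifts [f] above [f c] there. *)
Lemma second_derive_max f (f1 : R -> R) c d (e : R) :
  (forall x : R, has_deriv f x (f1 x)) -> has_deriv f1 c d -> 0 < e ->
  (forall x, c - e < x -> x < c + e -> f x <= f c) -> d <= 0.
Proof.
move=> ff1 f1d e0 mx; rewrite leNgt; apply/negP => d0.
have f1c : f1 c = 0 by apply: is_derive_max0 (ff1 c) e0 mx.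
have [s s0 H] := is_derive_near f1d d0.
pose h := Num.min e s / 2.
have m0 : 0 < Num.min e s by rewrite lt_min e0 s0.
have me : Num.min e s <= e by rewrite ge_min lexx.
have ms : Num.min e s <= s by rewrite ge_min lexx orbT.
have h0 : 0 < h by rewrite /h; lra.
have hs : h < s by rewrite /h; lra.
have cch : c < c + h by lra.
have cf : {within `[c, c + h], continuous f}.
  apply: continuous_subspaceT => x.
  by apply: differentiable_continuous; apply/derivable1_diffP; case: (ff1 x).
have [x xI fx] := MVT cch (fun x _ => ff1 x) cf.
move: xI; rewrite in_itv /= => /andP[cx xch].
have xc0 : 0 < x - c by lra.
have := H (x - c) (lt0r_neq0 xc0) .
rewrite gtr0_norm // => /(_ (ltac:(lra))).
rewrite subrKC f1c subr0 ltr_norml => /andP[Hd _].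
have q0 : 0 < f1 x / (x - c) by lra.
have f1x : 0 < f1 x.
  by rewrite -(divfK (lt0r_neq0 xc0) (f1 x)) mulr_gt0.
have fxh : f (c + h) <= f c by apply: mx; rewrite /h; lra.
have : 0 < f1 x * (c + h - c) by rewrite mulr_gt0 //; lra.
by rewrite -fx; lra.
Qed.

(* At a positive interior (or final-time) maximum one would have
   Phi_t >= 0 >= Phi_hh. *)
Lemma max_principle1 (a l r t0 t1 : R) (P P1 P11 Pt : R -> R -> R) :
  0 <= a ->
  continuous (fun p : R * R => P p.1 p.2) ->
  (forall t y : R, has_deriv (P ^~ t) y (P1 y t)) ->
  (forall t y : R, has_deriv (P1 ^~ t) y (P11 y t)) ->
  (forall y t : R, has_deriv (P y) t (Pt y t)) ->
  (forall t, t0 <= t <= t1 -> P l t <= 0) ->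
  (forall t, t0 <= t <= t1 -> P r t <= 0) ->
  (forall y, l <= y <= r -> P y t0 <= 0) ->
  (forall y t, l < y < r -> t0 < t <= t1 -> Pt y t - a * P11 y t < 0) ->
  forall y t, l <= y <= r -> t0 <= t <= t1 -> P y t <= 0.
Proof.
move=> a0 cP dP1 dP11 dPt bl br b0 eqn y t yI tI.
have A0 : `[l, r] `*` `[t0, t1] !=set0 by exists (y, t); split; rewrite /= in_itv.
have cA : compact (`[l, r] `*` `[t0, t1]).
  by apply: compact_setX; apply: segment_compact.
have [[ym tm]] := compact_EVT_max A0 cA (continuous_subspaceT cP).
rewrite inE => -[/= ]; rewrite !in_itv /= => ymI tmI mx.
have {}mx u s : l <= u <= r -> t0 <= s <= t1 -> P u s <= P ym tm.
  by move=> uI sI; apply: (mx (u, s)); rewrite inE; split; rewrite /= in_itv.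
rewrite leNgt; apply/negP => Pyt.
have Pm : 0 < P ym tm by apply: lt_le_trans Pyt (mx _ _ yI tI).
have yml : l < ym.
  rewrite lt_neqAle; case/andP: (ymI) => -> _; rewrite andbT; apply/eqP => E.
  by move: (bl _ tmI); rewrite E leNgt Pm.
have ymr : ym < r.
  rewrite lt_neqAle; case/andP: (ymI) => _ ->; rewrite andbT; apply/eqP => E.
  by move: (br _ tmI); rewrite -E leNgt Pm.
have tm0 : t0 < tm.
  rewrite lt_neqAle; case/andP: (tmI) => -> _; rewrite andbT; apply/eqP => E.
  by move: (b0 _ ymI); rewrite E leNgt Pm.
have pos : 0 < Num.min (ym - l) (r - ym) by rewrite lt_min; lra.
have ml : Num.min (ym - l) (r - ym) <= ym - l by rewrite ge_min lexx.
have mr : Num.min (ym - l) (r - ym) <= r - ym by rewrite ge_min lexx orbT.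
have Pyy : P11 ym tm <= 0.
  apply: (second_derive_max (dP1 tm) (dP11 tm ym) pos) => x xl xr.
  by apply: mx => //; lra.
have Ptt : 0 <= Pt ym tm.
  apply: (is_derive_left_max (dPt ym tm) (e := tm - t0)); first by lra.
  by move=> x xl xr; apply: mx => //; lra.
have := eqn ym tm; rewrite yml ymr tm0 => /(_ isT); case/andP: tmI => _ -> /(_ isT).
have : a * P11 ym tm <= 0 by rewrite mulr_ge0_le0.
lra.
Qed.

(** The version with two space variables serves the mixed difference in [second_difference_le]. At
    an interior maximum both pure second derivatives are nonpositive, so their sum can be treated as
    [P11] was before. *)
Lemma max_principle2 (a r t0 t1 : R) (P P1 P11 P2 P22 Pt : R -> R -> R -> R) :
  0 <= a ->
  continuous (fun p : R * R * R => P p.1.1 p.1.2 p.2) ->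
  (forall k t h : R, has_deriv (fun h => P h k t) h (P1 h k t)) ->
  (forall k t h : R, has_deriv (fun h => P1 h k t) h (P11 h k t)) ->
  (forall h t k : R, has_deriv (fun k => P h k t) k (P2 h k t)) ->
  (forall h t k : R, has_deriv (fun k => P2 h k t) k (P22 h k t)) ->
  (forall h k t : R, has_deriv (P h k) t (Pt h k t)) ->
  (forall k t, 0 <= k <= r -> t0 <= t <= t1 -> P 0 k t <= 0) ->
  (forall k t, 0 <= k <= r -> t0 <= t <= t1 -> P r k t <= 0) ->
  (forall h t, 0 <= h <= r -> t0 <= t <= t1 -> P h 0 t <= 0) ->
  (forall h t, 0 <= h <= r -> t0 <= t <= t1 -> P h r t <= 0) ->
  (forall h k, 0 <= h <= r -> 0 <= k <= r -> P h k t0 <= 0) ->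
  (forall h k t, 0 < h < r -> 0 < k < r -> t0 < t <= t1 ->
     Pt h k t - a * (P11 h k t + P22 h k t) < 0) ->
  forall h k t, 0 <= h <= r -> 0 <= k <= r -> t0 <= t <= t1 -> P h k t <= 0.
Proof.
move=> a0 cP dP1 dP11 dP2 dP22 dPt b1 b2 b3 b4 b0 eqn h k t hI kI tI.
pose A := `[0, r] `*` `[0, r] `*` `[t0, t1].
have A0 : A !=set0 by exists (h, k, t); do !split; rewrite /= in_itv.
have cA : compact A.
  by do !apply: compact_setX; apply: segment_compact.
have [[[hm km] tm]] := compact_EVT_max A0 cA (continuous_subspaceT cP).
rewrite inE => -[[/= ]]; rewrite !in_itv /= => hmI kmI tmI mx.
have {}mx u v s : 0 <= u <= r -> 0 <= v <= r -> t0 <= s <= t1 ->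
    P u v s <= P hm km tm.
  by move=> uI vI sI; apply: (mx (u, v, s)); rewrite inE; do !split; rewrite /= in_itv.
rewrite leNgt; apply/negP => Pyt.
have Pm : 0 < P hm km tm by apply: lt_le_trans Pyt (mx _ _ _ hI kI tI).
have hm0 : 0 < hm.
  rewrite lt_neqAle; case/andP: (hmI) => -> _; rewrite andbT; apply/eqP => E.
  by move: (b1 _ _ kmI tmI) Pm; rewrite -E; lra.
have hmr : hm < r.
  rewrite lt_neqAle; case/andP: (hmI) => _ ->; rewrite andbT; apply/eqP => E.
  by move: (b2 _ _ kmI tmI); rewrite -E leNgt Pm.
have km0 : 0 < km.
  rewrite lt_neqAle; case/andP: (kmI) => -> _; rewrite andbT; apply/eqP => E.
  by move: (b3 _ _ hmI tmI) Pm; rewrite -E; lra.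
have kmr : km < r.
  rewrite lt_neqAle; case/andP: (kmI) => _ ->; rewrite andbT; apply/eqP => E.
  by move: (b4 _ _ hmI tmI); rewrite -E leNgt Pm.
have tm0 : t0 < tm.
  rewrite lt_neqAle; case/andP: (tmI) => -> _; rewrite andbT; apply/eqP => E.
  by move: (b0 _ _ hmI kmI); rewrite E leNgt Pm.
have side x : 0 < x -> x < r -> exists2 e, 0 < e &
    forall u, x - e < u -> u < x + e -> 0 <= u <= r.
  move=> x0 xr; exists (Num.min x (r - x)); first by rewrite lt_min; lra.
  have ml : Num.min x (r - x) <= x by rewrite ge_min lexx.
  have mr : Num.min x (r - x) <= r - x by rewrite ge_min lexx orbT.
  by move=> u u1 u2; lra.
have P11m : P11 hm km tm <= 0.
  have [e e0 He] := side _ hm0 hmr.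
  apply: (second_derive_max (dP1 km tm) (dP11 km tm hm) e0) => x xl xr.
  by apply: mx => //; apply: He.
have P22m : P22 hm km tm <= 0.
  have [e e0 He] := side _ km0 kmr.
  apply: (second_derive_max (dP2 hm tm) (dP22 hm tm km) e0) => x xl xr.
  by apply: mx => //; apply: He.
have Ptt : 0 <= Pt hm km tm.
  apply: (is_derive_left_max (dPt hm km tm) (e := tm - t0)); first by lra.
  by move=> x xl xr; apply: mx => //; lra.
have := eqn hm km tm; rewrite hm0 hmr km0 kmr tm0 => /(_ isT isT).
case/andP: tmI => _ -> /(_ isT).
have : a * (P11 hm km tm + P22 hm km tm) <= 0 by rewrite mulr_ge0_le0 //; lra.
lra.
Qed.
End MaximumPrinciple.

(** * Calculus of derivatives and continuity *)

Section RealDerivatives.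
Variable R : realType.
Implicit Types (f g : R -> R) (x a b : R).

Lemma has_deriv_cst x a : has_deriv (fun=> a) x 0.
Proof. exact: is_derive_cst. Qed.

Lemma has_deriv_id x : has_deriv (fun y => y) x 1.
Proof. exact: is_derive_id. Qed.

Lemma has_derivD x f g a b : has_deriv f x a -> has_deriv g x b ->
  has_deriv (fun y => f y + g y) x (a + b).
Proof. exact: is_deriveD. Qed.

Lemma has_derivN x f a : has_deriv f x a -> has_deriv (fun y => - f y) x (- a).
Proof. exact: is_deriveN. Qed.

Lemma has_derivM x f g a b : has_deriv f x a -> has_deriv g x b ->
  has_deriv (fun y => f y * g y) x (a * g x + f x * b).
Proof.
move=> fa gb; have := is_deriveM fa gb.
by rewrite /GRing.scale /= addrC [g x * a]mulrC.
Qed.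

Lemma has_deriv_comp x f g a b : has_deriv f (g x) a -> has_deriv g x b ->
  has_deriv (fun y => f (g y)) x (a * b).
Proof.
move=> fa gb; have := @is_derive1_comp R f g x a b fa gb.
by rewrite /comp mulrC.
Qed.

Lemma has_deriv_eq x f a b : has_deriv f x a -> a = b -> has_deriv f x b.
Proof. by move=> fa <-. Qed.

Lemma has_deriv_continuous f : (forall x, exists a, has_deriv f x a) -> continuous f.
Proof.
move=> H x; have [a [fa _]] := H x.
by apply: differentiable_continuous; apply/derivable1_diffP.
Qed.
End RealDerivatives.

Ltac der_step :=
  cbv beta; lazymatch goal with
  | |- has_deriv (fun _ => ?c) _ _ => exact: has_deriv_cst
  | |- has_deriv (fun x => x) _ _ => exact: has_deriv_id
  | |- has_deriv (fun x => @?f x + @?g x) _ _ => refine (@has_derivD _ _ f g _ _ _ _)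
  | |- has_deriv (fun x => - @?f x) _ _ => refine (@has_derivN _ _ f _ _)
  | |- has_deriv (fun x => @?f x * @?g x) _ _ => refine (@has_derivM _ _ f g _ _ _ _)
  | |- has_deriv (fun x => ?v (@?g x) (@?h x)) _ _ =>
      lazymatch h with
      | (fun _ => ?s) =>
          lazymatch goal with H : forall t y, has_deriv (fun x => v x t) y _ |- _ =>
            refine (@has_deriv_comp _ _ (fun z => v z s) g _ _ (H s _) _) end
      | _ => lazymatch g with (fun _ => ?z) =>
          lazymatch goal with H : forall y t, has_deriv (fun s => v y s) t _ |- _ =>
            refine (@has_deriv_comp _ _ (fun s => v z s) h _ _ (H z _) _) end end
      end
  end.
Ltac der := apply: has_deriv_eq; [repeat der_step | try by rewrite /=; ring].

Section Continuity.
Variables (R : realType) (T : topologicalType).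
Implicit Types f g : T -> R.

Lemma cts_cst (c : R) : continuous (fun _ : T => c).
Proof. exact: cst_continuous. Qed.

Lemma ctsD f g : continuous f -> continuous g -> continuous (fun x => f x + g x).
Proof. by move=> cf cg x; apply: cvgD; [exact: cf|exact: cg]. Qed.

Lemma ctsN f : continuous f -> continuous (fun x => - f x).
Proof. by move=> cf x; apply: cvgN; exact: cf. Qed.

Lemma ctsM f g : continuous f -> continuous g -> continuous (fun x => f x * g x).
Proof. by move=> cf cg x; apply: cvgM; [exact: cf|exact: cg]. Qed.

Lemma cts_pair f g : continuous f -> continuous g -> continuous (fun x => (f x, g x)).
Proof. by move=> cf cg x; exact: (cvg_pair (cf x) (cg x)). Qed.

Lemma cts_comp2 (v : R -> R -> R) f g : continuous (fun p : R * R => v p.1 p.2) ->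
  continuous f -> continuous g -> continuous (fun x => v (f x) (g x)).
Proof.
move=> cv cf cg x.
have := @continuous_comp T (R * R)%type R (fun x => (f x, g x)) (fun p : R * R => v p.1 p.2) x.
by move=> /(_ (@cts_pair f g cf cg x) (cv (f x, g x))).
Qed.
End Continuity.

Section Projections.
Variables (T U : topologicalType).
Lemma cts_fst : continuous (fun p : T * U => p.1).
Proof. by move=> p; exact: cvg_fst. Qed.
Lemma cts_snd : continuous (fun p : T * U => p.2).
Proof. by move=> p; exact: cvg_snd. Qed.
Lemma cts_fst_comp (V : topologicalType) (f : V -> T * U) : continuous f ->
  continuous (fun p => (f p).1).
Proof. by move=> cf p; exact: (@continuous_comp _ _ _ f fst p (cf p) (@cts_fst (f p))). Qed.
Lemma cts_snd_comp (V : topologicalType) (f : V -> T * U) : continuous f ->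
  continuous (fun p => (f p).2).
Proof. by move=> cf p; exact: (@continuous_comp _ _ _ f snd p (cf p) (@cts_snd (f p))). Qed.
Lemma cts_id : continuous (fun p : T => p).
Proof. by move=> p; exact: cvg_id. Qed.
End Projections.

Ltac cont_step :=
  lazymatch goal with
  | |- continuous (fun _ => ?c) => exact: cts_cst
  | |- continuous (fun x => x) => exact: cts_id
  | |- continuous (fun x => @?f x + @?g x) => refine (@ctsD _ _ f g _ _)
  | |- continuous (fun x => - @?f x) => refine (@ctsN _ _ f _)
  | |- continuous (fun x => @?f x * @?g x) => refine (@ctsM _ _ f g _ _)
  | |- continuous (fun x => fst x) => exact: cts_fst
  | |- continuous (fun x => snd x) => exact: cts_snd
  | |- continuous (fun x => fst (fst x)) => apply: cts_fst_comp; exact: cts_fst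
  | |- continuous (fun x => snd (fst x)) => apply: cts_snd_comp; exact: cts_fst
  | H : continuous (fun p => ?v (fst p) (snd p)) |-
      continuous (fun x => ?v (@?f x) (@?g x)) => refine (@cts_comp2 _ _ v f g H _ _)
  | |- _ => assumption
  end.
Ltac cont := repeat cont_step.

Ltac itv :=
  repeat match goal with
  | H : is_true ?b |- _ => lazymatch b with andb _ _ => fail | _ => clear H end
  | H : forall _, _ |- _ => clear H
  end; lra.

(** * Interior estimates *)

Section Oscillation.
Variable R : realType.

Record regular (v v1 v11 vt : R -> R -> R) : Prop := Regular {
  reg_cont : continuous (fun p : R * R => v p.1 p.2);
  reg_d1 : forall t y : R, has_deriv (fun x => v x t) y (v1 y t);
  reg_d11 : forall t y : R, has_deriv (fun x => v1 x t) y (v11 y t);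
  reg_dt : forall y t : R, has_deriv (fun s => v y s) t (vt y t) }.

Lemma regular_opp v v1 v11 vt : regular v v1 v11 vt ->
  regular (fun y t => - v y t) (fun y t => - v1 y t)
    (fun y t => - v11 y t) (fun y t => - vt y t).
Proof.
move=> [cv d1 d11 dt]; split; last by move=> y t; apply: has_derivN.
- exact: ctsN.
- by move=> y t; apply: has_derivN.
- by move=> y t; apply: has_derivN.
Qed.

(** The half-widths make the box fit into the unit ball of [pdist]: 1/2 + sqrt(1/5) < 1. The unknown
    constant [c] cancels in all spatial differences of [v]. *)
Definition near_heat (a c F : R) (v v11 vt : R -> R -> R) : Prop :=
  forall y t, - (1 / 2) <= y <= 1 / 2 -> - (1 / 5) <= t <= 1 / 5 ->
  `|vt y t - a * v11 y t - c| <= F.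

Definition box_bound (E : R) (v : R -> R -> R) : Prop :=
  forall y t, - (1 / 2) <= y <= 1 / 2 -> - (1 / 5) <= t <= 1 / 5 -> `|v y t| <= E.

Lemma near_heat_opp a c F v v11 vt : near_heat a c F v v11 vt ->
  near_heat a (- c) F (fun y t => - v y t) (fun y t => - v11 y t)
    (fun y t => - vt y t).
Proof.
move=> H y t yI tI; apply: le_trans (H y t yI tI).
by rewrite -normrN le_eqVlt; apply/orP; left; apply/eqP; congr (`|_|); ring.
Qed.

(** The difference [v (y + h) t - v (y - h) t], as a function of [h] and [t], solves the same heat
    equation up to [2 F] and vanishes at [h = 0]. A concave barrier in [h] therefore gives a
    Lipschitz bound. *)
Lemma oscillation_le (lambda a E F c : R) v v1 v11 vt y t0 h :
  0 < lambda -> lambda <= 1 -> lambda <= a -> 0 < E -> 0 <= F -> regular v v1 v11 vt ->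
  near_heat a c F v v11 vt -> box_bound E v ->
  - (1 / 4) <= y <= 1 / 4 -> - (1 / 10) <= t0 <= 1 / 5 -> 0 <= h <= 1 / 4 ->
  v (y + h) t0 - v (y - h) t0 <= 21 * ((E + F) / lambda) * h.
Proof.
move=> l0 l1 la E0 F0 [cv d1 d11 dt] heat vE yI t0I hI.
have a0 : 0 < a by apply: lt_le_trans l0 la.
have EF0 : 0 <= E + F by move: E0 F0 => p q; lra.
have EFl : E + F <= (E + F) / lambda.
  by rewrite ler_pdivlMr // ler_piMr.
have KEF : lambda * ((E + F) / lambda) = E + F.
  by rewrite mulrC divfK ?gt_eqF.
set G := (E + F) / lambda in EFl KEF *.
(* At [h = 1/4] the barrier is at least K/16 > 2 E; in the equation it contributes 2 a K >= 84 (E +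
   F), more than the error 2 F + 20 E. The time term equals 2 E at the initial time t0 - 1/10. *)
pose K := 42 * G.
have K0 : 0 < K by rewrite /K; lra.
pose P h t := v (y + h) t - v (y - h) t - (K * (h * (1 / 2 - h)) + 20 * E * (t0 - t)).
pose P1 h t := v1 (y + h) t + v1 (y - h) t - K * (1 / 2 - 2 * h).
pose P11 h t := v11 (y + h) t - v11 (y - h) t + 2 * K.
pose Pt h t := vt (y + h) t - vt (y - h) t + 20 * E.
have : P h t0 <= 0; last first.
  rewrite /P subrr mulr0 addr0 => H.
  have : K * (h * (1 / 2 - h)) <= K * (1 / 2 * h).
    apply: ler_wpM2l; first exact: ltW.
    by rewrite [h * _]mulrC; apply: ler_wpM2r; lra.
  by rewrite /K in H * => k; lra.
have bdE x t : - (1 / 2) <= x <= 1 / 2 -> - (1 / 5) <= t <= 1 / 5 -> - E <= v x t <= E.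
  by move=> xI tI; rewrite -ler_norml; exact: vE.
apply: (@max_principle1 R a 0 (1/4) (t0 - 1/10) t0 P P1 P11 Pt (ltW a0)) => //.
- by rewrite /P; cont.
- by move=> t x; rewrite /P /P1; der.
- by move=> t x; rewrite /P1 /P11; der.
- by move=> x t; rewrite /P /Pt; der.
- move=> t tI; rewrite /P addr0 subr0 subrr mul0r mulr0.
  have : 0 <= 20 * E * (t0 - t) by rewrite mulr_ge0 //; lra.
  lra.
- move=> t tI; rewrite /P.
  have /bdE : - (1/2) <= y + 1/4 <= 1/2 by lra.
  move=> /(_ t (ltac:(itv))).
  have /bdE : - (1/2) <= y - 1/4 <= 1/2 by lra.
  move=> /(_ t (ltac:(itv))).
  have : 0 <= 20 * E * (t0 - t) by rewrite mulr_ge0 //; lra.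
  by rewrite /K; lra.
- move=> x xI; rewrite /P.
  have /bdE : - (1/2) <= y + x <= 1/2 by lra.
  move=> /(_ (t0 - 1/10) (ltac:(itv))).
  have /bdE : - (1/2) <= y - x <= 1/2 by lra.
  move=> /(_ (t0 - 1/10) (ltac:(itv))).
  have : 0 <= K * (x * (1 / 2 - x)) by apply: mulr_ge0; [exact: ltW|apply: mulr_ge0; lra].
  lra.
- move=> x t xI tI; rewrite /Pt /P11.
  have /heat : - (1/2) <= y + x <= 1/2 by lra.
  move=> /(_ t (ltac:(itv))); rewrite ler_norml.
  have /heat : - (1/2) <= y - x <= 1/2 by lra.
  move=> /(_ t (ltac:(itv))); rewrite ler_norml.
  have : lambda * K <= a * K by rewrite ler_wpM2r // ltW.
  rewrite /K mulrDr mulrBr; lra.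
- lra.
Qed.

End Oscillation.

Ltac lr :=
  repeat match goal with
  | H : is_true (andb _ _) |- _ => clear H
  | H : forall _, _ |- _ => clear H
  end; lra.

Section SecondDifference.
Variable R : realType.
Implicit Types (a c E F : R) (v : R -> R -> R).

Lemma box_bound_opp E v : box_bound E v -> box_bound E (fun y t => - v y t).
Proof. by move=> H y t yI tI; rewrite normrN; exact: H. Qed.

(* The mixed difference Z solves Z_t = a (Z_hh + Z_kk) / 2 up to an error and
   vanishes for h = 0 and for k = 0. *)
Lemma second_difference_le (lambda a E F c : R) v v1 v11 vt y t0 s :
  0 < lambda -> lambda <= 1 -> lambda <= a -> 0 < E -> 0 <= F ->
  regular v v1 v11 vt ->
  near_heat a c F v v11 vt -> box_bound E v ->
  - (1 / 8) <= y <= 1 / 8 -> - (1 / 20) <= t0 <= 1 / 5 -> 0 <= s <= 1 / 4 ->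
  v (y + s) t0 + v (y - s) t0 - 2 * v y t0 <=
    168 * ((E + F) / lambda / lambda) * s ^+ 2 + F / lambda.
Proof.
move=> l0 l1 la E0 F0 reg heat vE yI t0I sI.
have osc := oscillation_le l0 l1 la E0 F0 reg heat vE.
have oscN := oscillation_le l0 l1 la E0 F0 (regular_opp reg) (near_heat_opp heat)
  (box_bound_opp vE).
case: reg => cv d1 d11 dt.
have a0 : 0 < a by apply: lt_le_trans l0 la.
have G0 : 0 < (E + F) / lambda by rewrite divr_gt0 //; lra.
set G := (E + F) / lambda in osc oscN G0 *.
have GL : G <= G / lambda by rewrite ler_pdivlMr // ler_piMr // ltW.
have GLa : 64 * 21 * G <= a * (64 * 21 * (G / lambda)).
  apply: (@le_trans _ _ (lambda * (64 * 21 * (G / lambda)))).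
    have : lambda * (G / lambda) = G by rewrite mulrC divfK ?gt_eqF.
    lra.
  by apply: ler_wpM2r => //; lra.
have Fl0 : 0 <= F / lambda by rewrite divr_ge0 // ltW.
have FLa : F <= a * (F / lambda).
  apply: (@le_trans _ _ (lambda * (F / lambda))).
    by rewrite [lambda * _]mulrC divfK ?gt_eqF.
  by apply: ler_wpM2r.
set H := G / lambda in GL GLa *.
set f := F / lambda in Fl0 FLa *.
pose K := 64 * 21 * H.
have K0 : 0 < K by rewrite /K; lr.
(* Each subtracted term has its own task. As 64 * 21 = 32 * 42, the cubic term is at least 42 H k at
   h = 1/8 (and 42 H h at k = 1/8), which dominates Z there. The time term is 21 G (h + k) at t0 -
   1/20, the mean of the two bounds 42 G h and 42 G k on Z; its derivative is paid by the cubic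
   term. The last term absorbs the error 4 F of the four copies of the equation. *)
pose P h k t := v (y + h + k) t - v (y + h - k) t - v (y - h + k) t + v (y - h - k) t
   - (K * (h * k * (1 / 2 - h - k)) + 420 * G * (t0 - t) * (h + k) + 4 * f * (h * (1 - h))).
pose P1 h k t := v1 (y + h + k) t - v1 (y + h - k) t + v1 (y - h + k) t - v1 (y - h - k) t
   - (K * (k * (1 / 2 - 2 * h - k)) + 420 * G * (t0 - t) + 4 * f * (1 - 2 * h)).
pose P11 h k t := v11 (y + h + k) t - v11 (y + h - k) t - v11 (y - h + k) t + v11 (y - h - k) t
   + 2 * K * k + 8 * f.
pose P2 h k t := v1 (y + h + k) t + v1 (y + h - k) t - v1 (y - h + k) t - v1 (y - h - k) t
   - (K * (h * (1 / 2 - h - 2 * k)) + 420 * G * (t0 - t)).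
pose P22 h k t := v11 (y + h + k) t - v11 (y + h - k) t - v11 (y - h + k) t + v11 (y - h - k) t
   + 2 * K * h.
pose Pt h k t := vt (y + h + k) t - vt (y + h - k) t - vt (y - h + k) t + vt (y - h - k) t
   + 420 * G * (h + k).
have : P (s / 2) (s / 2) t0 <= 0; last first.
  rewrite /P !addrK subrr mulr0 mul0r addr0.
  rewrite (_ : y + s / 2 + s / 2 = y + s); last by field.
  rewrite (_ : y - s / 2 + s / 2 = y); last by field.
  rewrite (_ : y - s / 2 - s / 2 = y - s); last by field.
  have : K * (s / 2 * (s / 2) * (1 / 2 - s / 2 - s / 2)) <= K * (s ^+ 2 / 8).
    apply: ler_wpM2l; first exact: ltW.
    have -> : s ^+ 2 / 8 = s / 2 * (s / 2) * (1 / 2) by field.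
    apply: ler_wpM2l; last by lra.
    by apply: mulr_ge0; itv.
  have : 4 * f * (s / 2 * (1 - s / 2)) <= 4 * f * (1 / 4).
    apply: ler_wpM2l; first by lra.
    apply: (@le_trans _ _ (s / 2 * 1)); last by itv.
    by apply: ler_wpM2l; itv.
  by rewrite /K; lr.
have KK h k : 0 <= h <= 1 / 8 -> 0 <= k <= 1 / 8 ->
    0 <= K * (h * k * (1 / 2 - h - k)).
  move=> hI kI; apply: mulr_ge0; first exact: ltW.
  by apply: mulr_ge0; [apply: mulr_ge0|]; itv.
have ff h : 0 <= h <= 1 / 8 -> 0 <= 4 * f * (h * (1 - h)).
  by move=> hI; apply: mulr_ge0; [clear -Fl0; lra|apply: mulr_ge0; itv].
have GG h k t : 0 <= h <= 1 / 8 -> 0 <= k <= 1 / 8 -> t0 - 1 / 20 <= t <= t0 -> 0 <= 420 * G * (t0 - t) * (h + k).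
  by move=> hI kI tI; apply: mulr_ge0; [apply: mulr_ge0|]; clear -hI kI tI G0; lra.
have Zh h k t : 0 <= h <= 1 / 8 -> 0 <= k <= 1 / 8 -> t0 - 1 / 20 <= t <= t0 ->
    v (y + h + k) t - v (y + h - k) t - v (y - h + k) t + v (y - h - k) t <= 42 * G * k.
  move=> hI kI tI.
  have := osc (y + h) t k (ltac:(itv)) (ltac:(itv)) (ltac:(itv)).
  have := oscN (y - h) t k (ltac:(itv)) (ltac:(itv)) (ltac:(itv)).
  lr.
have Zk h k t : 0 <= h <= 1 / 8 -> 0 <= k <= 1 / 8 -> t0 - 1 / 20 <= t <= t0 ->
    v (y + h + k) t - v (y + h - k) t - v (y - h + k) t + v (y - h - k) t <= 42 * G * h.
  move=> hI kI tI.
  have := osc (y + k) t h (ltac:(itv)) (ltac:(itv)) (ltac:(itv)).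
  have := oscN (y - k) t h (ltac:(itv)) (ltac:(itv)) (ltac:(itv)).
  rewrite (addrAC y h k) (addrAC y h (- k)) (addrAC y (- h) k) (addrAC y (- h) (- k)).
  lr.
have GHk x : 0 <= x <= 1 / 8 -> G * x <= H * x by case/andP=> x0 _; apply: ler_wpM2r.
apply: (@max_principle2 R (a / 2) (1 / 8) (t0 - 1 / 20) t0 P P1 P11 P2 P22 Pt).
- lra.
- by rewrite /P; cont.
- by move=> k t h; rewrite /P /P1; der.
- by move=> k t h; rewrite /P1 /P11; der.
- by move=> h t k; rewrite /P /P2; der.
- by move=> h t k; rewrite /P2 /P22; der.
- by move=> h k t; rewrite /P /Pt; der.
- move=> k t kI tI; rewrite /P.
  have := Zk 0 k t (ltac:(itv)) kI tI.
  have := KK 0 k (ltac:(itv)) kI.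
  have := ff 0 (ltac:(itv)).
  have := GG 0 k t (ltac:(itv)) (ltac:(itv)) (ltac:(itv)).
  lr.
- move=> k t kI tI; rewrite /P.
  have := Zh (1 / 8) k t (ltac:(itv)) kI tI.
  have := ff (1 / 8) (ltac:(itv)).
  have := GG (1 / 8) k t (ltac:(itv)) (ltac:(itv)) (ltac:(itv)).
  have : K * (1 / 8 * k * (1 / 4)) <= K * (1 / 8 * k * (1 / 2 - 1 / 8 - k)).
    apply: ler_wpM2l; first exact: ltW.
    by apply: ler_wpM2l; itv.
  have := GHk k kI.
  rewrite /K; lr.
- move=> h t hI tI; rewrite /P.
  have := Zh h 0 t hI (ltac:(itv)) tI.
  have := KK h 0 hI (ltac:(itv)).
  have := ff h hI.
  have := GG h 0 t (ltac:(itv)) (ltac:(itv)) (ltac:(itv)).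
  lr.
- move=> h t hI tI; rewrite /P.
  have := Zk h (1 / 8) t hI (ltac:(itv)) tI.
  have := ff h hI.
  have := GG h (1 / 8) t (ltac:(itv)) (ltac:(itv)) (ltac:(itv)).
  have : K * (h * (1 / 8) * (1 / 4)) <= K * (h * (1 / 8) * (1 / 2 - h - 1 / 8)).
    apply: ler_wpM2l; first exact: ltW.
    by apply: ler_wpM2l; itv.
  have := GHk h hI.
  rewrite /K; lr.
- move=> h k hI kI; rewrite /P.
  have := Zk h k (t0 - 1 / 20) hI kI (ltac:(itv)).
  have := Zh h k (t0 - 1 / 20) hI kI (ltac:(itv)).
  have := KK h k hI kI.
  have := ff h hI.
  lr.
- move=> h k t hI kI tI; rewrite /Pt /P11 /P22.
  have heat' x : - (1 / 2) <= x <= 1 / 2 -> - F <= vt x t - a * v11 x t - c <= F.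
    by move=> xI; rewrite -ler_norml; apply: heat => //; itv.
  have := heat' (y + h + k) (ltac:(itv)).
  have := heat' (y + h - k) (ltac:(itv)).
  have := heat' (y - h + k) (ltac:(itv)).
  have := heat' (y - h - k) (ltac:(itv)).
  have : 64 * 21 * G * (h + k) <= a * (64 * 21 * H) * (h + k).
    by apply: ler_wpM2r => //; itv.
  have : 0 < G * (h + k) by apply: mulr_gt0; clear -hI kI G0; lra.
  rewrite /K; lr.
- lra.
- lra.
- lra.
Qed.
End SecondDifference.

Section AffineApproximation.
Variable R : realType.
Implicit Types (a c E F : R) (v : R -> R -> R).

(** A large [c] forces [v] to grow: [mu (t + 1/5 - 4/5 y^2) - E] is a subsolution below [v] on the
    initial and lateral sides, and at the origin this reads mu/5 <= 2 E. Applied to [- v] it bounds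
    [c] from below. *)
Lemma heat_constant_le (lambda a E F c : R) v v1 v11 vt :
  0 < lambda -> lambda <= 1 -> lambda <= a -> a <= lambda^-1 -> 0 < E -> 0 <= F ->
  regular v v1 v11 vt -> near_heat a c F v v11 vt -> box_bound E v ->
  c <= F + 30 * (E / lambda).
Proof.
move=> l0 l1 la al E0 F0 [cv d1 d11 dt] heat vE.
have a0 : 0 < a by apply: lt_le_trans l0 la.
have El0 : 0 < E / lambda by rewrite divr_gt0.
have Ela : E * a <= E / lambda by apply: ler_wpM2l => //; apply: ltW.
have EEl : E <= E / lambda by rewrite ler_pdivlMr // ler_piMr // ltW.
case: (leP c F) => [|cF]; first by clear -El0; lra.
have a2 : 0 < 1 + 2 * a by clear -a0; lra.
(* The operator applied to the barrier gives mu (1 + 8/5 a); dividing by the larger 1 + 2 a makes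
   the differential inequality strict. *)
pose mu := (c - F) / (1 + 2 * a).
have mu0 : 0 < mu by rewrite divr_gt0 // subr_gt0.
have muE : mu * (1 + 2 * a) = c - F by rewrite divfK ?gt_eqF.
pose P y t := mu * (t + 1 / 5 - 4 / 5 * (y * y)) - v y t - E.
pose P1 y t := - (mu * (8 / 5) * y) - v1 y t.
pose P11 y t := - (mu * (8 / 5)) - v11 y t.
pose Pt y t := mu - vt y t.
have bdE x t : - (1 / 2) <= x <= 1 / 2 -> - (1 / 5) <= t <= 0 -> - E <= v x t <= E.
  by move=> xI tI; rewrite -ler_norml; apply: vE => //; itv.
have : P 0 0 <= 0.
  apply: (@max_principle1 R a (- (1 / 2)) (1 / 2) (- (1 / 5)) 0 P P1 P11 Pt (ltW a0)).
  - by rewrite /P; cont.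
  - by move=> t y; rewrite /P /P1; der; rewrite /=; field.
  - by move=> t y; rewrite /P1 /P11; der; rewrite /=; field.
  - by move=> y t; rewrite /P /Pt; der; rewrite /=; field.
  - move=> t tI; rewrite /P.
    have := bdE (- (1 / 2)) t (ltac:(itv)) tI.
    have : mu * t <= 0 by apply: mulr_ge0_le0; [exact: ltW|case/andP: tI].
    clear -mu0; lra.
  - move=> t tI; rewrite /P.
    have := bdE (1 / 2) t (ltac:(itv)) tI.
    have : mu * t <= 0 by apply: mulr_ge0_le0; [exact: ltW|case/andP: tI].
    clear -mu0; lra.
  - move=> y yI; rewrite /P.
    have := bdE y (- (1 / 5)) yI (ltac:(itv)).
    have : 0 <= mu * (y * y) by rewrite mulr_ge0 ?(ltW mu0) // -expr2 sqr_ge0.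
    clear; lra.
  - move=> y t yI tI; rewrite /Pt /P11.
    have /heat : - (1 / 2) <= y <= 1 / 2 by itv.
    move=> /(_ t (ltac:(itv))); rewrite ler_norml.
    have : 0 < mu * a by rewrite mulr_gt0.
    clear -muE; lra.
  - itv.
  - itv.
rewrite /P; have := bdE 0 0 (ltac:(itv)) (ltac:(itv)).
move=> vI P0.
have mE : mu <= 10 * E by clear -vI P0; lra.
have : mu * (1 + 2 * a) <= 10 * E * (1 + 2 * a) by apply: ler_wpM2r => //; apply: ltW.
rewrite muE; clear -Ela EEl; lra.
Qed.

(** The mean of [v] at [y + s] and [y - s] does not see the slope of [v]. At time [t0] it exceeds
    [v y t0] by at most half the second difference bound, and the maximum principle carries this
    forward to [s = 0] at later times. *)
Lemma time_increment_le (lambda a E F c : R) v v1 v11 vt y t0 t1 :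
  0 < lambda -> lambda <= 1 -> lambda <= a -> a <= lambda^-1 -> 0 < E -> 0 <= F ->
  regular v v1 v11 vt -> near_heat a c F v v11 vt -> box_bound E v ->
  - (1 / 8) <= y <= 1 / 8 -> - (1 / 20) <= t0 -> t0 <= t1 -> t1 <= 1 / 5 ->
  v y t1 - v y t0 <=
    F / lambda + 520 * ((E + F) / lambda / lambda / lambda) * (t1 - t0).
Proof.
move=> l0 l1 la al E0 F0 reg heat vE yI t0I t01 t1I.
have sd := second_difference_le l0 l1 la E0 F0 reg heat vE.
have cle := heat_constant_le l0 l1 la al E0 F0 reg heat vE.
have cge := heat_constant_le l0 l1 la al E0 F0 (regular_opp reg) (near_heat_opp heat)
  (box_bound_opp vE).
case: reg => cv d1 d11 dt.
have a0 : 0 < a by apply: lt_le_trans l0 la.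
have div_le (x : R) : 0 <= x -> x <= x / lambda.
  by move=> x0; rewrite ler_pdivlMr // ler_piMr.
have Fl : F <= F / lambda by exact: div_le.
have El : E <= E / lambda by apply: div_le; exact: ltW.
have G0 : 0 < (E + F) / lambda by rewrite divr_gt0 //; clear -E0 F0; lra.
have GE : (E + F) / lambda = E / lambda + F / lambda by rewrite mulrDl.
set G := (E + F) / lambda in sd G0 GE *.
have GH : G <= G / lambda by apply: div_le; exact: ltW.
set H := G / lambda in sd GH *.
have HI : H <= H / lambda by apply: div_le; clear -GH G0; lra.
have aH : a * H <= H / lambda.
  by rewrite mulrC; apply: ler_wpM2l => //; clear -GH G0; lra.
have aH0 : 0 < a * H by rewrite mulr_gt0 //; clear -GH G0; lra.
set J := H / lambda in HI aH *.
set El' := E / lambda in cle cge GE El.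
set f := F / lambda in sd Fl GE *.
pose B := F + 480 * (a * H).
(* The coefficient 160 exceeds the 84 needed at [t0] and makes the barrier at least 10 H at s = 1/4,
   above what [E] and the lower bound on [c] permit. In the equation it costs 320 a H, which the 480
   a H in [B] outweighs. *)
pose P s t := 1 / 2 * (v (y + s) t + v (y - s) t) - v y t0 - c * (t - t0)
  - (1 / 2 * f + 160 * H * (s * s) + B * (t - t0)).
pose P1 s t := 1 / 2 * (v1 (y + s) t - v1 (y - s) t) - 320 * H * s.
pose P11 s t := 1 / 2 * (v11 (y + s) t + v11 (y - s) t) - 320 * H.
pose Pt s t := 1 / 2 * (vt (y + s) t + vt (y - s) t) - c - B.
have B0 : 0 <= B by rewrite /B; clear -F0 aH0; lra.
have : P 0 t1 <= 0; last first.
  rewrite /P addr0 subr0 mulr0 mulr0 addr0 => P0.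
  have : (c + B) * (t1 - t0) <= 520 * J * (t1 - t0).
    apply: ler_wpM2r; first by rewrite subr_ge0.
    by rewrite /B; clear -cle GE GH HI aH Fl G0 El E0 F0; lra.
  clear -P0 Fl F0; lra.
have bdE x t : - (1 / 2) <= x <= 1 / 2 -> t0 <= t <= t1 -> - E <= v x t <= E.
  by move=> xI tI; rewrite -ler_norml; apply: vE => //; clear -tI t0I t1I; lra.
have y4p : - (1 / 2) <= y + 1 / 4 <= 1 / 2 by itv.
have y4m : - (1 / 2) <= y - 1 / 4 <= 1 / 2 by itv.
have yy : - (1 / 2) <= y <= 1 / 2 by itv.
have t0t0 : t0 <= t0 <= t1 by rewrite lexx.
have lateral t : t0 <= t <= t1 ->
    1 / 2 * (v (y + 1 / 4) t + v (y - 1 / 4) t) - v y t0 - c * (t - t0)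
    - (1 / 2 * f + 160 * H * (1 / 16) + B * (t - t0)) <= 0.
  move=> tI.
  have := bdE _ _ y4p tI; have := bdE _ _ y4m tI; have := bdE _ _ yy t0t0.
  have Bt : 0 <= B * (t - t0) by apply: mulr_ge0 => //; clear -tI; lra.
  have ct : - (c * (t - t0)) <= (F + 30 * El') * (1 / 4).
    have cc : 0 <= F + 30 * El' by clear -F0 El E0; lra.
    apply: (@le_trans _ _ ((F + 30 * El') * (t - t0))).
      by rewrite -mulNr; apply: ler_wpM2r => //; clear -tI; lra.
    by apply: ler_wpM2l => //; clear -tI t0I t1I; lra.
  clear -Bt ct GE GH El Fl F0 E0; lra.
apply: (@max_principle1 R a (- (1 / 4)) (1 / 4) t0 t1 P P1 P11 Pt (ltW a0)).
- by rewrite /P; cont.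
- by move=> t s; rewrite /P /P1; der; rewrite /=; field.
- by move=> t s; rewrite /P1 /P11; der; rewrite /=; field.
- by move=> s t; rewrite /P /Pt; der; rewrite /=; field.
- move=> t tI; rewrite /P opprK.
  by have := lateral t tI; clear; lra.
- move=> t tI; rewrite /P.
  by have := lateral t tI; clear; lra.
- move=> s sI; rewrite /P subrr !mulr0 addr0.
  have ss : 0 <= s * s by rewrite -expr2 sqr_ge0.
  have H0 : 0 <= H by clear -GH G0; lra.
  have HS : 0 <= H * (s * s) by rewrite mulr_ge0.
  have t0b : - (1 / 20) <= t0 <= 1 / 5 by clear -t0I t01 t1I; lra.
  case: (leP 0 s) => s0.
    have := sd y t0 s yI t0b (ltac:(clear -s0 sI; lra)).
    by rewrite expr2; clear -HS; lra.
  have := sd y t0 (- s) yI t0b (ltac:(clear -s0 sI; lra)).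
  by rewrite opprK expr2; clear -HS; lra.
- move=> s t sI tI; rewrite /Pt /P11.
  have tb : - (1 / 5) <= t <= 1 / 5 by clear -tI t0I t1I; lra.
  have := heat (y + s) t (ltac:(itv)) tb; rewrite ler_norml.
  have := heat (y - s) t (ltac:(itv)) tb; rewrite ler_norml.
  rewrite /B; clear -aH0; lra.
- itv.
- by rewrite lexx t01.
Qed.

(* If g vanishes at the endpoints, compare a maximum of g with the nearest
   endpoint and the reflected point. *)
Lemma second_difference_max (g : R -> R) (r D : R) : 0 <= r ->
  continuous g -> g r <= 0 -> g (- r) <= 0 ->
  (forall y s, - r <= y <= r -> 0 <= s <= r -> - (g (y + s) + g (y - s) - 2 * g y) <= D) ->
  forall y, - r <= y <= r -> g y <= D.
Proof.
move=> r0 cg gr gnr gD y yI.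
have rr : - r <= r by lra.
have [m mI mx] := EVT_max rr (continuous_subspaceT cg).
move: mI; rewrite in_itv /= => mI.
apply: (@le_trans _ _ (g m)); first by apply: mx; rewrite in_itv.
have {}mx u : - r <= u <= r -> g u <= g m by move=> uI; apply: mx; rewrite in_itv.
case: (leP 0 m) => m0.
  have := gD m (r - m) mI (ltac:(lra)).
  have := mx (m - (r - m)) (ltac:(lra)).
  by rewrite (_ : m + (r - m) = r); [lra|ring].
have := gD m (r + m) mI (ltac:(lra)).
have := mx (m + (r + m)) (ltac:(lra)).
by rewrite (_ : m - (r + m) = - r); [lra|ring].
Qed.

(** [nu] is the slope of the chord of [v] at time 0 over [-r, r]. After subtraction of the chord,
    [second_difference_max] applies in space and [time_increment_le] handles the rest. The factor
    870 covers 2 * 168 + 520 = 856 in front of [E]. *)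
Lemma local_affine_approx (lambda a E F c r : R) v v1 v11 vt :
  0 < lambda -> lambda <= 1 -> lambda <= a -> a <= lambda^-1 -> 0 < E -> 0 <= F ->
  regular v v1 v11 vt -> near_heat a c F v v11 vt -> box_bound E v ->
  0 < r -> r <= 1 / 8 ->
  exists nu, forall y t, - r <= y <= r -> - (r ^+ 2) <= t <= r ^+ 2 ->
    `|v y t - v 0 0 - nu * y| <= 870 / lambda ^+ 3 * (E * r ^+ 2 + F).
Proof.
move=> l0 l1 la al E0 F0 reg heat vE r0 r8.
have sd := second_difference_le l0 l1 la E0 F0 reg heat vE.
have sdN := second_difference_le l0 l1 la E0 F0 (regular_opp reg) (near_heat_opp heat)
  (box_bound_opp vE).
have ti := time_increment_le l0 l1 la al E0 F0 reg heat vE.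
have tiN := time_increment_le l0 l1 la al E0 F0 (regular_opp reg) (near_heat_opp heat)
  (box_bound_opp vE).
have div_le (x : R) : 0 <= x -> x <= x / lambda.
  by move=> x0; rewrite ler_pdivlMr // ler_piMr.
pose D := 168 * ((E + F) / lambda / lambda) * r ^+ 2 + F / lambda.
pose nu := (v r 0 - v (- r) 0) / (2 * r).
pose k := (v r 0 + v (- r) 0) / 2.
have r20 : 0 < r ^+ 2 by rewrite exprn_gt0.
have G0 : 0 <= (E + F) / lambda by rewrite divr_ge0 ?(ltW l0) //; clear -E0 F0; lra.
have H0 : 0 <= (E + F) / lambda / lambda by rewrite divr_ge0 ?(ltW l0).
have nur : nu * r = (v r 0 - v (- r) 0) / 2 by rewrite /nu; field; rewrite gt_eqF.
have rr : r ^+ 2 <= 1 / 64.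
  have -> : 1 / 64 = (1 / 8) ^+ 2 :> R by field.
  by rewrite lerXn2r // nnegrE ?(ltW r0) //; lra.
have cv0 : continuous (fun y => v y 0).
  by apply: has_deriv_continuous => y; exists (v1 y 0); case: reg => _ + _ _; apply.
have gD y s : - r <= y <= r -> 0 <= s <= r ->
    `|v (y + s) 0 + v (y - s) 0 - 2 * v y 0| <= D.
  move=> yI sI; rewrite ler_norml.
  have ss : s ^+ 2 <= r ^+ 2.
    by case/andP: sI => s0 sr; rewrite lerXn2r // nnegrE // ltW.
  have HS : 168 * ((E + F) / lambda / lambda) * s ^+ 2 <=
      168 * ((E + F) / lambda / lambda) * r ^+ 2.
    by apply: ler_wpM2l => //; clear -H0; lra.
  have yI8 : - (1 / 8) <= y <= 1 / 8 by clear -yI r8; lra.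
  have sI4 : 0 <= s <= 1 / 4 by clear -sI r8; lra.
  have := sd y 0 s yI8 (ltac:(clear; lra)) sI4.
  have := sdN y 0 s yI8 (ltac:(clear; lra)) sI4.
  rewrite /D; clear -HS; lra.
have space y : - r <= y <= r -> `|v y 0 - k - nu * y| <= D.
  move=> yI; rewrite ler_norml -lerN2 opprK; apply/andP; split.
    apply: (@second_difference_max (fun y => - (v y 0 - k - nu * y)) r) => //.
    - exact: ltW.
    - by cont.
    - by rewrite nur /k; clear; lra.
    - by rewrite mulrN nur /k; clear; lra.
    - move=> z s zI sI; have := gD z s zI sI; rewrite ler_norml; clear; lra.
  apply: (@second_difference_max (fun y => v y 0 - k - nu * y) r) => //.
  - exact: ltW.
  - by cont.
  - by rewrite nur /k; clear; lra.
  - by rewrite mulrN nur /k; clear; lra.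
  - move=> z s zI sI; have := gD z s zI sI; rewrite ler_norml; clear; lra.
pose J := (E + F) / lambda / lambda / lambda.
have HJ : (E + F) / lambda / lambda <= J by exact: div_le.
have time y t : - r <= y <= r -> - (r ^+ 2) <= t <= r ^+ 2 ->
    `|v y t - v y 0| <= F / lambda + 520 * J * r ^+ 2.
  move=> yI tI; have yI8 : - (1 / 8) <= y <= 1 / 8 by clear -yI r8; lra.
  have J0 : 0 <= 520 * J by clear -HJ H0; lra.
  have mono s : s <= r ^+ 2 -> 520 * J * s <= 520 * J * r ^+ 2.
    by move=> sr; apply: ler_wpM2l.
  rewrite ler_norml; case: (leP 0 t) => t0.
    have := ti y 0 t yI8 (ltac:(clear; lra)) t0 (ltac:(clear -tI rr; lra)).
    have := tiN y 0 t yI8 (ltac:(clear; lra)) t0 (ltac:(clear -tI rr; lra)).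
    have := mono (t - 0) (ltac:(clear -tI; lra)); rewrite -/J; clear; lra.
  have := ti y t 0 yI8 (ltac:(clear -tI rr; lra)) (ltW t0) (ltac:(clear; lra)).
  have := tiN y t 0 yI8 (ltac:(clear -tI rr; lra)) (ltW t0) (ltac:(clear; lra)).
  have := mono (0 - t) (ltac:(clear -tI; lra)); rewrite -/J; clear; lra.
exists nu => y t yI tI.
have := space y yI; have := space 0 (ltac:(clear -r0; lra)); have := time y t yI tI.
rewrite mulr0 subr0 !ler_norml.
have JE : J = (E + F) / lambda ^+ 3 by rewrite /J; field; rewrite gt_eqF.
have l3 : 0 < lambda ^+ 3 by rewrite exprn_gt0.
have FJ : F / lambda <= F / lambda ^+ 3.
  apply: ler_wpM2l => //; rewrite lef_pV2 ?posrE //.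
  by rewrite exprS ler_piMr ?(ltW l0) // exprn_ile1 // ltW.
have HJr : (E + F) / lambda / lambda * r ^+ 2 <= J * r ^+ 2 by apply: ler_wpM2r => //; exact: ltW.
have FF0 : 0 <= F / lambda ^+ 3 by rewrite divr_ge0 // ltW.
have EJr : J * r ^+ 2 <= E / lambda ^+ 3 * r ^+ 2 + F / lambda ^+ 3 * (1 / 64).
  rewrite JE 2!mulrDl lerD2l; apply: ler_wpM2l => //.
have -> : 870 / lambda ^+ 3 * (E * r ^+ 2 + F) =
  870 * (E / lambda ^+ 3 * r ^+ 2) + 870 * (F / lambda ^+ 3).
  by field; rewrite gt_eqF.
rewrite /D; clear -FJ HJr EJr FF0; lra.
Qed.
End AffineApproximation.

Section BallApprox.
Variable R : realType.
Implicit Types (a c E F : R) (v : R -> R -> R).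

Lemma sqrt_abs_le (t s : R) : 0 <= s -> - (s ^+ 2) <= t <= s ^+ 2 -> Num.sqrt `|t| <= s.
Proof.
move=> s0; rewrite -ler_norml => ts.
by rewrite -(ger0_norm s0) -(sqrtr_sqr s); exact: ler_wsqrtr.
Qed.

Lemma regular_affine (x1 x2 L k nu : R) v v1 v11 vt : regular v v1 v11 vt ->
  regular (fun y t => v (x1 + L * y) (x2 + L ^+ 2 * t) - k - nu * y)
    (fun y t => L * v1 (x1 + L * y) (x2 + L ^+ 2 * t) - nu)
    (fun y t => L ^+ 2 * v11 (x1 + L * y) (x2 + L ^+ 2 * t))
    (fun y t => L ^+ 2 * vt (x1 + L * y) (x2 + L ^+ 2 * t)).
Proof.
case=> cv d1 d11 dt; split.
- by cont.
- by move=> t y; der.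
- by move=> t y; der.
- by move=> y t; der.
Qed.

(** Parabolic scaling by [L] and [L^2] reduces to the unit box. An affine function of [y] solves the
    homogeneous equation, so it can be subtracted beforehand: only the distance [E] of [v] to affine
    functions enters, not the size of [v]. *)
Lemma ball_affine_approx (lambda a E F c r L nu : R) (x : R * R) v v1 v11 vt :
  0 < lambda -> lambda <= 1 -> lambda <= a -> a <= lambda^-1 -> 0 < E -> 0 <= F ->
  0 < L -> 0 < r -> r <= 1 / 8 ->
  regular v v1 v11 vt ->
  (forall y t, pdist (y, t) x < L -> `|vt y t - a * v11 y t - c| <= F) ->
  (forall y t, pdist (y, t) x < L -> `|v y t - v x.1 x.2 - nu * (y - x.1)| <= E) ->
  exists nu', forall y t, pdist (y, t) x < r * L ->
    `|v y t - v x.1 x.2 - nu' * (y - x.1)| <= 870 / lambda ^+ 3 * (E * r ^+ 2 + L ^+ 2 * F).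
Proof.
case: x => x1 x2 l0 l1 la al E0 F0 L0 r0 r8 reg heat vE /=.
have L20 : 0 < L ^+ 2 by rewrite exprn_gt0.
pose w y t := v (x1 + L * y) (x2 + L ^+ 2 * t) - v x1 x2 - (nu * L) * y.
have dist y t : - (1 / 2) <= y <= 1 / 2 -> - (1 / 5) <= t <= 1 / 5 ->
    pdist (x1 + L * y, x2 + L ^+ 2 * t) (x1, x2) < L.
  move=> yI tI; rewrite /pdist /=.
  rewrite !(addrC x1) !(addrC x2) !addrK (normrM L y) (normrM (L ^+ 2) t).
  rewrite (gtr0_norm L0) (gtr0_norm L20) (sqrtrM _ (ltW L20)) sqrtr_sqr (gtr0_norm L0).
  rewrite -mulrDr gtr_pMr //.
  have : `|y| <= 1 / 2 by rewrite ler_norml; clear -yI; lra.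
  have : Num.sqrt `|t| <= 9 / 20.
    apply: sqrt_abs_le; first by clear; lra.
    by rewrite expr2; clear -tI; lra.
  clear; lra.
have regw := regular_affine x1 x2 L (v x1 x2) (nu * L) reg.
have [||y t yI tI|nuw H] := @local_affine_approx R lambda a E (L ^+ 2 * F) (L ^+ 2 * c) r _ _ _ _
   l0 l1 la al E0 _ regw _ _ r0 r8.
- by rewrite mulr_ge0 // ltW.
- move=> y t yI tI; have := heat _ _ (dist y t yI tI).
  rewrite -(ler_pM2l L20) => H; apply: le_trans H.
  rewrite -[X in _ <= X * _](gtr0_norm L20) -normrM.
  by rewrite le_eqVlt; apply/orP; left; apply/eqP; congr (`|_|); ring.
- have := vE _ _ (dist y t yI tI); rewrite /=.
  by rewrite (addrC x1) addrK mulrA.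
exists (nu + nuw / L) => y t yt.
pose y' := (y - x1) / L; pose t' := (t - x2) / L ^+ 2.
have Ey : y = x1 + L * y' by rewrite /y' mulrC divfK ?gt_eqF // subrKC.
have Et : t = x2 + L ^+ 2 * t' by rewrite /t' mulrC divfK ?gt_eqF // subrKC.
have yt' : `|y'| + Num.sqrt `|t'| < r.
  rewrite -(ltr_pM2r L0) mulrC mulrDr; apply: le_lt_trans yt; rewrite /pdist /=.
  rewrite Ey Et !(addrC x1) !(addrC x2) !addrK (normrM L y') (normrM (L ^+ 2) t').
  by rewrite (gtr0_norm L0) (gtr0_norm L20) (sqrtrM _ (ltW L20)) sqrtr_sqr (gtr0_norm L0).
have s0 := sqrtr_ge0 `|t'|.
have y'I : - r <= y' <= r.
  by rewrite -ler_norml; clear -yt' s0; lra.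
have t'I : - r ^+ 2 <= t' <= r ^+ 2.
  rewrite -ler_norml -(sqr_sqrtr (normr_ge0 t')) lerXn2r ?nnegrE // ?ltW //.
  by have := normr_ge0 y'; clear -yt'; lra.
apply: le_trans (H y' t' y'I t'I); rewrite -Ey -Et !mulr0 !addr0.
rewrite le_eqVlt; apply/orP; left; apply/eqP; congr (`|_|).
by rewrite /y'; field; rewrite gt_eqF.
Qed.
End BallApprox.

(** * Families of periodic solutions *)

Section GlobalOscillation.
Variable R : realType.
Implicit Types (a c D F : R) (v : R -> R -> R).

Lemma int_shift (b y : R) : exists n : int, b <= y + n%:~R <= b + 1.
Proof.
exists (- Num.floor (y - b)); rewrite mulrNz.
by have /andP[] := floor_itv (y - b); rewrite intrD; lra.
Qed.

Definition periodic1 v := forall (n : int) y t, v (y + n%:~R) t = v y t.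
Definition periodic2 v := forall (n : int) y t, v y (t + n%:~R) = v y t.

(** A strip one period wide has no lateral boundary: a maximum over it is a maximum over the whole
    line. The rate [c + 2 F] in place of [c + F] makes the contradiction at the maximum strict. *)
Lemma strip_le a F c b t0 t1 S v v1 v11 vt :
  0 <= a -> 0 < F -> regular v v1 v11 vt -> periodic1 v ->
  (forall y t, b - 1 / 2 <= y <= b + 1 / 2 -> t0 <= t <= t1 ->
     `|vt y t - a * v11 y t - c| <= F) ->
  (forall y, v y t0 <= S) ->
  forall y t, t0 <= t <= t1 -> v y t <= S + (c + 2 * F) * (t - t0).
Proof.
move=> a0 F0 [cv d1 d11 dt] per heat vS y t tI.
pose P y t := v y t - S - (c + 2 * F) * (t - t0).
have perP n z s : P (z + n%:~R) s = P z s by rewrite /P per.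
pose A := `[b - 1 / 2, b + 1 / 2] `*` `[t0, t1].
have A0 : A !=set0 by exists (b, t); split; rewrite /= in_itv /=; lra.
have cA : compact A by apply: compact_setX; apply: segment_compact.
have cP : continuous (fun p : R * R => P p.1 p.2) by rewrite /P; cont.
have [[ym tm]] := compact_EVT_max A0 cA (continuous_subspaceT cP).
rewrite inE => -[/= ]; rewrite !in_itv /= => ymI tmI mx.
have {}mx u s : t0 <= s <= t1 -> P u s <= P ym tm.
  move=> sI; have [n nI] := int_shift (b - 1 / 2) u; rewrite -(perP n).
  by apply: (mx (u + n%:~R, s)); rewrite inE; split; rewrite /= in_itv /=; clear -nI sI; lra.
suff : P ym tm <= 0 by have := mx y t tI; rewrite /P; lra.
rewrite leNgt; apply/negP => Pm.
have tm0 : t0 < tm.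
  rewrite lt_neqAle; case/andP: (tmI) => -> _; rewrite andbT; apply/eqP => E.
  by have := vS ym; move: Pm; rewrite /P -E; lra.
pose P1 := v1.
have dP1 s z : has_deriv (fun z => P z s) z (v1 z s) by rewrite /P; der.
have dPt s z : has_deriv (fun s => P z s) s (vt z s - (c + 2 * F)) by rewrite /P; der.
have Pyy : v11 ym tm <= 0.
  apply: (second_derive_max (dP1 tm) (d11 tm ym) ltr01) => x _ _.
  exact: mx.
have Ptt : 0 <= vt ym tm - (c + 2 * F).
  apply: (is_derive_left_max (dPt tm ym) (e := tm - t0)); first by lra.
  by move=> x xl xr; apply: mx => //; lra.
have := heat ym tm ymI tmI; rewrite ler_norml.
have : a * v11 ym tm <= 0 by rewrite mulr_ge0_le0.
lra.
Qed.

Arguments strip_le {a F c b t0 t1 S v v1 v11 vt} _ _ _ _ _ _ y t _.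

(* [W x] solves the equation with coefficient frozen at [x], but only near [x]; [hf_base] lets
   one replace [x] by the point around which an extremum is located. *)
Record heat_family (lambda F D : R) (a : R * R -> R)
    (W W1 W11 Wt : R * R -> R -> R -> R) : Prop := HeatFamily {
  hf_a : forall x, lambda <= a x;
  hf_reg : forall x, regular (W x) (W1 x) (W11 x) (Wt x);
  hf_per1 : forall x, periodic1 (W x);
  hf_per2 : forall x, periodic2 (W x);
  hf_heat : forall x, exists c, forall y t, pdist (y, t) x < 1 ->
     `|Wt x y t - a x * W11 x y t - c| <= F;
  hf_base : forall x y : R * R, `|x.1 - y.1| <= 1 -> `|x.2 - y.2| <= 3 ->
     exists k, forall z t, `|W x z t - W y z t - k| <= D }.

Lemma pdist_lt1 (y t : R) (x : R * R) : `|y - x.1| <= 1 / 2 -> `|t - x.2| <= 1 / 9 ->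
  pdist (y, t) x < 1.
Proof.
move=> y1 t1; rewrite /pdist /=.
have : Num.sqrt `|t - x.2| <= 1 / 3.
  apply: sqrt_abs_le; first by lra.
  by move: t1; rewrite ler_norml expr2; lra.
lra.
Qed.

(* Compare x with the base point located at a maximum of the left-hand side
   minus K h (1/2 - h), which is penalized in time to absorb the error D. *)
Lemma space_oscillation_le (lambda F D : R) (a : R * R -> R)
    (W W1 W11 Wt : R * R -> R -> R -> R) x y z t :
  0 < lambda -> lambda <= 1 -> 0 < F -> 0 < D ->
  heat_family lambda F D a W W1 W11 Wt ->
  W x y t - W x z t <= 30 * ((F + D) / lambda).
Proof.
move=> l0 l1 F0 D0 [la reg per1 per2 heat change_base].
pose K := (F + 405 * D) / lambda.
have KE : lambda * K = F + 405 * D by rewrite mulrC divfK ?gt_eqF.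
have FD0 : 0 < (F + D) / lambda by rewrite divr_gt0 //; lra.
have K0 : 0 < K by rewrite /K; apply: divr_gt0; [clear -F0 D0; lra|exact: l0].
have DD : D <= (F + D) / lambda.
  by rewrite ler_pdivlMr //; have : D * lambda <= D * 1 by [apply: ler_wpM2l => //; lra]; lra.
have KF : K <= 405 * ((F + D) / lambda).
  by rewrite mulrA; apply: ler_wpM2r; [rewrite invr_ge0 ltW|lra].
(* [q] vanishes at 0 and at 1/2, where the difference vanishes as well, at 1/2 because the two
   points are then a period apart; so a large maximum is interior in [h]. *)
pose q h := h * (1 / 2 - h) : R.
pose P (y h t : R) := W x (y + h) t - W x (y - h) t - K * q h.
have cW := reg_cont (reg x).
have cP : continuous (fun p : R * R * R => P p.1.1 p.1.2 p.2) by rewrite /P /q; cont.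
pose A := `[x.1, x.1 + 1] `*` `[(0 : R), 1 / 2] `*` `[x.2, x.2 + 1].
have A0 : A !=set0 by exists (x.1, 0, x.2); do !split; rewrite /= in_itv /=; lra.
have cA : compact A by do !apply: compact_setX; apply: segment_compact.
have [[[ym hm] tm]] := compact_EVT_max A0 cA (continuous_subspaceT cP).
rewrite inE => -[[/= ]]; rewrite !in_itv /= => ymI hmI tmI mx.
have {}mx u h s : 0 <= h <= 1 / 2 -> P u h s <= P ym hm tm.
  move=> hI; have [n nI] := int_shift x.1 u; have [m mI] := int_shift x.2 s.
  have -> : P u h s = P (u + n%:~R) h (s + m%:~R).
    by rewrite /P !per2 ![u + n%:~R + _]addrAC !per1.
  by apply: (mx (u + n%:~R, h, s + m%:~R)); rewrite inE; do !split; rewrite /= in_itv.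
have main : P ym hm tm <= 2 * D.
  rewrite leNgt; apply/negP => Pm.
  pose b := (ym, tm).
  have [|/=|k kD] := change_base x b.
  - by rewrite /= ler_norml; lra.
  - by rewrite /= ler_norml; lra.
  have {}kD z' s : - D <= W x z' s - W b z' s - k <= D by rewrite -ler_norml.
  have cV := reg_cont (reg b).
  have [c cF] := heat b.
  (* At [|s - tm| = 1/9] the penalty is 405/81 D = 5 D, more than the 4 D lost by passing from base
     point [x] to [b] and back. The maximum of [Q] is thus interior in time and stays where the
     equation for [W b] holds. There the penalty costs at most 90 D, which [K] dominates. *)
  pose Q (h s : R) := W b (ym + h) s - W b (ym - h) s - K * q h
    - 405 * D * ((s - tm) * (s - tm)).
  pose Q1 (h s : R) := W1 b (ym + h) s + W1 b (ym - h) s - K * (1 / 2 - 2 * h).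
  pose Q11 (h s : R) := W11 b (ym + h) s - W11 b (ym - h) s + 2 * K.
  pose Qt (h s : R) := Wt b (ym + h) s - Wt b (ym - h) s - 810 * D * (s - tm).
  have [_ e1 e11 et] := reg b.
  have dQ1 s h : has_deriv (fun h => Q h s) h (Q1 h s).
    by rewrite /Q /Q1 /q; der.
  have dQ11 s h : has_deriv (fun h => Q1 h s) h (Q11 h s) by rewrite /Q1 /Q11; der.
  have dQt s h : has_deriv (fun s => Q h s) s (Qt h s) by rewrite /Q /Qt /q; der.
  have cQ : continuous (fun p : R * R => Q p.1 p.2) by rewrite /Q /q; cont.
  pose B := `[(0 : R), 1 / 2] `*` `[tm - 1 / 9, tm + 1 / 9].
  have B0 : B !=set0 by exists (0, tm); split; rewrite /= in_itv /=; lra.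
  have cB : compact B by apply: compact_setX; apply: segment_compact.
  have [[h s]] := compact_EVT_max B0 cB (continuous_subspaceT cQ).
  rewrite inE => -[/= ]; rewrite !in_itv /= => hI sI mxQ.
  have {}mxQ h' s' : 0 <= h' <= 1 / 2 -> tm - 1 / 9 <= s' <= tm + 1 / 9 -> Q h' s' <= Q h s.
    by move=> h'I s'I; apply: (mxQ (h', s')); rewrite inE; split; rewrite /= in_itv.
  have Qm : P ym hm tm - 2 * D <= Q h s.
    apply: le_trans _ (mxQ hm tm hmI (ltac:(clear; lra))).
    have := kD (ym + hm) tm; have := kD (ym - hm) tm.
    by rewrite /P /Q subrr !mulr0; clear; lra.
  have QP : Q h s <= P ym hm tm + 2 * D - 405 * D * ((s - tm) * (s - tm)).
    have := kD (ym + h) s; have := kD (ym - h) s; have := mx ym h s hI.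
    by rewrite /P /Q; clear; lra.
  have sqD : D * (1 / 81) <= D * ((s - tm) * (s - tm)) -> False.
    by move=> H; clear -H Qm QP D0; lra.
  have h0 : 0 < h.
    rewrite lt_neqAle; case/andP: (hI) => -> _; rewrite andbT; apply/eqP => E.
    have : 0 <= D * ((s - tm) * (s - tm)) by apply: mulr_ge0; [exact: ltW|rewrite -expr2 sqr_ge0].
    by move: Qm; rewrite /Q /q -E addr0 subr0 mul0r; clear -Pm; lra.
  have h2 : h < 1 / 2.
    rewrite lt_neqAle; case/andP: (hI) => _ ->; rewrite andbT; apply/eqP => E.
    have : 0 <= D * ((s - tm) * (s - tm)) by apply: mulr_ge0; [exact: ltW|rewrite -expr2 sqr_ge0].
    have := per1 b 1 (ym - 1 / 2) s; rewrite mulr1z.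
    rewrite (_ : ym - 1 / 2 + 1 = ym + 1 / 2); last by field.
    by move=> perE; move: Qm; rewrite /Q /q E perE; clear -Pm; lra.
  have s1 : tm - 1 / 9 < s.
    rewrite lt_neqAle; case/andP: (sI) => -> _; rewrite andbT; apply/eqP => E.
    by apply: sqD; rewrite -E; clear; lra.
  have s2 : s < tm + 1 / 9.
    rewrite lt_neqAle; case/andP: (sI) => _ ->; rewrite andbT; apply/eqP => E.
    by apply: sqD; rewrite E; clear; lra.
  have Qhh : Q11 h s <= 0.
    have pos : 0 < Num.min h (1 / 2 - h) by rewrite lt_min; clear -h0 h2; lra.
    have ml : Num.min h (1 / 2 - h) <= h by rewrite ge_min lexx.
    have mr : Num.min h (1 / 2 - h) <= 1 / 2 - h by rewrite ge_min lexx orbT.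
    apply: (second_derive_max (dQ1 s) (dQ11 s h) pos) => h' h1' h2'.
    by apply: mxQ => //; clear -ml mr h1' h2'; lra.
  have Qs : Qt h s = 0.
    have pos : 0 < Num.min (s - tm + 1 / 9) (tm + 1 / 9 - s).
      by rewrite lt_min; clear -s1 s2; lra.
    have ml : Num.min (s - tm + 1 / 9) (tm + 1 / 9 - s) <= s - tm + 1 / 9.
      by rewrite ge_min lexx.
    have mr : Num.min (s - tm + 1 / 9) (tm + 1 / 9 - s) <= tm + 1 / 9 - s.
      by rewrite ge_min lexx orbT.
    apply: (is_derive_max0 (dQt s h) pos) => s' s1' s2'.
    by apply: mxQ => //; clear -ml mr s1' s2'; lra.
  have eqn z' : `|z'| <= 1 / 2 -> - F <= Wt b (ym + z') s - a b * W11 b (ym + z') s - c <= F.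
    move=> z'1; rewrite -ler_norml; apply: cF; apply: pdist_lt1 => /=.
      by rewrite [ym + z']addrC addrK.
    by rewrite ler_norml; clear -sI; lra.
  have := eqn h (ltac:(rewrite ler_norml; clear -hI; lra)).
  have := eqn (- h) (ltac:(rewrite ler_norml; clear -hI; lra)).
  have aK : lambda * K <= a b * K by apply: ler_wpM2r (la b); exact: ltW.
  have : a b * Q11 h s <= 0 by rewrite mulr_ge0_le0 // (le_trans (ltW l0)).
  have Ds : D * (s - tm) <= D * (1 / 9) by apply: ler_wpM2l; [exact: ltW|clear -sI; lra].
  have Ds' : - (D * (1 / 9)) <= D * (s - tm).
    by rewrite -mulrN; apply: ler_wpM2l; [exact: ltW|clear -sI; lra].
  move: Qs; rewrite /Qt /Q11; clear -aK KE Ds Ds' F0 D0; lra.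
have [n nI] := int_shift z y.
rewrite -(per1 x n y t).
have := mx ((y + n%:~R + z) / 2) ((y + n%:~R - z) / 2) t (ltac:(clear -nI; lra)).
move/le_trans/(_ main); rewrite /P.
rewrite (_ : (y + n%:~R + z) / 2 + (y + n%:~R - z) / 2 = y + n%:~R); last by field.
rewrite (_ : (y + n%:~R + z) / 2 - (y + n%:~R - z) / 2 = z); last by field.
set h := (y + n%:~R - z) / 2.
have : K * q h <= K * (1 / 16).
  apply: ler_wpM2l; first exact: ltW.
  have := sqr_ge0 (h - 1 / 4); rewrite expr2 /q; clear; lra.
clear -KF DD FD0; lra.
Qed.

(** Oscillation in space is known at every fixed time, so only variation in time remains. Starting
    at the time of the maximum, a lower bound is carried forward until a full time period is
    covered. *)
Lemma global_oscillation_le (lambda F D : R) (a : R * R -> R)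
    (W W1 W11 Wt : R * R -> R -> R -> R) x y t z s :
  0 < lambda -> lambda <= 1 -> 0 < F -> 0 < D ->
  heat_family lambda F D a W W1 W11 Wt ->
  `|W x y t - W x z s| <= 500 * (100 * ((F + D) / lambda)).
Proof.
move=> l0 l1 F0 D0 HF.
have osc b y' z' t' := space_oscillation_le b y' z' t' l0 l1 F0 D0 HF.
case: HF => la reg per1 per2 heat change_base.
have FDG : F + D <= (F + D) / lambda.
  rewrite ler_pdivlMr // -[leRHS]mulr1; apply: ler_wpM2l => //.
  by clear -F0 D0; lra.
pose G := 30 * ((F + D) / lambda).
have G0 : 0 < G by rewrite /G; clear -F0 D0 FDG; lra.
have cW := reg_cont (reg x).
pose A := `[x.1, x.1 + 1] `*` `[x.2, x.2 + 1].
have A0 : A !=set0 by exists x; split; rewrite /= in_itv /=; lra.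
have cA : compact A by apply: compact_setX; apply: segment_compact.
have [[ym tm]] := compact_EVT_max A0 cA (continuous_subspaceT cW).
rewrite inE => -[/= ]; rewrite !in_itv /= => ymI tmI mx.
set S := W x ym tm in mx.
have {}mx u r : W x u r <= S.
  have [n nI] := int_shift x.1 u; have [m mI] := int_shift x.2 r.
  rewrite -(per1 x n) -(per2 x m).
  by apply: (mx (u + n%:~R, r + m%:~R)); rewrite inE; split; rewrite /= in_itv.
pose e := 2 * G + 4 * D + F.
(* The value S - B at time t1 propagates to [t1, t1 + 1/9] with a worse B: the
   slope c is at least of order - B since the solution cannot exceed S. *)
have step B t1 : 0 <= B -> tm <= t1 <= tm + 1 -> (forall u, S - B <= W x u t1) ->
    forall r, t1 <= r <= t1 + 1 / 9 -> forall u, S - (2 * B + e) <= W x u r.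
  move=> B0 t1I low r rI u.
  pose b := (ym, t1).
  have [||k kD] := change_base x b.
  - by rewrite /= ler_norml; lra.
  - by rewrite /= ler_norml; lra.
  have {}kD z' r' : - D <= W x z' r' - W b z' r' - k <= D by rewrite -ler_norml.
  have [c cF] := heat b.
  have a0 : 0 <= a b by rewrite (le_trans (ltW l0)).
  have eqn (r0 r1 : R) : t1 - 1 / 9 <= r0 -> r1 <= t1 + 1 / 9 -> forall z' r',
      ym - 1 / 2 <= z' <= ym + 1 / 2 -> r0 <= r' <= r1 ->
      `|Wt b z' r' - a b * W11 b z' r' - c| <= F.
    move=> r0I r1I z' r' z'I r'I; apply: cF; apply: pdist_lt1 => /=.
      by rewrite ler_norml; clear -z'I; lra.
    by rewrite ler_norml; clear -r'I r0I r1I; lra.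
  have eqnN (r0 r1 : R) : t1 - 1 / 9 <= r0 -> r1 <= t1 + 1 / 9 -> forall z' r',
      ym - 1 / 2 <= z' <= ym + 1 / 2 -> r0 <= r' <= r1 ->
      `|- Wt b z' r' - a b * - W11 b z' r' - - c| <= F.
    move=> r0I r1I z' r' z'I r'I.
    apply: le_trans (eqn r0 r1 r0I r1I z' r' z'I r'I).
    rewrite -[in leRHS]normrN.
    by rewrite le_eqVlt; apply/orP; left; apply/eqP; congr (`|_|); ring.
  have perN : periodic1 (fun y t => - W b y t) by move=> n y' t'; rewrite per1.
  (* backwards from t1, to bound c from below *)
  have c_low : - (c + 2 * F) * (1 / 9) <= B + 2 * D + G.
    have vS u' : W b u' (t1 - 1 / 9) <= W b ym (t1 - 1 / 9) + G.
      by have := osc b u' ym (t1 - 1 / 9); rewrite /G; clear; lra.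
    have := strip_le a0 F0 (reg b) (per1 b)
      (eqn (t1 - 1 / 9) t1 (ltac:(clear; lra)) (ltac:(clear; lra))) vS ym t1
      (ltac:(clear; lra)).
    have := kD ym t1; have := kD ym (t1 - 1 / 9); have := mx ym (t1 - 1 / 9); have := low ym.
    clear; lra.
  have vS u' : - W b u' t1 <= - (W b ym t1 - G).
    by have := osc b ym u' t1; rewrite /G; clear; lra.
  have := strip_le a0 F0 (regular_opp (reg b)) perN
    (eqnN t1 (t1 + 1 / 9) (ltac:(clear; lra)) (ltac:(clear; lra))) vS u r
    (ltac:(clear -rI; lra)).
  have := kD u r; have := kD ym t1; have := low ym.
  have : (- c + 2 * F) * (r - t1) <= B + 2 * D + G + 4 * F * (1 / 9).
    case: (leP (- c + 2 * F) 0) => cs.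
      have : (- c + 2 * F) * (r - t1) <= 0.
        by apply: mulr_le0_ge0 => //; clear -rI; lra.
      by clear -B0 D0 G0 F0; lra.
    have : (- c + 2 * F) * (r - t1) <= (- c + 2 * F) * (1 / 9).
      by apply: ler_wpM2l; [exact: ltW|clear -rI; lra].
    clear -c_low; lra.
  rewrite /e; clear -F0; lra.
have iter_low (j : nat) : (j <= 9)%N -> forall r, tm <= r <= tm + j%:R / 9 ->
    forall u, S - (2 ^+ j * (G + e) - e) <= W x u r.
  elim: j => [_|j IH j9] r rI u.
    have -> : r = tm by move: rI; rewrite mul0r addr0; clear; lra.
    by rewrite expr0; have := osc x ym u tm; rewrite -/S /G; clear; lra.
  have {}IH := IH (ltnW j9).
  have e0 : 0 < e by rewrite /e; clear -G0 D0 F0; lra.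
  have p0 : 1 <= 2 ^+ j :> R by rewrite exprn_ege1 //; clear; lra.
  have Bj : 0 <= 2 ^+ j * (G + e) - e.
    have : 1 * (G + e) <= 2 ^+ j * (G + e) by apply: ler_wpM2r => //; clear -G0 e0; lra.
    by clear -G0; lra.
  have j8 : j%:R <= 8 :> R by rewrite ler_nat.
  have j0 : 0 <= j%:R :> R by [].
  have rE : j.+1%:R = j%:R + 1 :> R by rewrite -natr1.
  case: (leP r (tm + j%:R / 9)) => rj.
    have := IH r (ltac:(clear -rI rj; lra)) u.
    by rewrite exprS; clear -Bj e0; lra.
  pose t1 := tm + j%:R / 9.
  have := step _ t1 Bj (ltac:(rewrite /t1; clear -j8 j0; lra))
    (IH t1 (ltac:(rewrite /t1; clear -j8 j0; lra))) r _ u.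
  rewrite exprS => H.
  have := H (ltac:(rewrite /t1; move: rI; rewrite rE; clear -rj; lra)).
  by clear; lra.
have low u r : S - 511 * (2 * G + 4 * D + F) - 512 * G <= W x u r.
  have [n nI] := int_shift tm r.
  rewrite -(per2 x n); have := iter_low 9%N isT (r + n%:~R) (ltac:(clear -nI; lra)) u.
  rewrite (_ : 2 ^+ 9 = 512 :> R); last by rewrite -natrX.
  by rewrite /e; clear; lra.
have := low y t; have := low z s; have := mx y t; have := mx z s.
rewrite ler_norml /G; clear -FDG F0 D0; lra.
Qed.
End GlobalOscillation.

(** * Trigonometric polynomials *)

Section TrigApprox.
Variable R : realType.
Implicit Types (f g : R -> R) (u : R * R -> R).

Lemma cos_mul_cos (a b : R) : cos a * cos b = (cos (a + b) + cos (a - b)) / 2.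
Proof. by rewrite cosD cosB; field. Qed.

Inductive tpoly (n : nat) : (R -> R) -> Prop :=
| tpoly_wave (l : nat) (c p : R) : (l <= n)%N ->
    tpoly n (fun s => c * cos (l%:R * (2 * pi * s) + p))
| tpoly_add f g : tpoly n f -> tpoly n g -> tpoly n (fun s => f s + g s).

(** Multiplication by sin(pi l / m), nonzero because 0 < l < m, makes the sum telescope, and the two
    end terms agree by periodicity. *)
Lemma sum_cos0 (l m : nat) (s p : R) : (0 < l < m)%N ->
  \sum_(j < m) cos (l%:R * (2 * pi * (s - j%:R / m%:R)) + p) = 0.
Proof.
move=> /andP[l0 lm]; have m0 : (0 < m%:R :> R) by rewrite ltr0n (ltn_trans l0).
pose b : R := pi * (l%:R / m%:R).
have sb : 0 < sin b.
  apply: sin_gt0_pi; apply/andP; split.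
    by rewrite mulr_gt0 ?pi_gt0 // divr_gt0 // ltr0n.
  by rewrite gtr_pMr ?pi_gt0 // ltr_pdivrMr // mul1r ltr_nat.
apply: (mulfI (lt0r_neq0 sb)); rewrite mulr0.
pose h (j : nat) : R := - sin (l%:R * (2 * pi * (s - j%:R / m%:R)) + p + b) / 2.
rewrite mulr_sumr.
have -> : \sum_(j < m) sin b * cos (l%:R * (2 * pi * (s - j%:R / m%:R)) + p)
    = \sum_(j < m) (h j.+1 - h j).
  apply: eq_bigr => j _; rewrite /h.
  pose X := l%:R * (2 * pi * (s - j%:R / m%:R)) + p.
  have -> : l%:R * (2 * pi * (s - j.+1%:R / m%:R)) + p + b =
X - b.
    by rewrite /X /b -natr1; field; rewrite gt_eqF.
  by rewrite -/X (sinB X) (sinD X); field.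
rewrite -(big_mkord xpredT (fun j => h j.+1 - h j)) telescope_sumr // /h mul0r subr0.
have -> : l%:R * (2 * pi * (s - m%:R / m%:R)) + p + b =
    l%:R * (2 * pi * s) + p + b - (pi *+ 2) *+ l.
  by rewrite divff ?gt_eqF // -mulr_natr -[pi *+ 2]mulr_natr; ring.
have := periodicn (@sinD2pi R) l (l%:R * (2 * pi * s) + p + b - (pi *+ 2) *+ l).
by rewrite subrK => ->; rewrite subrr.
Qed.

Lemma tpoly_avg n f : tpoly n f ->
  exists A, forall m s, (n < m)%N -> \sum_(j < m) f (s - j%:R / m%:R) = m%:R * A.
Proof.
elim=> [l c p ln|{}f g _ [A HA] _ [B HB]]; last first.
  by exists (A + B) => m s nm; rewrite big_split /= HA // HB // mulrDr.
case: l ln => [|l] ln.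
  exists (c * cos p) => m s nm.
  under eq_bigr do rewrite mul0r add0r.
  by rewrite sumr_const card_ord mulr_natl.
exists 0 => m s nm; rewrite mulr0 -mulr_sumr sum_cos0 ?mulr0 //=.
exact: leq_ltn_trans ln nm.
Qed.

Lemma tpoly_mul_cos n f c d : tpoly n f ->
  tpoly n.+1 (fun s => f s * (c + d * cos (2 * pi * s))).
Proof.
elim=> [l c' p ln|{}f g _ Hf _ Hg]; last first.
  by under eq_fun do rewrite mulrDl; exact: tpoly_add.
have -> : (fun s => c' * cos (l%:R * (2 * pi * s) + p) * (c + d * cos (2 * pi * s))) =
  (fun s => c' * c * cos (l%:R * (2 * pi * s) + p) +
    (c' * d / 2 * cos (l.+1%:R * (2 * pi * s) + p) +
     c' * d / 2 * cos (l%:R * (2 * pi * s) + p - 2 * pi * s))).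
  apply/funext => s; have := cos_mul_cos (l%:R * (2 * pi * s) + p) (2 * pi * s).
  have -> : l%:R * (2 * pi * s) + p + 2 * pi * s = l.+1%:R * (2 * pi * s) + p.
    by rewrite -natr1; ring.
  set x := cos _; set y := cos (2 * pi * s); set z := cos _; set w := cos _ => E.
  have -> : c' * x * (c + d * y) = c' * c * x + c' * d * (x * y) by ring.
  by rewrite E; field.
apply: tpoly_add; first exact/tpoly_wave/ltnW.
apply: tpoly_add; first exact: tpoly_wave.
case: l ln => [|l] ln.
  have -> : (fun s => c' * d / 2 * cos (0%:R * (2 * pi * s) + p - 2 * pi * s)) =
      (fun s => c' * d / 2 * cos (1%:R * (2 * pi * s) + - p)).
    apply/funext => s; congr (_ * _); rewrite -cosN; congr cos; ring.
  exact: tpoly_wave.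
have -> : (fun s => c' * d / 2 * cos (l.+1%:R * (2 * pi * s) + p - 2 * pi * s)) =
    (fun s => c' * d / 2 * cos (l%:R * (2 * pi * s) + p)).
  by apply/funext => s; congr (_ * cos _); rewrite -natr1; ring.
by apply: tpoly_wave; exact/leqW/ltnW.
Qed.

(** This is cos(pi s)^(2n), the unnormalised de la Vallee Poussin kernel. With [sin2], which is
    sin(pi s)^2, it satisfies fejer (n+1) = fejer n (1 - sin2), so its concentration can be read off
    from its averages alone. *)
Definition fejer (n : nat) (s : R) : R := ((1 + cos (2 * pi * s)) / 2) ^+ n.
Definition sin2 (s : R) : R := (1 - cos (2 * pi * s)) / 2.

Lemma fejer_ge0 n s : 0 <= fejer n s.
Proof. by rewrite exprn_ge0 //; have := cos_geN1 (2 * pi * s); lra. Qed.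

Lemma sin2_ge0 s : 0 <= sin2 s.
Proof. by rewrite /sin2; have := cos_le1 (2 * pi * s); lra. Qed.

Lemma tpoly_fejer n : tpoly n (fejer n).
Proof.
elim: n => [|n IH].
  have -> : fejer 0 = (fun s => 1 * cos (0%:R * (2 * pi * s) + 0)).
    by apply/funext => s; rewrite /fejer expr0 mul0r addr0 cos0 mulr1.
  exact: tpoly_wave.
have -> : fejer n.+1 = (fun s => fejer n s * (1 / 2 + 1 / 2 * cos (2 * pi * s))).
  by apply/funext => s; rewrite /fejer exprSr; congr (_ * _); field.
exact: tpoly_mul_cos.
Qed.

Lemma fejer_avg : exists A : nat -> R, forall n m s, (n < m)%N ->
  \sum_(j < m) fejer n (s - j%:R / m%:R) = m%:R * A n.
Proof.
have [A HA] := choice (fun n => tpoly_avg (tpoly_fejer n)).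
by exists A => n m s nm; apply: HA.
Qed.

(** Averages over equidistant nodes replace integrals. The weighted mean of [sin2] is (A n - A
    (n+1)) / A n. It is small for some [n], because A n >= 1/(n+1), by the node at 0, rules out
    geometric decay. *)
Lemma fejer_weights (d : R) : 0 < d < 1 -> exists m (w : nat -> R -> R) n k,
  [/\ forall j s, w j s = k * fejer n (s - j%:R / m%:R), 0 <= k,
    forall s, \sum_(j < m) w j s = 1 &
    forall s, \sum_(j < m) w j s * sin2 (s - j%:R / m%:R) <= d].
Proof.
move=> /andP[d0 d1]; have [A HA] := fejer_avg.
have A0 n : 1 / n.+1%:R <= A n.
  rewrite ler_pdivrMr ?ltr0n // mulrC -(HA n n.+1 0) // big_ord_recl /=.
  rewrite mul0r subr0 /fejer mulr0 cos0 (_ : (1 + 1) / 2 = 1 :> R); last by field.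
  rewrite expr1n.
  by rewrite lerDl sumr_ge0 // => i _; rewrite fejer_ge0.
have Ap n : 0 < A n by apply: lt_le_trans (A0 n); rewrite divr_gt0 ?ltr0n.
have [n Hn] : exists n, A n - A n.+1 <= d * A n.
  apply: contrapT => /forallNP H.
  have {}H n : A n.+1 <= (1 - d) * A n.
    by have /negP := H n; rewrite -ltNge; lra.
  have A00 : A 0%N = 1.
    have := HA 0%N 1%N 0 isT; rewrite big_ord1 /fejer expr0; lra.
  (* Quadratic decay already contradicts A k >= 1/(k+1). The induction rests on (1 - d) (2 + x +
     d)^2 <= (2 + x)^2 for x >= 0. *)
  have Hk k : A k * (2 + k%:R * d) ^+ 2 <= 4.
    elim: k => [|k IH]; first by rewrite A00 expr2; lra.
    apply: le_trans IH; rewrite -[k.+1%:R]natr1.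
    have x2 : 0 <= k%:R * d by rewrite mulr_ge0 // ltW.
    apply: (@le_trans _ _ ((1 - d) * A k * (2 + (k%:R + 1) * d) ^+ 2)).
      by apply: ler_wpM2r; [exact: sqr_ge0|exact: H].
    rewrite -mulrA mulrCA; apply: ler_wpM2l; first exact: ltW.
    rewrite (mulrDl k%:R 1 d) mul1r; set x := k%:R * d in x2 *.
    rewrite !expr2.
    have : 0 <= d * (x * (2 + x)) by rewrite mulr_ge0 ?(ltW d0) // mulr_ge0 //; lra.
    have : 0 <= d * d * (3 + 2 * x) by rewrite mulr_ge0 ?mulr_ge0 ?(ltW d0) //; lra.
    have : 0 <= d * d * d by rewrite !mulr_ge0 ?(ltW d0).
    lra.
  pose k := Num.truncn (4 / d ^+ 2).
  have d20 : 0 < d ^+ 2 by rewrite exprn_gt0.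
  have kI : 4 / d ^+ 2 < k.+1%:R by apply: truncnS_gt.
  have k4 : 4 < k.+1%:R * d ^+ 2 by rewrite -ltr_pdivrMr.
  have := le_trans (ler_wpM2r (sqr_ge0 (2 + k.+1%:R * d)) (A0 k.+1)) (Hk k.+1).
  rewrite mulrAC mul1r ler_pdivrMr ?ltr0n // -[k.+2%:R]natr1.
  have K0 : 0 < k.+1%:R :> R by rewrite ltr0n.
  set K := k.+1%:R in kI k4 K0 *.
  have : 4 * K < K * d ^+ 2 * K by rewrite ltr_pM2r.
  have : 0 < K * d by rewrite mulr_gt0.
  rewrite !expr2; lra.
pose k := (n.+2%:R * A n)^-1.
have k0 : 0 < k by rewrite invr_gt0 mulr_gt0 ?ltr0n.
(* The number of nodes must exceed n + 1, since [fejer n.+1] is averaged over them too. *)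
exists n.+2, (fun j s => k * fejer n (s - j%:R / n.+2%:R)), n, k; split => //.
- exact: ltW.
- move=> s; rewrite -mulr_sumr HA // /k mulVf // mulf_neq0 ?gt_eqF ?ltr0n //.
- move=> s.
  have -> : \sum_(j < n.+2) k * fejer n (s - j%:R / n.+2%:R) * sin2 (s - j%:R / n.+2%:R)
     = k * (\sum_(j < n.+2) fejer n (s - j%:R / n.+2%:R) -
            \sum_(j < n.+2) fejer n.+1 (s - j%:R / n.+2%:R)).
    rewrite -sumrB mulr_sumr; apply: eq_bigr => j _; rewrite -mulrA; congr (_ * _).
    by rewrite /fejer exprSr /sin2; field.
  rewrite !HA // -mulrBr /k mulrC ler_pdivrMr ?mulr_gt0 ?ltr0n //.
  by rewrite mulrCA ler_wpM2l.
Qed.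
End TrigApprox.

Section TrigDense.
Variable R : realType.
Implicit Types (f g : R -> R) (u : R * R -> R) (B C e : R).

Inductive trig : (R * R -> R) -> Prop :=
| trig_wave (c k1 k2 p : R) : trig (fun y => c * cos (k1 * y.1 + k2 * y.2 + p))
| trig_add u v : trig u -> trig v -> trig (fun y => u y + v y).

Lemma trig_scale c u : trig u -> trig (fun y => c * u y).
Proof.
elim=> [c' k1 k2 p|{}u v _ Hu _ Hv].
  by under eq_fun do rewrite mulrA; exact: trig_wave.
by under eq_fun do rewrite mulrDr; exact: trig_add.
Qed.

Lemma trig_mul u v : trig u -> trig v -> trig (fun y => u y * v y).
Proof.
move=> Hu; elim=> [c k1 k2 p|{}v w _ Hv _ Hw]; last first.
  by under eq_fun do rewrite mulrDr; exact: trig_add.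
elim: Hu => [c' k1' k2' p'|{}u v' _ Hu _ Hv']; last first.
  by under eq_fun do rewrite mulrDl; exact: trig_add.
have -> : (fun y : R * R => c' * cos (k1' * y.1 + k2' * y.2 + p') *
     (c * cos (k1 * y.1 + k2 * y.2 + p))) =
   (fun y => c' * c / 2 * cos ((k1' + k1) * y.1 + (k2' + k2) * y.2 + (p' + p)) +
             c' * c / 2 * cos ((k1' - k1) * y.1 + (k2' - k2) * y.2 + (p' - p))).
  apply/funext => y; rewrite mulrACA cos_mul_cos.
  set a := cos _; set b := cos _; set a' := cos _; set b' := cos _.
  have -> : a = a' by rewrite /a /a'; congr cos; ring.
  have -> : b = b' by rewrite /b /b'; congr cos; ring.
  by field.
by apply: trig_add; exact: trig_wave.
Qed.

Lemma trig_cst c : trig (fun=> c).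
Proof.
have -> : (fun _ : R * R => c) = (fun y => c * cos (0 * y.1 + 0 * y.2 + 0)).
  by apply/funext => y; rewrite !mul0r !addr0 cos0 mulr1.
exact: trig_wave.
Qed.

Lemma trig_sum m (F : nat -> R * R -> R) : (forall j, trig (F j)) ->
  trig (fun y => \sum_(j < m) F j y).
Proof.
move=> H; elim: m => [|m IH].
  by under eq_fun do rewrite big_ord0; exact: trig_cst.
by under eq_fun do rewrite big_ord_recr /=; exact: trig_add.
Qed.

Lemma trig_tpoly1 n f b : tpoly n f -> trig (fun y => f (y.1 - b)).
Proof.
elim=> [l c p _|{}f g _ Hf _ Hg]; last exact: trig_add.
have -> : (fun y : R * R => c * cos (l%:R * (2 * pi * (y.1 - b)) + p)) =
  (fun y => c * cos (l%:R * 2 * pi * y.1 + 0 * y.2 + (p - l%:R * 2 * pi * b))).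
  by apply/funext => y; congr (_ * cos _); ring.
exact: trig_wave.
Qed.

Lemma trig_tpoly2 n f b : tpoly n f -> trig (fun y => f (y.2 - b)).
Proof.
elim=> [l c p _|{}f g _ Hf _ Hg]; last exact: trig_add.
have -> : (fun y : R * R => c * cos (l%:R * (2 * pi * (y.2 - b)) + p)) =
  (fun y => c * cos (0 * y.1 + l%:R * 2 * pi * y.2 + (p - l%:R * 2 * pi * b))).
  by apply/funext => y; congr (_ * cos _); ring.
exact: trig_wave.
Qed.

Lemma sin2_int (s : R) (n : int) : sin2 (s + n%:~R) = sin2 s.
Proof.
have nat_case (k : nat) (r : R) : cos (2 * pi * (r + k%:R)) = cos (2 * pi * r).
  have := periodicn (@cosD2pi R) k (2 * pi * r) => <-.
  by congr cos; rewrite -mulr_natr -[pi *+ 2]mulr_natr; ring.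
rewrite /sin2; case: n => k; first by rewrite nat_case.
rewrite NegzE mulrNz; have := nat_case k.+1 (s - k.+1%:R).
by rewrite subrK => ->.
Qed.

Lemma sin2_eq0 (s : R) : -1 <= s <= 1 -> sin2 s = 0 -> exists n : int, s = n%:~R.
Proof.
move=> sI; have -> : sin2 s = sin (pi * s) ^+ 2.
  rewrite /sin2; have -> : 2 * pi * s = pi * s *+ 2 by rewrite -mulr_natr; ring.
  by rewrite cos_mulr2n sin2cos2; field.
move/eqP; rewrite sqrf_eq0 => /eqP s0.
have pi0 := pi_gt0 R.
have pos (r : R) : 0 < r -> r < 1 -> sin (pi * r) <> 0.
  move=> r0 r1; apply/eqP; rewrite gt_eqF // sin_gt0_pi // mulr_gt0 //=.
  by rewrite gtr_pMr.
have [->|/eqP sN1] := eqVneq s (-1); first by exists (-1); rewrite mulrNz.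
have [->|/eqP s1] := eqVneq s 1; first by exists 1.
have [->|/eqP sn0] := eqVneq s 0; first by exists 0.
case: (ltrP 0 s) => sp.
  by case: (pos s) => //; rewrite lt_neqAle; case/andP: sI => _ ->; rewrite andbT; apply/eqP.
case: (pos (- s)).
- by rewrite oppr_gt0 lt_neqAle sp andbT; apply/eqP.
- rewrite ltrNl lt_neqAle; case/andP: sI => -> _; rewrite andbT.
  by apply/eqP => E; apply: sN1.
- by rewrite mulrN sinN s0 oppr0.
Qed.

Lemma continuous_sin2 : continuous (@sin2 R).
Proof.
have cc : continuous (fun s : R => cos (2 * pi * s)).
  have cl : continuous (fun s : R => 2 * pi * s) by cont.
  move=> x; apply: (@continuous_comp _ _ _ (fun s => 2 * pi * s) (@cos R)).
    exact: cl.
  exact: continuous_cos.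
by rewrite /sin2; cont.
Qed.

Lemma Z2periodicE u : Z2periodic u -> forall (m n : int) (y1 y2 : R),
  u (y1 + m%:~R, y2 + n%:~R) = u (y1, y2).
Proof. by move=> pu m n y1 y2; exact: (pu m n (y1, y2)). Qed.

Lemma continuous_norm (T : topologicalType) (f : T -> R) : continuous f ->
  continuous (fun x => `|f x|).
Proof.
move=> cf x.
exact: (@continuous_comp _ _ _ f (fun x => `|x|) x (cf x) (@norm_continuous _ _ _)).
Qed.

Lemma periodic_bounded u : Z2periodic u -> continuous u -> exists B, forall y, `|u y| <= B.
Proof.
move=> pu cu.
pose A := `[(0 : R), 1] `*` `[(0 : R), 1].
have A0 : A !=set0 by exists (0, 0); split; rewrite /= in_itv /=; lra.
have cA : compact A by apply: compact_setX; apply: segment_compact.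
have cnu : continuous (fun y => `|u y|).
  exact: continuous_norm.
have [m _ mx] := compact_EVT_max A0 cA (continuous_subspaceT cnu).
exists (`|u m|) => -[y1 y2].
have [n1 n1I] := int_shift 0 y1; have [n2 n2I] := int_shift 0 y2.
rewrite -(Z2periodicE pu n1 n2).
rewrite add0r in n1I n2I.
by apply: mx; rewrite inE; split; rewrite /= in_itv /= ?n1I ?n2I.
Qed.

(** Uniform continuity in a form that can be averaged against the weights, [sin2] measuring the
    distance to the integers. On the compact set of pairs where [u] varies by at least [e], the sum
    of the two [sin2] has a positive minimum, and [C] is [2 B] divided by it. *)
Lemma periodic_modulus u e : Z2periodic u -> continuous u -> 0 < e ->
  exists C, 0 <= C /\ forall y z, `|u z - u y| <= e + C * (sin2 (z.1 - y.1) + sin2 (z.2 - y.2)).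
Proof.
move=> pu cu e0; have [B uB] := periodic_bounded pu cu.
pose K := (`[(0 : R), 1] `*` `[(0 : R), 1]) `*` (`[(0 : R), 1] `*` `[(0 : R), 1]).
have cK : compact K by do !apply: compact_setX; apply: segment_compact.
pose du (p : (R * R) * (R * R)) := `|u p.2 - u p.1|.
have cdu : continuous du.
  have cd : continuous (fun p : (R * R) * (R * R) => u p.2 - u p.1).
    apply: (@ctsD _ _ (fun p => u p.2) (fun p => - u p.1)); last apply: (@ctsN _ _ (fun p => u p.1)).
      by move=> p; exact: (@continuous_comp _ _ _ snd u p (@cts_snd _ _ p) (cu p.2)).
    by move=> p; exact: (@continuous_comp _ _ _ fst u p (@cts_fst _ _ p) (cu p.1)).
  exact: (continuous_norm cd).
pose P := K `&` [set p | e <= du p].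
have cP : compact P.
  apply: compact_closedI => //.
  rewrite (_ : [set p | e <= du p] = du @^-1` [set x | e <= x]) //.
  by apply: closed_comp; [move=> p _; exact: cdu|exact: closed_ge].
pose S (p : (R * R) * (R * R)) := sin2 (p.2.1 - p.1.1) + sin2 (p.2.2 - p.1.2).
have cS : continuous S.
  have cs (q : (R * R) * (R * R) -> R) : continuous q -> continuous (fun p => sin2 (q p)).
    move=> cf p; apply: (@continuous_comp _ _ _ q (@sin2 R)); first exact: cf.
    exact: continuous_sin2.
  have c1 : continuous (fun p : (R * R) * (R * R) => p.2.1 - p.1.1).
    exact: (ctsD (f := fun p : (R * R) * (R * R) => p.2.1) (cts_fst_comp (@cts_snd _ _))
      (ctsN (f := fun p : (R * R) * (R * R) => p.1.1) (cts_fst_comp (@cts_fst _ _)))).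
  have c2 : continuous (fun p : (R * R) * (R * R) => p.2.2 - p.1.2).
    exact: (ctsD (f := fun p : (R * R) * (R * R) => p.2.2) (cts_snd_comp (@cts_snd _ _))
      (ctsN (f := fun p : (R * R) * (R * R) => p.1.2) (cts_snd_comp (@cts_fst _ _)))).
  exact: (ctsD (cs _ c1) (cs _ c2)).
have B0 : 0 <= B by apply: le_trans (uB (0, 0)).
have duB p : du p <= 2 * B.
  by apply: le_trans (ler_normB _ _) _; have := uB p.1; have := uB p.2; lra.
have S0 p : 0 <= S p by rewrite addr_ge0 // sin2_ge0.
have reduce y z : exists p, [/\ K p, du p = `|u z - u y| &
    S p = sin2 (z.1 - y.1) + sin2 (z.2 - y.2)].
  case: y => y1 y2; case: z => z1 z2.
  have [n1 n1I] := int_shift 0 y1; have [n2 n2I] := int_shift 0 y2.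
  have [m1 m1I] := int_shift 0 z1; have [m2 m2I] := int_shift 0 z2.
  exists ((y1 + n1%:~R, y2 + n2%:~R), (z1 + m1%:~R, z2 + m2%:~R)); split.
  - by do !split; rewrite /= in_itv /=; rewrite add0r in n1I n2I m1I m2I.
  - by rewrite /du !Z2periodicE.
  - rewrite /S /=; congr (_ + _).
      by rewrite -(sin2_int (z1 - y1) (m1 - n1)) intrB; congr sin2; ring.
    by rewrite -(sin2_int (z2 - y2) (m2 - n2)) intrB; congr sin2; ring.
have [P0|/set0P P0] := eqVneq P set0.
  exists 0; split => // y z; have [p [Kp <- _]] := reduce y z.
  rewrite mul0r addr0 leNgt; apply/negP => ep.
  have : P p by split => //=; exact: ltW.
  by rewrite P0.
have [m mP mn] := compact_EVT_min P0 cP (continuous_subspaceT cS).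
have Sm : 0 < S m.
  rewrite lt_neqAle S0 andbT; apply/eqP => /esym Sm0.
  move: mP; rewrite inE => -[[[/= ]]]; rewrite !in_itv /= => a1 a2 [b1 b2].
  have [/eqP s1 /eqP s2] : sin2 (m.2.1 - m.1.1) == 0 /\ sin2 (m.2.2 - m.1.2) == 0.
    by apply/andP; rewrite -paddr_eq0 ?sin2_ge0 //; apply/eqP.
  have [|k1 k1E] := sin2_eq0 _ s1; first by lra.
  have [|k2 k2E] := sin2_eq0 _ s2; first by lra.
  rewrite /du (_ : m.2 = (m.1.1 + k1%:~R, m.1.2 + k2%:~R)); last first.
    by rewrite -k1E -k2E !subrKC -surjective_pairing.
  by rewrite Z2periodicE // -surjective_pairing subrr normr0 leNgt e0.
exists (2 * B / S m); split; first by rewrite divr_ge0 ?mulr_ge0 // ltW.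
move=> y z; have [p [Kp <- <-]] := reduce y z.
case: (leP e (du p)) => ep; last first.
  apply: ler_wpDr; last exact: ltW.
  by rewrite mulr_ge0 // divr_ge0 ?mulr_ge0 // ltW.
apply: ler_wpDl; first exact: ltW.
apply: le_trans (duB p) _; rewrite mulrAC ler_pdivlMr //.
by apply: ler_wpM2l; [rewrite mulr_ge0|apply: mn; rewrite inE].
Qed.

(** Sampling [u] on a grid with product weights is a positive operator that fixes constants. Its
    error is at most the weighted mean of the modulus in [periodic_modulus], which splits into the
    two coordinates. *)
Theorem trig_dense u e : Z2periodic u -> continuous u -> 0 < e ->
  exists2 p, trig p & forall y, `|u y - p y| <= e.
Proof.
move=> pu cu e0.
have e2 : 0 < e / 2 by lra.
have [C [C0 HC]] := periodic_modulus pu cu e2.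
(* This gives d < 1 and 4 C d <= e, so the two [sin2] terms together cost at most e/2. *)
pose d := e / (4 * C + 2 * e).
have dd : 0 < 4 * C + 2 * e by lra.
have d0 : 0 < d < 1 by rewrite divr_gt0 //= ltr_pdivrMr //; lra.
have [m [w [n [k [wE k0 w1 wd]]]]] := fejer_weights d0.
have w0 j s : 0 <= w j s by rewrite wE mulr_ge0 // fejer_ge0.
pose node (i j : nat) : R * R := (i%:R / m%:R, j%:R / m%:R).
exists (fun y => \sum_(i < m) \sum_(j < m) u (node i j) * (w i y.1 * w j y.2)).
  apply: (@trig_sum _ (fun i y => \sum_(j < m) u (node i j) * (w i y.1 * w j y.2))) => i.
  apply: (@trig_sum _ (fun j y => u (node i j) * (w i y.1 * w j y.2))) => j.
  apply/trig_scale/trig_mul.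
    under eq_fun do rewrite wE.
    exact/trig_scale/(@trig_tpoly1 n)/tpoly_fejer.
  under eq_fun do rewrite wE.
  exact/trig_scale/(@trig_tpoly2 n)/tpoly_fejer.
move=> y.
have sum1 : \sum_(i < m) \sum_(j < m) w i y.1 * w j y.2 = 1.
  by under eq_bigr do rewrite -mulr_sumr w1 mulr1; rewrite w1.
have -> : u y - \sum_(i < m) \sum_(j < m) u (node i j) * (w i y.1 * w j y.2) =
   \sum_(i < m) \sum_(j < m) (u y - u (node i j)) * (w i y.1 * w j y.2).
  rewrite -[in LHS](mulr1 (u y)) -[in LHS]sum1 mulr_sumr -sumrB.
  apply: eq_bigr => i _; rewrite mulr_sumr -sumrB.
  by apply: eq_bigr => j _; rewrite mulrBl.
apply: (@le_trans _ _ (\sum_(i < m) \sum_(j < m)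
    (e / 2 + C * (sin2 (y.1 - i%:R / m%:R) + sin2 (y.2 - j%:R / m%:R))) * (w i y.1 * w j y.2))).
  apply: le_trans (ler_norm_sum _ _ _) _; apply: ler_sum => i _.
  apply: le_trans (ler_norm_sum _ _ _) _; apply: ler_sum => j _.
  rewrite normrM [X in _ * X]ger0_norm ?mulr_ge0 //.
  by apply: ler_wpM2r; [rewrite mulr_ge0|exact: (HC (node i j) y)].
have -> : \sum_(i < m) \sum_(j < m)
    (e / 2 + C * (sin2 (y.1 - i%:R / m%:R) + sin2 (y.2 - j%:R / m%:R))) * (w i y.1 * w j y.2) =
   e / 2 * (\sum_(i < m) \sum_(j < m) w i y.1 * w j y.2) +
   C * (\sum_(i < m) w i y.1 * sin2 (y.1 - i%:R / m%:R)) * (\sum_(j < m) w j y.2) +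
   C * (\sum_(i < m) w i y.1) * (\sum_(j < m) w j y.2 * sin2 (y.2 - j%:R / m%:R)).
  rewrite mulr_sumr -!mulrA !mulr_suml !mulr_sumr -!big_split /=.
  apply: eq_bigr => i _.
  rewrite !mulr_sumr -!big_split /=.
  by apply: eq_bigr => j _; ring.
rewrite sum1 !w1 !mulr1.
have Cd (s : R) : C * (\sum_(i < m) w i s * sin2 (s - i%:R / m%:R)) <= C * d.
  by apply: ler_wpM2l.
have dE : 4 * (C * d) <= e.
  rewrite /d mulrA mulrA ler_pdivrMr //; have : 0 < e * e by rewrite mulr_gt0.
  lra.
have := Cd y.1; have := Cd y.2; lra.
Qed.
End TrigDense.

Local Notation leb2 R := (@lebesgue_measure R \x @lebesgue_measure R)%E.

(** * Dilated averages *)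

Section PlaneMeasure.
Variable R : realType.
Local Notation mR := (measurableTypeR R).
Local Notation mu := (@lebesgue_measure R).

(** The plane carries the product sigma-algebra, so an open set has to be exhibited as a countable
    union of rational boxes. *)
Lemma open_measurable2 (O : set (R * R)) : open O -> @measurable _ (mR * mR)%type O.
Proof.
move=> oO.
pose box (i : rat * rat * (rat * rat)) : set (R * R) :=
  `]ratr i.1.1, ratr i.1.2[ `*` `]ratr i.2.1, ratr i.2.2[.
pose F i := if `[< box i `<=` O >] then box i else set0.
have -> : O = \bigcup_i F i.
  apply/seteqP; split => [y Oy|y [i _]]; last first.
    by rewrite /F; case: asboolP => // bO /bO.
  have [e /= e0 eO] : exists2 e, 0 < e & ball y e `<=` O by apply/nbhs_ballP/open_nbhs_nbhs.
  have rat_near (r : R) : exists p : rat * rat,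
      [/\ r - e < ratr p.1, ratr p.1 < r, r < ratr p.2 & ratr p.2 < r + e].
    have [p] := @rat_in_itvoo R (r - e) r (ltac:(lra)).
    have [q] := @rat_in_itvoo R r (r + e) (ltac:(lra)).
    by rewrite !in_itv /= => /andP[? ?] /andP[? ?]; exists (p, q).
  have [p [p1 p2 p3 p4]] := rat_near y.1; have [q [q1 q2 q3 q4]] := rat_near y.2.
  exists (p, q) => //; rewrite /F; case: asboolP => [_|].
    by split; rewrite /= in_itv /= ?p2 ?q2.
  case; move=> z [/=]; rewrite !in_itv /= => /andP[z1 z2] /andP[z3 z4].
  by apply: eO; split; rewrite /ball /= ltr_norml; lra.
apply: countable_bigcupT_measurable; first exact: countableP.
move=> i; rewrite /F; case: asboolP => _; last exact: measurable0.
by apply: measurableX; exact: measurable_itv.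
Qed.

Lemma continuous_measurable2 (f : R * R -> R) : continuous f ->
  measurable_fun [set: mR * mR] f.
Proof.
move=> /continuousP cf; apply: (measurability _ (measurable_realfun.RGenOpens.measurableE R)).
move=> _ [_ [a [b ->] <-]]; rewrite setTI; apply: open_measurable2.
exact/cf/interval_open.
Qed.

Lemma lebesgue_measure_reflect (c : R) (A : set R) : measurable A ->
  mu ((fun x : R => c - x) @^-1` A) = mu A.
Proof.
move=> mA; apply/esym.
have mc : measurable_fun setT ((fun x : R => c - x) : mR -> mR).
  by apply: continuous_measurable_fun; cont.
apply: (@lebesgue_measure_unique R (pushforward mu ((fun x : R => c - x) : mR -> mR))) => //.
move=> _ [[a b]] _ <-; transitivity (mu `[c - b, c - a[%classic).
  rewrite !lebesgue_measure_itv /= !lte_fin.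
  by rewrite ltrD2l ltrN2; case: ifP => // _; rewrite -!EFinB; congr EFin; ring.
congr (mu _); apply/seteqP.
by split => x /=; rewrite !in_itv /= => /andP[? ?]; apply/andP; split; lra.
Qed.

Lemma leb2_reflect (y : R * R) (A : set (mR * mR)) : measurable A ->
  (leb2 R) ((fun z : R * R => y - z) @^-1` A) = (leb2 R) A.
Proof.
move=> mA; apply/esym.
have mphi : measurable_fun setT ((fun z : R * R => y - z) : mR * mR -> mR * mR).
  apply/measurable_fun_pairP; split; apply: continuous_measurable2.
    by apply: ctsD; [exact: cts_cst|apply: ctsN; exact: cts_fst].
  by apply: ctsD; [exact: cts_cst|apply: ctsN; exact: cts_snd].
apply: (@product_measure_unique _ _ _ _ _ _ _
  (pushforward (leb2 R) ((fun z : R * R => y - z) : mR * mR -> mR * mR))) => //.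
move=> B C mB mC.
transitivity ((leb2 R) (((fun x : R => y.1 - x) @^-1` B) `*` ((fun x : R => y.2 - x) @^-1` C)));
  first by [].
have mr (c : R) (D : set R) : measurable D -> measurable ((fun x : R => c - x) @^-1` D).
  move=> mD; rewrite -[X in measurable X]setTI.
  have mc : measurable_fun setT ((fun x : R => c - x) : mR -> mR).
    by apply: continuous_measurable_fun; cont.
  exact: mc.
by rewrite product_measure1E /=; [rewrite !lebesgue_measure_reflect|exact: mr|exact: mr].
Qed.

Lemma Rintegral_reflect (y : R * R) (G : R * R -> R) : continuous G ->
  (leb2 R).-integrable setT (EFin \o (fun z => G (y - z))) ->
  \int[leb2 R]_(z in setT) G (y - z) = \int[leb2 R]_(z in setT) G z.
Proof.
move=> cG iG; rewrite /Rintegral; congr fine.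
have mphi : measurable_fun setT ((fun z : R * R => y - z) : mR * mR -> mR * mR).
  apply/measurable_fun_pairP; split; apply: continuous_measurable2.
    by apply: ctsD; [exact: cts_cst|apply: ctsN; exact: cts_fst].
  by apply: ctsD; [exact: cts_cst|apply: ctsN; exact: cts_snd].
have mG : measurable_fun [set: mR * mR] (EFin \o G).
  by apply/measurable_EFinP; exact: continuous_measurable2.
have := @integral_pushforward _ _ _ _ R _ mphi (leb2 R) setT (EFin \o G) mG iG measurableT.
rewrite preimage_setT => <-.
by apply: eq_measure_integral => A mA _; exact: leb2_reflect.
Qed.

Lemma integral_oneDsqrV_lty : (\int[mu]_x ((oneDsqr x)^-1)%:E < +oo)%E.
Proof.
have mf : measurable_fun [set: mR] (fun x : R => ((oneDsqr x)^-1)%:E).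
  apply/measurable_EFinP; apply: continuous_measurable_fun.
  exact: continuous_oneDsqrV.
have f0 (x : R) : (0 <= ((oneDsqr x)^-1)%:E)%E.
  by rewrite lee_fin invr_ge0 addr_ge0 // sqr_ge0.
have E : [set: mR] = `]-oo, 0%R[%classic `|` `[0%R, +oo[%classic.
  by apply/seteqP; split => x //= _; rewrite !in_itv /= andbT; case: (ltrP x 0); [left|right].
rewrite E ge0_integral_setU //; first last.
- by apply/disj_setPS => x [/=]; rewrite !in_itv /= andbT ltNge => /negbTE ->.
- by rewrite -E.
have half : (\int[mu]_(x in `[0%R, +oo[) ((oneDsqr x)^-1)%:E < +oo)%E.
  by rewrite integral0y_oneDsqr ltry.
rewrite lte_add_pinfty //.
apply: le_lt_trans half.
rewrite (ge0_integration_by_substitution0 mf f0).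
under [leRHS]eq_integral do rewrite /oneDsqr sqrrN.
apply: ge0_subset_integral => //; first exact: measurable_funS mf.
by move=> x /=; rewrite !in_itv /= => /ltW.
Qed.

(** The common integrable majorant of all integrands below; [weight_shift] makes it stable under
    reflection and translation. *)
Definition weight (w : R * R) : R := (oneDsqr w.1)^-1 * (oneDsqr w.2)^-1.

Lemma weight_gt0 w : 0 < weight w.
Proof. by rewrite mulr_gt0 // invr_gt0 (lt_le_trans ltr01) // oneDsqr_ge1. Qed.

Lemma continuous_weight : continuous weight.
Proof.
have c1 : continuous (fun w : R * R => (oneDsqr w.1)^-1).
  move=> w; apply: (@continuous_comp _ _ _ fst (fun x : R => (oneDsqr x)^-1)); first exact: cts_fst.
  exact: continuous_oneDsqrV.
have c2 : continuous (fun w : R * R => (oneDsqr w.2)^-1).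
  move=> w; apply: (@continuous_comp _ _ _ snd (fun x : R => (oneDsqr x)^-1)); first exact: cts_snd.
  exact: continuous_oneDsqrV.
exact: (ctsM c1 c2).
Qed.

Lemma integrable_weight : (leb2 R).-integrable setT (EFin \o weight).
Proof.
have mw : measurable_fun [set: mR * mR] (EFin \o weight).
  by apply/measurable_EFinP; exact: (continuous_measurable2 continuous_weight).
apply/integrableP; split => //.
under eq_integral do rewrite gee0_abs ?lee_fin ?(ltW (weight_gt0 _)) //.
rewrite fubini_tonelli1 //; last by move=> w; rewrite lee_fin ltW // weight_gt0.
have mf : measurable_fun [set: mR] (fun x : R => ((oneDsqr x)^-1)%:E).
  apply/measurable_EFinP; apply: continuous_measurable_fun.
  exact: continuous_oneDsqrV.
have f0 (x : R) : (0 <= ((oneDsqr x)^-1)%:E)%E.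
  by rewrite lee_fin invr_ge0 addr_ge0 // sqr_ge0.
have I0 : (0 <= \int[mu]_x ((oneDsqr x)^-1)%:E)%E by apply: integral_ge0.
rewrite /fubini_F /=.
under eq_integral => x _.
  rewrite /weight /=; under eq_integral do rewrite EFinM.
  rewrite ge0_integralZl //.
  over.
rewrite ge0_integralZr //.
by apply: lte_mul_pinfty => //; rewrite ?ge0_fin_numE // integral_oneDsqrV_lty.
Qed.
End PlaneMeasure.

Section Rapid.
Variable R : realType.
Local Notation mR := (measurableTypeR R).
Implicit Types (f g u v : R * R -> R) (B C e s : R) (y w : R * R).

Definition weight_mass : R := \int[leb2 R]_(w in setT) weight w.

Lemma weight_mass_ge0 : 0 <= weight_mass.
Proof. by apply: Rintegral_ge0 => w _; rewrite ltW // weight_gt0. Qed.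

Lemma weight_integrable g C : continuous g -> (forall w, `|g w| <= C * weight w) ->
  (leb2 R).-integrable setT (EFin \o g).
Proof.
move=> cg gC.
apply: (@le_integrable _ _ _ (leb2 R) setT measurableT _ (fun w => C%:E * (EFin \o @weight R) w)%E).
- by apply/measurable_EFinP; exact: continuous_measurable2.
- move=> w _; rewrite /= lee_fin; apply: le_trans (gC w) _.
  exact: ler_norm.
- by apply: integrableZl => //; exact: integrable_weight.
Qed.

Lemma weight_Rintegral g C : continuous g -> (forall w, `|g w| <= C * weight w) ->
  `|\int[leb2 R]_(w in setT) g w| <= C * weight_mass.
Proof.
move=> cg gC; have ig := weight_integrable cg gC.
apply: le_trans (le_normr_Rintegral measurableT ig) _.
rewrite /weight_mass -RintegralZl //; last exact: integrable_weight.
apply: le_Rintegral => //.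
- exact: (integrable_norm ig).
- have cW : continuous (fun w : R * R => C * weight w).
    exact: (ctsM (@cts_cst _ _ C) (@continuous_weight R)).
  have CW w : `|C * weight w| <= `|C| * weight w.
    by rewrite normrM (gtr0_norm (weight_gt0 w)).
  exact: (weight_integrable cW CW).
Qed.

(** Of the two powers of the product of [oneDsqr], one absorbs [growth] and the other leaves the
    integrable [weight]. *)
Definition rapid g : Prop := continuous g /\ exists C, 0 <= C /\
  forall w, `|g w| * (oneDsqr w.1 * oneDsqr w.2) ^+ 2 <= C.

Lemma schwartz_rapid f m n : schwartz f -> rapid (iter m (@d1 R) (iter n (@d2 R) f)).
Proof.
move=> /(_ m n) /=; set g := iter m _ _ => -[dg bg].
split; first by move=> w; exact: differentiable_continuous.
have [C00 H00] := bg 0%N 0%N; have [C02 H02] := bg 0%N 2%N; have [C04 H04] := bg 0%N 4%N.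
have [C20 H20] := bg 2%N 0%N; have [C22 H22] := bg 2%N 2%N; have [C24 H24] := bg 2%N 4%N.
have [C40 H40] := bg 4%N 0%N; have [C42 H42] := bg 4%N 2%N; have [C44 H44] := bg 4%N 4%N.
have key w : `|g w| * (oneDsqr w.1 * oneDsqr w.2) ^+ 2 <=
    C00 + 2 * C02 + C04 + 2 * (C20 + 2 * C22 + C24) + (C40 + 2 * C42 + C44).
  have := H00 w; have := H02 w; have := H04 w; have := H20 w; have := H22 w.
  have := H24 w; have := H40 w; have := H42 w; have := H44 w.
  have nm (x y z : R) : `|x * y * z| = `|x| * `|y| * `|z| by rewrite !normrM.
  rewrite !nm.
  have e2 (x : R) : `|x ^+ 2| = x ^+ 2 by rewrite ger0_norm // sqr_ge0.
  have e4 (x : R) : `|x ^+ 4| = x ^+ 4 by rewrite ger0_norm // -[4%N]/(2 * 2)%N exprM sqr_ge0.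
  rewrite !e2 !e4 !expr0 normr1 /oneDsqr.
  have -> : `|g w| * ((1 + w.1 ^+ 2) * (1 + w.2 ^+ 2)) ^+ 2 =
     1 * 1 * `|g w| + 2 * (1 * w.2 ^+ 2 * `|g w|) + 1 * w.2 ^+ 4 * `|g w| +
     2 * (w.1 ^+ 2 * 1 * `|g w| + 2 * (w.1 ^+ 2 * w.2 ^+ 2 * `|g w|) + w.1 ^+ 2 * w.2 ^+ 4 * `|g w|)
     + (w.1 ^+ 4 * 1 * `|g w| + 2 * (w.1 ^+ 4 * w.2 ^+ 2 * `|g w|) + w.1 ^+ 4 * w.2 ^+ 4 * `|g w|).
    by ring.
  lra.
eexists; split; last exact: key.
apply: le_trans (key (0, 0)).
by rewrite mulr_ge0 // exprn_ge0 // mulr_ge0 // addr_ge0 // sqr_ge0.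
Qed.

(** The square of 1 + rho, with rho the parabolic distance of [w] to the origin. It dominates (1 +
    rho)^kappa for every kappa <= 2. *)
Definition growth (w : R * R) : R := (1 + `|w.1| + Num.sqrt `|w.2|) ^+ 2.

Lemma growth_ge1 w : 1 <= growth w.
Proof.
have := normr_ge0 w.1; have := sqrtr_ge0 `|w.2| => a b.
by rewrite exprn_ege1 //; lra.
Qed.

Lemma growth_le w : growth w <= 6 * (oneDsqr w.1 * oneDsqr w.2).
Proof.
rewrite /growth /oneDsqr; set a := `|w.1|; set b := Num.sqrt `|w.2|.
have aE : w.1 ^+ 2 = a ^+ 2 by rewrite /a -normrX ger0_norm // sqr_ge0.
have bE : w.2 ^+ 2 = b ^+ 2 * b ^+ 2.
  by rewrite /b sqr_sqrtr // -expr2 -normrX ger0_norm // sqr_ge0.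
rewrite aE bE !expr2.
have a0 : 0 <= a by exact: normr_ge0.
have b0 : 0 <= b by exact: sqrtr_ge0.
have := sqr_ge0 (1 - a); have := sqr_ge0 (1 - b); have := sqr_ge0 (a - b).
have := sqr_ge0 (b * b - 1).
have : 0 <= a * a * (b * b * (b * b)) by rewrite !mulr_ge0.
have : 0 <= a * a by rewrite mulr_ge0.
have : 0 <= b * b * (b * b) by rewrite !mulr_ge0.
rewrite !expr2; lra.
Qed.

Lemma rapid_weight g : rapid g -> exists C, 0 <= C /\
  forall w, `|g w| * growth w <= C * weight w.
Proof.
move=> [_ [C [C0 gC]]]; exists (6 * C); split; first by rewrite mulr_ge0.
move=> w; have := gC w; set o := oneDsqr w.1 * oneDsqr w.2.
have o0 : 0 < o by rewrite mulr_gt0 // (lt_le_trans ltr01) // oneDsqr_ge1.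
have -> : weight w = o^-1 by rewrite /weight /o invfM.
rewrite ler_pdivlMr // => H.
apply: le_trans (_ : `|g w| * (6 * o) * o <= _).
  by apply: ler_wpM2r; [exact: ltW|apply: ler_wpM2l => //; exact: growth_le].
by move: H; rewrite expr2; lra.
Qed.

Lemma rapid_le_weight g : rapid g -> exists C, 0 <= C /\ forall w, `|g w| <= C * weight w.
Proof.
move=> /rapid_weight[C [C0 gC]]; exists C; split => // w; apply: le_trans (gC w).
by rewrite ler_peMr // growth_ge1.
Qed.

Lemma continuous_dil (s1 s2 : R) (y : R * R) u : continuous u ->
  continuous (fun w : R * R => u (y.1 + s1 * w.1, y.2 + s2 * w.2)).
Proof.
move=> cu w.
have c1 : continuous (fun w : R * R => y.1 + s1 * w.1) by cont.
have c2 : continuous (fun w : R * R => y.2 + s2 * w.2) by cont.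
by apply: (@continuous_comp _ _ _ (fun w : R * R => (y.1 + s1 * w.1, y.2 + s2 * w.2)) u);
  [exact: (cts_pair c1 c2)|exact: cu].
Qed.

(** Dilating the argument of [u] instead of the kernel avoids a Jacobian and lets the factors be
    arbitrary reals; [dil_approx] uses a negative [s1]. *)
Definition dil f (s1 s2 : R) u (y : R * R) : R :=
  \int[leb2 R]_(w in setT) (f w * u (y.1 + s1 * w.1, y.2 + s2 * w.2)).

Lemma dil_integrable f s1 s2 u y B : rapid f -> continuous u -> (forall z, `|u z| <= B) ->
  (leb2 R).-integrable setT (EFin \o (fun w => f w * u (y.1 + s1 * w.1, y.2 + s2 * w.2))).
Proof.
move=> rf cu uB; have [C [C0 fC]] := rapid_le_weight rf.
apply: (@weight_integrable _ (C * B)).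
  apply: (@ctsM _ _ f (fun w => u (y.1 + s1 * w.1, y.2 + s2 * w.2))); first by case: rf.
  exact: continuous_dil.
by move=> w; rewrite normrM mulrAC; apply: ler_pM.
Qed.

Definition bound_const f (C : R) := 0 <= C /\ forall s1 s2 u y B,
  continuous u -> (forall z, `|u z| <= B) -> `|dil f s1 s2 u y| <= C * B.

Lemma dil_bound f : rapid f -> exists C, bound_const f C.
Proof.
move=> rf; have [C [C0 fC]] := rapid_le_weight rf.
exists (C * weight_mass); split; first by rewrite mulr_ge0 // weight_mass_ge0.
move=> s1 s2 u y B cu uB; rewrite mulrAC; apply: weight_Rintegral.
  apply: (@ctsM _ _ f (fun w => u (y.1 + s1 * w.1, y.2 + s2 * w.2))); first by case: rf.
  exact: continuous_dil.
by move=> w; rewrite normrM mulrAC; apply: ler_pM.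
Qed.

Lemma dilB f s1 s2 u v y B B' : rapid f -> continuous u -> continuous v ->
  (forall z, `|u z| <= B) -> (forall z, `|v z| <= B') ->
  dil f s1 s2 (fun z => u z - v z) y = dil f s1 s2 u y - dil f s1 s2 v y.
Proof.
move=> rf cu cv uB vB; rewrite /dil -RintegralB //; last 2 first.
- exact: dil_integrable uB.
- exact: dil_integrable vB.
by apply: eq_Rintegral => w _; rewrite mulrBr.
Qed.

Lemma dilD f s1 s2 u v y B B' : rapid f -> continuous u -> continuous v ->
  (forall z, `|u z| <= B) -> (forall z, `|v z| <= B') ->
  dil f s1 s2 (fun z => u z + v z) y = dil f s1 s2 u y + dil f s1 s2 v y.
Proof.
move=> rf cu cv uB vB; rewrite /dil -RintegralD //; last 2 first.
- exact: dil_integrable uB.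
- exact: dil_integrable vB.
by apply: eq_Rintegral => w _; rewrite mulrDr.
Qed.
End Rapid.

(** * The kernels as Fourier multipliers *)

Section Multiplier.
Variable R : realType.
Local Notation mR := (measurableTypeR R).
Implicit Types (f g u v p : R * R -> R) (B C G K T e s q r : R) (y w : R * R).

Lemma is_psi_cos T f k1 k2 : is_psi T f ->
  \int[leb2 R]_(w in setT) (cos (k1 * w.1 + k2 * w.2) * f w) =
    expR (- (T * (k1 ^+ 4 + k2 ^+ 2))).
Proof. by move=> [_ /(_ (k1, k2))] []. Qed.

Lemma is_psi_sin T f k1 k2 : is_psi T f ->
  \int[leb2 R]_(w in setT) (sin (k1 * w.1 + k2 * w.2) * f w) = 0.
Proof. by move=> [_ /(_ (k1, k2))] [_ /eqP]; rewrite oppr_eq0 => /eqP. Qed.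

Lemma is_psi_rapid T f : is_psi T f -> rapid f.
Proof. by move=> [/(schwartz_rapid 0 0)]. Qed.

Lemma is_psi_mass T f : is_psi T f -> \int[leb2 R]_(w in setT) f w = 1.
Proof.
move=> /(is_psi_cos 0 0); rewrite !expr0n /= addr0 mulr0 oppr0 expR0 => <-.
by apply: eq_Rintegral => w _; rewrite !mul0r addr0 cos0 mul1r.
Qed.

Lemma continuous_phase (k1 k2 a : R) :
  continuous (fun y : R * R => k1 * y.1 + k2 * y.2 + a).
Proof. by cont. Qed.

Lemma continuous_cos_phase (k1 k2 a : R) :
  continuous (fun y : R * R => cos (k1 * y.1 + k2 * y.2 + a)).
Proof.
move=> y; apply: (@continuous_comp _ _ _ (fun y : R * R => k1 * y.1 + k2 * y.2 + a) (@cos R)).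
  exact: continuous_phase.
exact: continuous_cos.
Qed.

Lemma continuous_sin_phase (k1 k2 a : R) :
  continuous (fun y : R * R => sin (k1 * y.1 + k2 * y.2 + a)).
Proof.
move=> y; apply: (@continuous_comp _ _ _ (fun y : R * R => k1 * y.1 + k2 * y.2 + a) (@sin R)).
  exact: continuous_phase.
exact: continuous_sin.
Qed.

Lemma trig_continuous p : trig p -> continuous p.
Proof.
elim=> [c k1 k2 a|u v _ cu _ cv]; last exact: ctsD.
exact: (ctsM (@cts_cst _ _ c) (@continuous_cos_phase k1 k2 a)).
Qed.

Lemma trig_bounded p : trig p -> exists B, forall y, `|p y| <= B.
Proof.
elim=> [c k1 k2 a|u v _ [B uB] _ [B' vB]].
  by exists `|c| => y; rewrite normrM ler_piMr // cos_max.
by exists (B + B') => y; apply: le_trans (ler_normD _ _) _; exact: lerD.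
Qed.

Lemma oneDsqr_gt0 (x : R) : 0 < oneDsqr x.
Proof. by rewrite (lt_le_trans ltr01) // oneDsqr_ge1. Qed.

(** In each coordinate this is Peetre's inequality 1 + b^2 <= 2 (1 + a^2) (1 + (a - b)^2). *)
Lemma weight_shift (y z : R * R) :
  weight (y - z) <= 4 * (oneDsqr y.1 * oneDsqr y.2) * weight z.
Proof.
have o (a b : R) : (oneDsqr (a - b))^-1 <= 2 * oneDsqr a * (oneDsqr b)^-1.
  rewrite ler_pdivlMr ?oneDsqr_gt0 // mulrC ler_pdivrMr ?oneDsqr_gt0 //.
  rewrite /oneDsqr !expr2; have := sqr_ge0 (b - 2 * a); rewrite expr2.
  have : 0 <= a * a * ((a - b) * (a - b)) by rewrite mulr_ge0 // -expr2 sqr_ge0.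
  lra.
rewrite /weight /=.
have -> : 4 * (oneDsqr y.1 * oneDsqr y.2) * ((oneDsqr z.1)^-1 * (oneDsqr z.2)^-1) =
  2 * oneDsqr y.1 * (oneDsqr z.1)^-1 * (2 * oneDsqr y.2 * (oneDsqr z.2)^-1) by ring.
by apply: ler_pM => //; rewrite invr_ge0 ltW // oneDsqr_gt0.
Qed.

Lemma phase_integral T f (c a k1 k2 : R) : is_psi T f ->
  \int[leb2 R]_(w in setT) (f w * (c * cos (k1 * w.1 + k2 * w.2 + a))) =
    expR (- (T * (k1 ^+ 4 + k2 ^+ 2))) * (c * cos a).
Proof.
move=> hf; have rf := is_psi_rapid hf; have [C [C0 fC]] := rapid_le_weight rf.
have cf : continuous f by case: rf.
have icos : (leb2 R).-integrable setT (EFin \o (fun w => cos (k1 * w.1 + k2 * w.2) * f w)).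
  apply: (@weight_integrable _ _ C).
    have := @continuous_cos_phase k1 k2 0; under eq_fun do rewrite addr0.
    by move=> cc; exact: ctsM.
  move=> w; rewrite normrM; apply: le_trans (fC w).
  by rewrite ler_piMl // cos_max.
have isin : (leb2 R).-integrable setT (EFin \o (fun w => sin (k1 * w.1 + k2 * w.2) * f w)).
  apply: (@weight_integrable _ _ C).
    have := @continuous_sin_phase k1 k2 0; under eq_fun do rewrite addr0.
    by move=> cc; exact: ctsM.
  move=> w; rewrite normrM; apply: le_trans (fC w).
  by rewrite ler_piMl // sin_max.
transitivity (\int[leb2 R]_(w in setT) (c * cos a * (cos (k1 * w.1 + k2 * w.2) * f w)
    - c * sin a * (sin (k1 * w.1 + k2 * w.2) * f w))).
  by apply: eq_Rintegral => w _; rewrite cosD; ring.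
rewrite RintegralB //; last 2 first.
- exact: (integrableZl measurableT (c * cos a) icos).
- exact: (integrableZl measurableT (c * sin a) isin).
rewrite !RintegralZl // (is_psi_cos _ _ hf) (is_psi_sin _ _ hf).
by rewrite mulr0 subr0 mulrC.
Qed.

Lemma dil_wave f s1 s2 c k1 k2 a y : is_psi 1 f ->
  dil f s1 s2 (fun z => c * cos (k1 * z.1 + k2 * z.2 + a)) y =
    expR (- (s1 ^+ 4 * k1 ^+ 4 + s2 ^+ 2 * k2 ^+ 2)) * (c * cos (k1 * y.1 + k2 * y.2 + a)).
Proof.
move=> hf; rewrite /dil /=.
transitivity (\int[leb2 R]_(w in setT)
    (f w * (c * cos (k1 * s1 * w.1 + k2 * s2 * w.2 + (k1 * y.1 + k2 * y.2 + a))))).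
  by apply: eq_Rintegral => w _; congr (_ * (_ * cos _)); ring.
rewrite (phase_integral _ _ _ _ hf); congr (expR _ * _); ring.
Qed.

Lemma conv_wave T g c k1 k2 a y : is_psi T g ->
  convolution2 g (fun z => c * cos (k1 * z.1 + k2 * z.2 + a)) y =
    expR (- (T * (k1 ^+ 4 + k2 ^+ 2))) * (c * cos (k1 * y.1 + k2 * y.2 + a)).
Proof.
move=> hg; have rg := is_psi_rapid hg; have [C [C0 gC]] := rapid_le_weight rg.
have cg : continuous g by case: rg.
pose G (w : R * R) := g w * (c * cos (- k1 * w.1 + - k2 * w.2 + (k1 * y.1 + k2 * y.2 + a))).
have cG : continuous G.
  apply: (@ctsM _ _ g (fun w => c * cos (- k1 * w.1 + - k2 * w.2 + (k1 * y.1 + k2 * y.2 + a)))) => //.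
  apply: trig_continuous; exact: trig_wave.
transitivity (\int[leb2 R]_(z in setT) G (y - z)).
  rewrite /convolution2; apply: eq_Rintegral => z _; rewrite /G /=.
  by congr (_ * (_ * cos _)); ring.
rewrite Rintegral_reflect //; first by rewrite (phase_integral _ _ _ _ hg) !sqrrN -[4%N]/(2 * 2)%N exprM sqrrN -exprM.
apply: (@weight_integrable _ _ (C * `|c| * (4 * (oneDsqr y.1 * oneDsqr y.2)))).
  move=> z; apply: (@continuous_comp _ _ _ (fun z : R * R => y - z) G); last exact: cG.
  exact: (cts_pair (ctsD (@cts_cst _ _ y.1) (ctsN (@cts_fst _ _))) (ctsD (@cts_cst _ _ y.2) (ctsN (@cts_snd _ _)))).
move=> z; apply: (@le_trans _ _ (C * `|c| * weight (y - z))).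
  rewrite /G normrM normrM mulrAC; apply: ler_pM => //.
  by rewrite ler_piMr // cos_max.
by rewrite -[leRHS]mulrA; apply: ler_wpM2l; [rewrite mulr_ge0|exact: weight_shift].
Qed.
End Multiplier.

Section DilationOperators.
Variable R : realType.
Local Notation mR := (measurableTypeR R).
Implicit Types (f g u v p : R * R -> R) (B C G K T e s q r : R) (y w : R * R).

Lemma eq_of_dist_le (a b K : R) : 0 <= K -> (forall e, 0 < e -> `|a - b| <= K * e) -> a = b.
Proof.
move=> K0 H; apply/eqP; rewrite -subr_eq0 -normr_le0; apply/ler_addgt0Pr => e e0.
have K1 : 0 < K + 1 by lra.
apply: le_trans (H (e / (K + 1)) (divr_gt0 e0 K1)) _.
by rewrite add0r mulrA ler_pdivrMr // mulrC; apply: ler_wpM2l; [exact: ltW|lra].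
Qed.

Lemma uniform_limit_continuous (F : R * R -> R) :
  (forall e, 0 < e -> exists v, continuous v /\ forall y, `|F y - v y| <= e) -> continuous F.
Proof.
move=> H y; apply/cvgrPdist_le => e e0.
have e3 : 0 < e / 3 by lra.
have [v [cv Fv]] := H _ e3.
have /cvgrPdist_le/(_ _ e3) := cv y.
apply: filterS => z yz.
have -> : F y - F z = (F y - v y) + (v y - v z) + - (F z - v z) by ring.
apply: le_trans (ler_normD _ _) _; rewrite normrN.
have := ler_normD (F y - v y) (v y - v z).
by have := Fv y; have := Fv z; move: yz; lra.
Qed.

Lemma trig_dil f s1 s2 p : is_psi 1 f -> trig p -> trig (dil f s1 s2 p).
Proof.
move=> hf; have rf := is_psi_rapid hf.
elim=> [c k1 k2 a|u v tu IHu tv IHv].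
  rewrite (_ : dil f s1 s2 _ = fun y => expR (- (s1 ^+ 4 * k1 ^+ 4 + s2 ^+ 2 * k2 ^+ 2)) * c *
      cos (k1 * y.1 + k2 * y.2 + a)); first exact: trig_wave.
  by apply/funext => y; rewrite dil_wave // mulrA.
have [B uB] := trig_bounded tu; have [B' vB] := trig_bounded tv.
rewrite (_ : dil f s1 s2 _ = fun y => dil f s1 s2 u y + dil f s1 s2 v y).
  exact: trig_add.
by apply/funext => y; apply: (@dilD _ f s1 s2 u v y B B') => //; exact: trig_continuous.
Qed.

Lemma dil_trig_comp f s1 s2 r1 r2 q1 q2 p : is_psi 1 f -> trig p ->
  q1 ^+ 4 = s1 ^+ 4 + r1 ^+ 4 -> q2 ^+ 2 = s2 ^+ 2 + r2 ^+ 2 ->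
  dil f s1 s2 (dil f r1 r2 p) = dil f q1 q2 p.
Proof.
move=> hf + E1 E2; have rf := is_psi_rapid hf.
elim=> [c k1 k2 a|u v tu IHu tv IHv].
  apply/funext => y.
  rewrite (_ : dil f r1 r2 _ = fun y => expR (- (r1 ^+ 4 * k1 ^+ 4 + r2 ^+ 2 * k2 ^+ 2)) * c *
      cos (k1 * y.1 + k2 * y.2 + a)); last by apply/funext => z; rewrite dil_wave // mulrA.
  by rewrite !dil_wave // E1 E2 !mulrA -expRD; congr (expR _ * _ * _); ring.
have [B uB] := trig_bounded tu; have [B' vB] := trig_bounded tv.
have cu := trig_continuous tu; have cv := trig_continuous tv.
have -> : dil f r1 r2 (fun y => u y + v y) = fun y => dil f r1 r2 u y + dil f r1 r2 v y.
  by apply/funext => y; exact: (@dilD _ f r1 r2 u v y B B').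
have tu' := trig_dil r1 r2 hf tu; have tv' := trig_dil r1 r2 hf tv.
have [B2 uB2] := trig_bounded tu'; have [B3 vB3] := trig_bounded tv'.
apply/funext => y.
rewrite (@dilD _ f s1 s2 _ _ y B2 B3) ?IHu ?IHv //; try exact: trig_continuous.
by rewrite (@dilD _ f q1 q2 u v y B B').
Qed.

Lemma dil_trig_eq f s1 s2 q1 q2 p : is_psi 1 f -> trig p ->
  q1 ^+ 4 = s1 ^+ 4 -> q2 ^+ 2 = s2 ^+ 2 -> dil f s1 s2 p = dil f q1 q2 p.
Proof.
move=> hf + E1 E2; have rf := is_psi_rapid hf.
elim=> [c k1 k2 a|u v tu IHu tv IHv].
  by apply/funext => y; rewrite !dil_wave // E1 E2.
have [B uB] := trig_bounded tu; have [B' vB] := trig_bounded tv.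
have cu := trig_continuous tu; have cv := trig_continuous tv.
by apply/funext => y; rewrite !(@dilD _ f _ _ u v y B B') // IHu IHv.
Qed.

Lemma dil_dist f s1 s2 u p e y : is_psi 1 f -> continuous u -> continuous p ->
  (exists B, forall z, `|u z| <= B) -> (exists B, forall z, `|p z| <= B) ->
  forall C, (forall s1 s2 u y B, continuous u -> (forall z, `|u z| <= B) ->
    `|dil f s1 s2 u y| <= C * B) ->
  (forall z, `|u z - p z| <= e) -> `|dil f s1 s2 u y - dil f s1 s2 p y| <= C * e.
Proof.
move=> hf cu cp [B uB] [B' pB] C HC ue; have rf := is_psi_rapid hf.
rewrite -(@dilB _ f s1 s2 u p y B B') //; apply: HC => //.
exact: (ctsD cu (ctsN cp)).
Qed.

Lemma continuous_reflect g (y : R * R) : continuous g ->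
  continuous (fun z : R * R => g (y - z)).
Proof.
move=> cg z; apply: (@continuous_comp _ _ _ (fun z : R * R => (y.1 - z.1, y.2 - z.2)) g); last exact: cg.
exact: (cts_pair (ctsD (@cts_cst _ _ y.1) (ctsN (@cts_fst _ _))) (ctsD (@cts_cst _ _ y.2) (ctsN (@cts_snd _ _)))).
Qed.

(** Only increments symmetrised in [w.1] are controlled by the hypothesis, so a term linear in the
    first variable, with whatever slope, does not count. *)
Definition approx_const (f : R * R -> R) (C : R) := 0 <= C /\
  forall (s1 s2 : R) (u : R * R -> R) y (G : R), Z2periodic u -> continuous u ->
  (forall w, `|(u (y.1 + s1 * w.1, y.2 + s2 * w.2) + u (y.1 - s1 * w.1, y.2 + s2 * w.2)) / 2
      - u y| <= G * growth w) ->
  `|dil f s1 s2 u y - u y| <= C * G.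

Section Fixed.
Variable f : R * R -> R.
Hypothesis hf : is_psi 1 f.

Lemma dil_continuous s1 s2 u : Z2periodic u -> continuous u -> continuous (dil f s1 s2 u).
Proof.
move=> pu cu; have [C [C0 HC]] := dil_bound (is_psi_rapid hf).
apply: uniform_limit_continuous => e e0.
have K1 : 0 < C + 1 by rewrite ltr_wpDl.
have [p tp up] := trig_dense pu cu (divr_gt0 e0 K1).
exists (dil f s1 s2 p); split; first exact/trig_continuous/trig_dil.
move=> y; apply: le_trans (dil_dist s1 s2 y hf cu (trig_continuous tp) (periodic_bounded pu cu)
  (trig_bounded tp) HC up) _.
by rewrite mulrA ler_pdivrMr // mulrC; apply: ler_wpM2l; [exact: ltW|rewrite lerDl].
Qed.

Lemma dil_periodic s1 s2 u : Z2periodic u -> Z2periodic (dil f s1 s2 u).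
Proof.
move=> pu m n [y1 y2]; rewrite /dil; apply: eq_Rintegral => w _; congr (_ * _).
rewrite -[RHS](Z2periodicE pu m n); congr u.
congr (_, _); first exact: (addrAC y1 m%:~R (s1 * w.1)).
exact: (addrAC y2 n%:~R (s2 * w.2)).
Qed.

Lemma dil_eq s1 s2 q1 q2 u : Z2periodic u -> continuous u ->
  q1 ^+ 4 = s1 ^+ 4 -> q2 ^+ 2 = s2 ^+ 2 -> dil f s1 s2 u = dil f q1 q2 u.
Proof.
move=> pu cu E1 E2; apply/funext => y.
have [C [C0 HC]] := dil_bound (is_psi_rapid hf).
apply: (@eq_of_dist_le _ _ (2 * C)); first by rewrite mulr_ge0.
move=> e e0; have [p tp up] := trig_dense pu cu e0.
have D q1 q2 := dil_dist q1 q2 y hf cu (trig_continuous tp) (periodic_bounded pu cu)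
  (trig_bounded tp) HC up.
have := D s1 s2; have := D q1 q2; rewrite -(dil_trig_eq hf tp E1 E2).
by rewrite !ler_norml; clear; lra.
Qed.

Lemma dil_comp s1 s2 r1 r2 q1 q2 u : Z2periodic u -> continuous u ->
  q1 ^+ 4 = s1 ^+ 4 + r1 ^+ 4 -> q2 ^+ 2 = s2 ^+ 2 + r2 ^+ 2 ->
  dil f s1 s2 (dil f r1 r2 u) = dil f q1 q2 u.
Proof.
move=> pu cu E1 E2; apply/funext => y.
have [C [C0 HC]] := dil_bound (is_psi_rapid hf).
apply: (@eq_of_dist_le _ _ (C * C + C)); first by rewrite addr_ge0 ?mulr_ge0.
move=> e e0; have [p tp up] := trig_dense pu cu e0.
have D q1 q2 z := dil_dist q1 q2 z hf cu (trig_continuous tp) (periodic_bounded pu cu)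
  (trig_bounded tp) HC up.
have tp' := trig_dil r1 r2 hf tp.
have := dil_dist s1 s2 y hf (dil_continuous pu cu) (trig_continuous tp')
  (periodic_bounded (dil_periodic r1 r2 pu) (dil_continuous pu cu)) (trig_bounded tp')
  HC (D r1 r2).
rewrite (dil_trig_comp hf tp E1 E2); have := D q1 q2 y.
by rewrite !ler_norml; clear; lra.
Qed.

(** On a wave both operators multiply by exp(-T (k1^4 + k2^2)), since s1^4 = s2^2 = T. Both are
    bounded in the supremum norm, the convolution with a constant that depends on the point [y], so
    the equality passes to [u] by density, one point at a time. *)
Lemma dil_conv T s1 s2 g u : is_psi T g -> Z2periodic u -> continuous u ->
  s1 ^+ 4 = T -> s2 ^+ 2 = T -> convolution2 g u = dil f s1 s2 u.
Proof.
move=> hg pu cu E1 E2; apply/funext => y.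
have [C [C0 HC]] := dil_bound (is_psi_rapid hf).
have [B uB] := periodic_bounded pu cu.
have [Cg [Cg0 gC]] := rapid_le_weight (is_psi_rapid hg).
have cg : continuous g by case: (is_psi_rapid hg).
pose K := 4 * (oneDsqr y.1 * oneDsqr y.2).
have K0 : 0 <= K by rewrite /K !mulr_ge0 // ltW // oneDsqr_gt0.
have cint v : continuous v -> continuous (fun z : R * R => g (y - z) * v z).
  move=> cv; apply: (@ctsM _ _ (fun z : R * R => g (y - z)) v) => //.
  exact: continuous_reflect.
have bint v b (z : R * R) : `|v z| <= b -> `|g (y - z) * v z| <= Cg * K * b * weight z.
  move=> vb; rewrite normrM mulrAC; apply: ler_pM => //.
  apply: le_trans (gC _) _; rewrite -mulrA; apply: ler_wpM2l => //; exact: weight_shift.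
have cD v v' b b' : continuous v -> continuous v' -> (forall z, `|v z| <= b) ->
    (forall z, `|v' z| <= b') ->
    convolution2 g (fun z => v z + v' z) y = convolution2 g v y + convolution2 g v' y.
  move=> cv cv' vb vb'; rewrite /convolution2 -RintegralD //; last 2 first.
  - exact: (weight_integrable (cint v cv) (fun z => bint v b z (vb z))).
  - exact: (weight_integrable (cint v' cv') (fun z => bint v' b' z (vb' z))).
  by apply: eq_Rintegral => z _; rewrite mulrDr.
have conv_trig p : trig p -> convolution2 g p y = dil f s1 s2 p y.
  elim=> [c k1 k2 a|v v' tv IHv tv' IHv'].
    rewrite (conv_wave _ _ _ _ _ hg) dil_wave // E1 E2.
    by congr (expR _ * _); ring.
  have [b vb] := trig_bounded tv; have [b' vb'] := trig_bounded tv'.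
  have cv := trig_continuous tv; have cv' := trig_continuous tv'.
  rewrite (cD v v' b b') // (@dilD _ f s1 s2 v v' y b b') ?IHv ?IHv' //.
  exact: is_psi_rapid hf.
apply: (@eq_of_dist_le _ _ (Cg * K * weight_mass R + C)).
  by rewrite addr_ge0 // !mulr_ge0 // weight_mass_ge0.
move=> e e0; have [p tp up] := trig_dense pu cu e0.
have H1 := dil_dist s1 s2 y hf cu (trig_continuous tp) (periodic_bounded pu cu)
  (trig_bounded tp) HC up.
have [b pb] := trig_bounded tp; have cp := trig_continuous tp.
have H2 : `|convolution2 g u y - convolution2 g p y| <= Cg * K * weight_mass R * e.
  rewrite [convolution2 g u y](_ : _ = convolution2 g (fun z => (u z - p z) + p z) y).
    have cup : continuous (fun z => u z - p z) by exact: (ctsD cu (ctsN cp)).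
    rewrite (cD (fun z => u z - p z) p e b) // addrK.
    rewrite mulrAC; apply: (weight_Rintegral (cint _ cup)) => z.
    exact: (bint (fun z => u z - p z) e z (up z)).
  by rewrite /convolution2; apply: eq_Rintegral => z _; rewrite subrK.
rewrite (conv_trig p tp) in H2.
apply: le_trans (ler_distD (dil f s1 s2 p y) _ _) _.
rewrite mulrDl; apply: lerD; first exact: H2.
by rewrite distrC; exact: H1.
Qed.

Lemma dil_trig_limit p y : trig p -> forall e, 0 < e -> exists2 r, 0 < r &
  forall s1 s2, `|s1| <= r -> `|s2| <= r -> `|dil f s1 s2 p y - p y| <= e.
Proof.
elim=> [c k1 k2 a|u v tu IHu tv IHv] e e0.
  pose K := k1 ^+ 4 + k2 ^+ 2.
  have k4 : 0 <= k1 ^+ 4 by rewrite -[4%N]/(2 * 2)%N exprM sqr_ge0.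
  have k2' : 0 <= k2 ^+ 2 by exact: sqr_ge0.
  have K0 : 0 <= K by rewrite addr_ge0.
  have c0 : 0 <= `|c| by exact: normr_ge0.
  have D0 : 0 < 1 + K * `|c| by rewrite ltr_pwDl // mulr_ge0.
  exists (Num.min 1 (e / (1 + K * `|c|))).
    by rewrite lt_min ltr01 divr_gt0.
  move=> s1 s2; rewrite !le_min => /andP[s11 s1e] /andP[s21 s2e].
  rewrite dil_wave //; set X := s1 ^+ 4 * _ + _; set w := c * cos _.
  have wc : `|w| <= `|c| by rewrite normrM ler_piMr // cos_max.
  have X0 : 0 <= X.
    by rewrite addr_ge0 // mulr_ge0 // ?sqr_ge0 // -[4%N]/(2 * 2)%N exprM sqr_ge0.
  have pow (s : R) : `|s| <= 1 -> s ^+ 4 <= `|s| /\ s ^+ 2 <= `|s|.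
    move=> s1'; have s2' : s ^+ 2 <= `|s|.
      by rewrite -[s ^+ 2]ger0_norm ?sqr_ge0 // normrX expr2 ler_piMr.
    split => //; apply: le_trans s2'; rewrite -[4%N]/(2 + 2)%N exprD ler_piMr ?sqr_ge0 //.
    by rewrite -[s ^+ 2]ger0_norm ?sqr_ge0 // normrX exprn_ile1.
  set d := e / (1 + K * `|c|) in s1e s2e.
  have XK : X <= d * K.
    rewrite mulrDr; apply: lerD; apply: ler_wpM2r => //.
      exact: le_trans (pow s1 s11).1 s1e.
    exact: le_trans (pow s2 s21).2 s2e.
  have -> : expR (- X) * w - w = - ((1 - expR (- X)) * w) by ring.
  rewrite normrN normrM.
  have E1 : expR (- X) <= 1 by rewrite -expR0 ler_expR oppr_le0.
  have E2 : 1 - X <= expR (- X) by exact: expR_ge1Dx.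
  rewrite ger0_norm ?subr_ge0 //.
  apply: (@le_trans _ _ (X * `|c|)).
    by apply: ler_pM => //; rewrite ?subr_ge0 //; clear -E2; lra.
  apply: (@le_trans _ _ (d * K * `|c|)); first exact: ler_wpM2r.
  rewrite /d -2!mulrA ler_piMr ?(ltW e0) // mulrC ler_pdivrMr // mul1r.
  by clear; lra.
have e2 : 0 < e / 2 by rewrite divr_gt0.
have [r1 r10 H1] := IHu _ e2; have [r2 r20 H2] := IHv _ e2.
exists (Num.min r1 r2); first by rewrite lt_min r10.
move=> s1 s2; rewrite !le_min => /andP[s11 s12] /andP[s21 s22].
have [b ub] := trig_bounded tu; have [b' vb] := trig_bounded tv.
rewrite (@dilD _ f s1 s2 u v y b b') //; first last.
- exact: trig_continuous.
- exact: trig_continuous.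
- exact: is_psi_rapid hf.
have := H1 _ _ s11 s21; have := H2 _ _ s12 s22.
by rewrite !ler_norml; clear; lra.
Qed.

Lemma dil_limit u y : Z2periodic u -> continuous u -> forall e, 0 < e -> exists2 r, 0 < r &
  forall s1 s2, `|s1| <= r -> `|s2| <= r -> `|dil f s1 s2 u y - u y| <= e.
Proof.
move=> pu cu e e0; have [C [C0 HC]] := dil_bound (is_psi_rapid hf).
have K1 : 0 < C + 1 by rewrite ltr_wpDl.
have e2 : 0 < e / 2 by rewrite divr_gt0.
have [p tp up] := trig_dense pu cu (divr_gt0 e2 K1).
have [r r0 Hr] := dil_trig_limit y tp e2.
exists r => // s1 s2 s1r s2r.
have := dil_dist s1 s2 y hf cu (trig_continuous tp) (periodic_bounded pu cu)
  (trig_bounded tp) HC up.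
have := Hr _ _ s1r s2r; have := up y.
have : (C + 1) * (e / 2 / (C + 1)) = e / 2 by rewrite mulrC divfK ?gt_eqF.
set d := e / 2 / (C + 1).
by rewrite !ler_norml; clear; lra.
Qed.

(* [dil f s1 s2] depends on [s1] only through [s1 ^+ 4], so it can be averaged with
   [dil f (- s1) s2]. *)
Lemma dil_approx : exists C, approx_const f C.
Proof.
have rf := is_psi_rapid hf; have [C [C0 fC]] := rapid_weight rf.
have cf : continuous f by case: rf.
exists (C * weight_mass R); split; first by rewrite mulr_ge0 // weight_mass_ge0.
move=> s1 s2 u y G pu cu uG; have [B uB] := periodic_bounded pu cu.
have [Cf [Cf0 fCf]] := rapid_le_weight rf.
have iu q1 := dil_integrable q1 s2 y rf cu uB.
have if1 : (leb2 R).-integrable setT (EFin \o (fun w => u y * f w)).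
  exact: (integrableZl measurableT (u y) (weight_integrable cf fCf)).
pose g w := f w * ((u (y.1 + s1 * w.1, y.2 + s2 * w.2) + u (y.1 - s1 * w.1, y.2 + s2 * w.2)) / 2
   - u y).
have -> : dil f s1 s2 u y - u y = \int[leb2 R]_(w in setT) g w.
  transitivity (\int[leb2 R]_(w in setT)
     (2^-1 * (f w * u (y.1 + s1 * w.1, y.2 + s2 * w.2)) +
      (2^-1 * (f w * u (y.1 + - s1 * w.1, y.2 + s2 * w.2)) - u y * f w))).
    have i1 := integrableZl measurableT 2^-1 (iu s1).
    have i2 := integrableZl measurableT 2^-1 (iu (- s1)).
    rewrite RintegralD //; last exact: (integrableB measurableT i2 if1).
    rewrite RintegralB // !RintegralZl //; last exact: (weight_integrable cf fCf).
    rewrite (is_psi_mass hf) -/(dil f s1 s2 u y) -/(dil f (- s1) s2 u y).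
    rewrite (@dil_eq (- s1) s2 s1 s2 u) //; last by rewrite -[4%N]/(2 * 2)%N !exprM sqrrN.
    by field.
  by apply: eq_Rintegral => w _; rewrite /g !mulNr; field.
rewrite mulrAC; apply: weight_Rintegral.
  apply: (@ctsM _ _ f (fun w => (u (y.1 + s1 * w.1, y.2 + s2 * w.2) +
     u (y.1 - s1 * w.1, y.2 + s2 * w.2)) / 2 - u y)) => //.
  have c1 := @continuous_dil R s1 s2 y u cu.
  have c2 := @continuous_dil R (- s1) s2 y u cu.
  under eq_fun do rewrite -(mulNr s1).
  exact: (ctsD (ctsM (ctsD c1 c2) (@cts_cst _ _ 2^-1)) (@cts_cst _ _ (- u y))).
move=> w; rewrite /g normrM.
apply: (@le_trans _ _ (`|f w| * growth w * G)).
  by rewrite -mulrA [growth w * G]mulrC; apply: ler_wpM2l.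
rewrite [leRHS]mulrAC; apply: ler_wpM2r; last exact: fC.
have gw : 0 < growth w by rewrite (lt_le_trans ltr01) // growth_ge1.
by rewrite -(pmulr_lge0 _ gw); apply: le_trans (uG w).
Qed.
End Fixed.
End DilationOperators.

(** * Derivatives of convolutions *)

Section ConvolutionDerivatives.
Variable R : realType.
Local Notation mR := (measurableTypeR R).
Implicit Types (f g u : R * R -> R) (B C K T e x : R).

(** Differentiation under the integral sign along a curve [pt], used with the two coordinate lines.
    The majorant is uniform for parameters within distance one of [x0]. *)
Lemma conv_has_deriv (pt : R -> R * R) g g' u B x0 K :
  rapid g -> rapid g' -> continuous u -> (forall z, `|u z| <= B) ->
  (forall (z : R * R) x, has_deriv (fun x => g (pt x - z)) x (g' (pt x - z))) ->
  0 <= K ->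
  (forall x (z : R * R), x0 - 1 < x < x0 + 1 -> weight (pt x - z) <= K * weight z) ->
  has_deriv (fun x => convolution2 g u (pt x)) x0 (convolution2 g' u (pt x0)).
Proof.
move=> rg rg' cu uB dg K0 HK.
have B0 : 0 <= B by apply: le_trans (uB (0, 0)).
have [C [C0 gC]] := rapid_le_weight rg; have [C' [C'0 gC']] := rapid_le_weight rg'.
pose F (x : R) (z : mR * mR) : R := g (pt x - z) * u z.
pose I := `]x0 - 1, x0 + 1[%classic : set R.
have Ix0 : I x0 by rewrite /I /= in_itv /=; lra.
have cF h x : rapid h -> continuous (fun z : R * R => h (pt x - z) * u z).
  move=> [ch _]; apply: (@ctsM _ _ (fun z : R * R => h (pt x - z)) u) => //.
  exact: continuous_reflect.
have bF h c x (z : R * R) : 0 <= c -> (forall w, `|h w| <= c * weight w) -> I x ->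
    `|h (pt x - z) * u z| <= c * K * B * weight z.
  move=> c0 hc; rewrite /I /= in_itv /= => xI.
  rewrite normrM mulrAC; apply: ler_pM => //.
  by apply: le_trans (hc _) _; rewrite -mulrA; apply: ler_wpM2l => //; exact: HK.
have intF x : I x -> (leb2 R).-integrable setT (EFin \o F x).
  move=> xI; apply: (weight_integrable (C := C * K * B) (cF g x rg)) => z.
  exact: (bF g C x z C0 gC xI).
have dF x z : has_deriv (fun x => F x z) x (g' (pt x - z) * u z).
  by have := has_derivM (dg z x) (has_deriv_cst x (u z)); rewrite mulr0 addr0.
pose G z := C' * K * B * weight z.
have G0 z : 0 <= G z by rewrite /G !mulr_ge0 // ltW // weight_gt0.
have cG : continuous G by exact: (ctsM (@cts_cst _ _ (C' * K * B)) (@continuous_weight R)).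
have iG : (leb2 R).-integrable setT (EFin \o G).
  apply: (weight_integrable (C := C' * K * B) cG) => z.
  by rewrite ger0_norm.
have p1 x z : partial1of2 F x z = g' (pt x - z) * u z.
  by rewrite partial1of2E; case: (dF x z).
have dF1 x z : I x -> setT z -> derivable (F ^~ z) x 1 by move=> _ _; case: (dF x z).
have Gub x z : I x -> setT z -> `|partial1of2 F x z| <= G z.
  by move=> xI _; rewrite p1; exact: (bF g' C' x z C'0 gC' xI).
have D1 := derivable_under_integral measurableT Ix0 intF dF1 G0 iG Gub.
have D2 := differentiation_under_integral measurableT Ix0 intF dF1 G0 iG Gub.
apply: DeriveDef; first exact: D1.
rewrite -derive1E; move: D2; rewrite /F => ->.
by apply: eq_Rintegral => z _; exact: p1.
Qed.

Lemma has_deriv_d1 g x t a : is_derive (x, t) ((1, 0) : R * R) g a <->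
  has_deriv (fun x => g (x, t)) x a.
Proof.
have E : (fun h : R => h^-1 *: ((g \o shift (x, t)) (h *: ((1, 0) : R * R)) - g (x, t))) =
    (fun h : R => h^-1 *: (((fun x => g (x, t)) \o shift x) (h *: (1 : R)) - g (x, t))).
  apply/funext => h /=; congr (_ *: (g _ - _)).
  by congr (_, _); rewrite /= /GRing.scale /= mulr0 add0r.
have ED : derivable g (x, t) ((1, 0) : R * R) = derivable (fun x => g (x, t)) x (1 : R).
  by rewrite /derivable E.
have EV : 'D_((1, 0) : R * R) g (x, t) = 'D_(1 : R) (fun x => g (x, t)) x.
  by rewrite /derive E.
split=> -[d dE].
  have d' : derivable (fun x => g (x, t)) x (1 : R) by rewrite -ED.
  have dE' : 'D_(1 : R) (fun x => g (x, t)) x = a by rewrite -EV.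
  exact: (DeriveDef d' dE').
have d' : derivable g (x, t) ((1, 0) : R * R) by rewrite ED.
have dE' : 'D_((1, 0) : R * R) g (x, t) = a by rewrite EV.
exact: (DeriveDef d' dE').
Qed.

Lemma has_deriv_d2 g x t a : is_derive (x, t) ((0, 1) : R * R) g a <->
  has_deriv (fun t => g (x, t)) t a.
Proof.
have E : (fun h : R => h^-1 *: ((g \o shift (x, t)) (h *: ((0, 1) : R * R)) - g (x, t))) =
    (fun h : R => h^-1 *: (((fun t => g (x, t)) \o shift t) (h *: (1 : R)) - g (x, t))).
  apply/funext => h /=; congr (_ *: (g _ - _)).
  by congr (_, _); rewrite /= /GRing.scale /= mulr0 add0r.
have ED : derivable g (x, t) ((0, 1) : R * R) = derivable (fun t => g (x, t)) t (1 : R).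
  by rewrite /derivable E.
have EV : 'D_((0, 1) : R * R) g (x, t) = 'D_(1 : R) (fun t => g (x, t)) t.
  by rewrite /derive E.
split=> -[d dE].
  have d' : derivable (fun t => g (x, t)) t (1 : R) by rewrite -ED.
  have dE' : 'D_(1 : R) (fun t => g (x, t)) t = a by rewrite -EV.
  exact: (DeriveDef d' dE').
have d' : derivable g (x, t) ((0, 1) : R * R) by rewrite ED.
have dE' : 'D_((0, 1) : R * R) g (x, t) = a by rewrite EV.
exact: (DeriveDef d' dE').
Qed.

Lemma differentiable_d1 g x t : differentiable g (x, t) ->
  has_deriv (fun x => g (x, t)) x (d1 g (x, t)).
Proof.
by move=> dg; apply/has_deriv_d1; apply: DeriveDef => //; exact: diff_derivable.
Qed.

Lemma differentiable_d2 g x t : differentiable g (x, t) ->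
  has_deriv (fun t => g (x, t)) t (d2 g (x, t)).
Proof.
by move=> dg; apply/has_deriv_d2; apply: DeriveDef => //; exact: diff_derivable.
Qed.

Lemma conv_d1 g g' u B x t : rapid g -> rapid g' -> continuous u -> (forall z, `|u z| <= B) ->
  (forall x t, has_deriv (fun x => g (x, t)) x (g' (x, t))) ->
  has_deriv (fun x => convolution2 g u (x, t)) x (convolution2 g' u (x, t)).
Proof.
move=> rg rg' cu uB dg.
apply: (@conv_has_deriv (fun x => (x, t)) g g' u B x
    (4 * (oneDsqr (`|x| + 1) * oneDsqr t))) => //.
  move=> [z1 z2] r.
  have dr : has_deriv (fun r => r - z1) r 1 by der.
  by have := @has_deriv_comp R r (fun q => g (q, t - z2)) (fun r => r - z1) _ _ (dg (r - z1) (t - z2)) dr;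
    rewrite mulr1.
move=> r z rI; apply: le_trans (weight_shift _ _) _.
apply: ler_wpM2r; first by rewrite ltW // weight_gt0.
apply: ler_wpM2l => //; apply: ler_wpM2r; first by rewrite ltW // oneDsqr_gt0.
rewrite /oneDsqr lerD2l /= -[r ^+ 2]ger0_norm ?sqr_ge0 // normrX.
rewrite lerXn2r ?nnegrE ?addr_ge0 // ler_norml.
by have := ler_norm x; have := ler_norm (- x); rewrite normrN; lra.
Qed.

Lemma conv_d2 g g' u B x t : rapid g -> rapid g' -> continuous u -> (forall z, `|u z| <= B) ->
  (forall x t, has_deriv (fun t => g (x, t)) t (g' (x, t))) ->
  has_deriv (fun t => convolution2 g u (x, t)) t (convolution2 g' u (x, t)).
Proof.
move=> rg rg' cu uB dg.
apply: (@conv_has_deriv (fun t => (x, t)) g g' u B t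
    (4 * (oneDsqr x * oneDsqr (`|t| + 1)))) => //.
  move=> [z1 z2] r.
  have dr : has_deriv (fun r => r - z2) r 1 by der.
  by have := @has_deriv_comp R r (fun q => g (x - z1, q)) (fun r => r - z2) _ _ (dg (x - z1) (r - z2)) dr;
    rewrite mulr1.
move=> r z rI; apply: le_trans (weight_shift _ _) _.
apply: ler_wpM2r; first by rewrite ltW // weight_gt0.
apply: ler_wpM2l => //; apply: ler_wpM2l; first by rewrite ltW // oneDsqr_gt0.
rewrite /oneDsqr lerD2l /= -[r ^+ 2]ger0_norm ?sqr_ge0 // normrX.
rewrite lerXn2r ?nnegrE ?addr_ge0 // ler_norml.
by have := ler_norm t; have := ler_norm (- t); rewrite normrN; lra.
Qed.

Lemma conv_regular f T g u : is_psi 1 f -> is_psi T g -> 0 < T -> Z2periodic u -> continuous u ->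
  exists v1 v11 vt : R -> R -> R,
    regular (fun y t => convolution2 g u (y, t)) v1 v11 vt /\
    forall a y t, parab a (convolution2 g u) (y, t) = vt y t - a * v11 y t.
Proof.
move=> hf hg T0 pu cu; have [B uB] := periodic_bounded pu cu.
have sg : schwartz g by case: hg.
have rg := is_psi_rapid hg.
have r1 : rapid (d1 g) by exact: (schwartz_rapid 1 0 sg).
have r11 : rapid (d1 (d1 g)) by exact: (schwartz_rapid 2 0 sg).
have r2 : rapid (d2 g) by exact: (schwartz_rapid 0 1 sg).
have D0 y : differentiable g y by case: (sg 0%N 0%N).
have D1 y : differentiable (d1 g) y by case: (sg 1%N 0%N).
have e1 x t : has_deriv (fun x => convolution2 g u (x, t)) x (convolution2 (d1 g) u (x, t)).
  by apply: (@conv_d1 g (@d1 R g) u B x t rg r1 cu uB) => r s; exact: differentiable_d1.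
have e11 x t : has_deriv (fun x => convolution2 (d1 g) u (x, t)) x
    (convolution2 (d1 (d1 g)) u (x, t)).
  by apply: (@conv_d1 (@d1 R g) (@d1 R (@d1 R g)) u B x t r1 r11 cu uB) => r s; exact: differentiable_d1.
have e2 x t : has_deriv (fun t => convolution2 g u (x, t)) t (convolution2 (d2 g) u (x, t)).
  by apply: (@conv_d2 g (@d2 R g) u B x t rg r2 cu uB) => r s; exact: differentiable_d2.
exists (fun y t => convolution2 (d1 g) u (y, t)),
  (fun y t => convolution2 (d1 (d1 g)) u (y, t)),
  (fun y t => convolution2 (d2 g) u (y, t)); split; first split.
(* Joint continuity does not follow from the existence of the partial derivatives. It comes from the
   identification with a dilated average, a uniform limit of trigonometric polynomials. *)
- under eq_fun do rewrite -surjective_pairing.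
  pose s1 := Num.sqrt (Num.sqrt T); pose s2 := Num.sqrt T.
  have E2 : s2 ^+ 2 = T by rewrite sqr_sqrtr // ltW.
  have E1 : s1 ^+ 4 = T.
    by rewrite -[4%N]/(2 * 2)%N exprM sqr_sqrtr ?sqrtr_ge0.
  rewrite (dil_conv hf hg pu cu E1 E2); exact: dil_continuous.
- exact: (fun t y => e1 y t).
- exact: (fun t y => e11 y t).
- exact: e2.
move=> a y t; rewrite /parab.
have -> : d2 (convolution2 g u) (y, t) = convolution2 (d2 g) u (y, t).
  by case: (has_deriv_d2 (convolution2 g u) y t (convolution2 (d2 g) u (y, t))) => _ /(_ (e2 y t)) [].
have -> : d1 (convolution2 g u) = convolution2 (d1 g) u.
  apply/funext => -[x s].
  by case: (has_deriv_d1 (convolution2 g u) x s (convolution2 (d1 g) u (x, s))) => _ /(_ (e1 x s)) [].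
have -> // : d1 (convolution2 (d1 g) u) (y, t) = convolution2 (d1 (d1 g)) u (y, t).
by case: (has_deriv_d1 (convolution2 (d1 g) u) y t (convolution2 (d1 (d1 g)) u (y, t)))
  => _ /(_ (e11 y t)) [].
Qed.
End ConvolutionDerivatives.

(** * Mollified germs *)

Section Setting.
Variable R : realType.
Implicit Types (kappa lambda beta L s d rho M T : R) (x y z w : R * R).

Lemma powR_mul_le kappa beta d s L rho : 0 <= beta -> beta <= kappa -> kappa <= 2 ->
  0 < L -> 0 <= d -> d <= L -> 0 <= s -> s <= L -> 0 <= rho ->
  d `^ beta * (s * rho) `^ (kappa - beta) <= L `^ kappa * (1 + rho) ^+ 2.
Proof.
move=> b0 bk k2 L0 d0 dL s0 sL r0.
have kb0 : 0 <= kappa - beta by lra.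
have -> : L `^ kappa * (1 + rho) ^+ 2 = L `^ beta * (L `^ (kappa - beta) * (1 + rho) ^+ 2).
  rewrite mulrA -powRD; first by rewrite subrKC.
  by apply/implyP => _; rewrite gt_eqF.
have nn (u : R) : 0 <= u -> u \is Num.nneg by rewrite nnegrE.
have L0' := ltW L0.
apply: ler_pM; rewrite ?powR_ge0 //; first by apply: ge0_ler_powR; rewrite ?nn.
have rho1 : 1 <= 1 + rho by rewrite lerDl.
apply: (@le_trans _ _ ((L * (1 + rho)) `^ (kappa - beta))).
  have r1 : 0 <= 1 + rho by rewrite addr_ge0.
  apply: ge0_ler_powR; [by []|exact/nn/mulr_ge0|exact/nn/mulr_ge0|].
  by apply: ler_pM => //; rewrite lerDr.
rewrite powRM ?addr_ge0 //; apply: ler_wpM2l; first exact: powR_ge0.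
rewrite -powR_mulrn ?addr_ge0 //; apply: ler_powR => //.
lra.
Qed.

Lemma powR4 (t : R) : 0 <= t -> (t ^+ 4) `^ 4^-1 = t.
Proof. by move=> t0; rewrite -powR_mulrn // -powRrM divff ?powRr1. Qed.

(** The added 1 gives [1 <= cardA A] even for empty [A], so that a separate term [L^kappa] can be
    absorbed. *)
Definition cardA (A : {fset R}) : R := (size A)%:R + 1.

Lemma sumA_le (A : {fset R}) (F : R -> R) (X : R) : 0 <= X ->
  (forall beta, beta \in A -> F beta <= X) -> \sum_(beta <- A) F beta <= cardA A * X.
Proof.
move=> X0 FX; apply: (@le_trans _ _ (\sum_(beta <- A) X)).
  by rewrite big_seq [leRHS]big_seq; apply: ler_sum => b bA; exact: FX.
rewrite big_const_seq count_predT iter_addr_0 /cardA mulrDl mul1r mulr_natl.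
by rewrite lerDl.
Qed.

Lemma cardA_ge1 (A : {fset R}) : 1 <= cardA A.
Proof. by rewrite /cardA lerDr. Qed.

Lemma pdist_ge0 x y : 0 <= pdist x y.
Proof. by rewrite addr_ge0 // sqrtr_ge0. Qed.

Lemma pdistC x y : pdist x y = pdist y x.
Proof. by rewrite /pdist distrC [X in Num.sqrt X]distrC. Qed.

Lemma pdist_shift y (p q : R) : pdist (y.1 + p, y.2 + q) y = `|p| + Num.sqrt `|q|.
Proof. by rewrite /pdist /= !(addrC y.1) !(addrC y.2) !addrK. Qed.

Lemma pdist_dilate y s w : 0 < s ->
  pdist (y.1 + s * w.1, y.2 + s ^+ 2 * w.2) y = s * (`|w.1| + Num.sqrt `|w.2|).
Proof.
move=> s0; rewrite pdist_shift (normrM s) (normrM (s ^+ 2)) sqrtrM ?normr_ge0 //.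
rewrite (gtr0_norm s0) (@gtr0_norm _ (s ^+ 2)) ?exprn_gt0 //.
by rewrite sqrtr_sqr (gtr0_norm s0) mulrDr.
Qed.

Lemma pdist_le x y (c1 c2 : R) : `|x.1 - y.1| <= c1 -> 0 <= c2 ->
  `|x.2 - y.2| <= c2 ^+ 2 -> pdist x y <= c1 + c2.
Proof.
move=> h1 c20 h2; apply: lerD => //.
by apply: sqrt_abs_le => //; rewrite -ler_norml.
Qed.

(* [M] stands for [M1 + M2 + eta]; the extra term [L `^ kappa] in [st_eq] makes room for
   replacing the infimum over [c] by a near-minimizer. *)
Record germ_setting (kappa lambda : R) (A : {fset R}) (psi : R -> R * R -> R)
    (U : R * R -> R * R -> R) (a : R * R -> R) (gamma : R * R -> R * R -> R) (M : R) :
    Prop := Setting {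
  st_kappa : 1 < kappa < 2;
  st_A : forall beta, beta \in A -> 0 <= beta < kappa;
  st_lambda : 0 < lambda < 1;
  st_psi : forall T, 0 < T -> is_psi T (psi T);
  st_per : forall x, Z2periodic (U x);
  st_cont : forall x, continuous (U x);
  st_a : forall x, lambda <= a x <= lambda^-1;
  st_M : 0 < M;
  st_eq : forall x L T, 0 < L -> L <= 1 -> 0 < T -> T `^ 4^-1 <= 1 ->
    exists c, forall y, pdist y x < L ->
      (T `^ 4^-1) ^+ 2 * `|parab (a x) (convolution2 (psi T) (U x)) y - c| <=
        M * (\sum_(beta <- A) (T `^ 4^-1) `^ beta * L `^ (kappa - beta) + L `^ kappa);
  st_base : forall x y z,
    `|U x z - U x y - U y z + U y y - gamma x y * (z - y).1| <=
      M * \sum_(beta <- A) pdist y x `^ beta * pdist z y `^ (kappa - beta) }.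

Lemma powR_split_le (kappa beta s L : R) : 0 <= beta -> beta <= kappa ->
  0 <= s -> s <= L -> 0 < L -> s `^ beta * L `^ (kappa - beta) <= L `^ kappa.
Proof.
move=> b0 bk s0 sL L0.
have -> : L `^ kappa = L `^ beta * L `^ (kappa - beta).
  rewrite -powRD; first by rewrite subrKC.
  by apply/implyP => _; rewrite gt_eqF.
apply: ler_wpM2r; first exact: powR_ge0.
by apply: ge0_ler_powR; rewrite ?nnegrE // (le_trans s0).
Qed.

Definition smooth (f : R * R -> R) (U : R * R -> R * R -> R) (s : R) x : R * R -> R :=
  dil f s (s ^+ 2) (U x).

Section Consequences.
Variables (kappa lambda : R) (A : {fset R}) (psi : R -> R * R -> R)
    (U : R * R -> R * R -> R) (a : R * R -> R) (gamma : R * R -> R * R -> R) (M : R)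
    (f : R * R -> R).
Local Notation stg := (germ_setting kappa lambda A psi U a gamma M).
Local Notation smooth := (smooth f U).

Lemma smoothE s x : is_psi 1 f -> stg -> 0 < s ->
  convolution2 (psi (s ^+ 4)) (U x) = smooth s x.
Proof.
move=> hf [_ _ _ hpsi per cont _ _ _ _] s0.
apply: (dil_conv hf (hpsi _ _) (per x) (cont x)) => //; first by rewrite exprn_gt0.
by rewrite -exprM.
Qed.

(** For [s <= L] every summand is at most [L^kappa]. The factor [s^-2] is harmless only when [s] is
    comparable to [L], which [intermediate_scale] arranges. *)
Lemma smooth_equation s L x : is_psi 1 f -> stg -> 0 < s -> s <= L -> L <= 1 ->
  exists c, forall y, pdist y x < L ->
    `|parab (a x) (smooth s x) y - c| <= 2 * cardA A * M * (s ^- 2 * L `^ kappa).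
Proof.
move=> hf st s0 sL L1; have [hk hA _ _ _ _ _ M0 heq _] := st.
have L0 : 0 < L by lra.
have T1 : (s ^+ 4) `^ 4^-1 <= 1 by rewrite powR4; lra.
have [c Hc] := heq x L (s ^+ 4) L0 L1 (exprn_gt0 4 s0) T1.
exists c => y yL; have := Hc y yL; rewrite smoothE // powR4 ?(ltW s0) // => H.
have s20 : 0 < s ^+ 2 by rewrite exprn_gt0.
have LK : 0 <= L `^ kappa by exact: powR_ge0.
have n1 := cardA_ge1 A.
have S : \sum_(beta <- A) s `^ beta * L `^ (kappa - beta) <= cardA A * L `^ kappa.
  apply: sumA_le => // b /hA bI.
  by apply: powR_split_le; lra.
rewrite -(ler_pM2l s20); apply: le_trans H _.
have -> : s ^+ 2 * (2 * cardA A * M * (s ^- 2 * L `^ kappa)) = 2 * cardA A * M * L `^ kappa.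
  by field; rewrite gt_eqF.
have -> : 2 * cardA A * M * L `^ kappa = M * (2 * (cardA A * L `^ kappa)) by ring.
apply: ler_wpM2l; first exact: ltW.
have : 1 * L `^ kappa <= cardA A * L `^ kappa by exact: ler_wpM2r.
lra.
Qed.

End Consequences.
End Setting.

(** * Comparison of mollifications at different scales *)

Section ScaleComparison.
Variable R : realType.
Implicit Types (L s t r N C M p q g h X : R) (x y z w : R * R).

Lemma average_le p q g h X : `|p - h - g| <= X -> `|q - h + g| <= X ->
  `|(p + q) / 2 - h| <= X.
Proof. by rewrite !ler_norml; lra. Qed.

Lemma root4_bound r s : 0 < s -> 0 <= r -> r <= s -> exists2 t, s <= t <= 2 * s & t ^+ 4 = s ^+ 4 + r ^+ 4.
Proof.
move=> s0 r0 rs; pose t := Num.sqrt (Num.sqrt (s ^+ 4 + r ^+ 4)).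
have s4 : 0 <= s ^+ 4 + r ^+ 4 by rewrite addr_ge0 ?exprn_ge0 // ltW.
have t4 : t ^+ 4 = s ^+ 4 + r ^+ 4.
  by rewrite (exprM t 2 2) sqr_sqrtr ?sqrtr_ge0 // sqr_sqrtr.
have t0 : 0 <= t by exact: sqrtr_ge0.
have le4 (p q : R) : 0 <= p -> 0 <= q -> p ^+ 4 <= q ^+ 4 -> p <= q.
  by move=> p0 q0; rewrite ler_pXn2r.
have s0' := ltW s0; have s20 : 0 <= 2 * s by rewrite mulr_ge0.
exists t => //; apply/andP; split; apply: le4 => //; rewrite t4.
  by rewrite lerDl exprn_ge0.
have : r ^+ 4 <= s ^+ 4 by rewrite ler_pXn2r // nnegrE // ltW.
have : 0 <= s ^+ 4 by rewrite exprn_ge0 // ltW.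
have -> : (2 * s) ^+ 4 = 16 * s ^+ 4 by ring.
lra.
Qed.

Section Consequences.
Variables (kappa lambda : R) (A : {fset R}) (psi : R -> R * R -> R)
    (U : R * R -> R * R -> R) (a : R * R -> R) (gamma : R * R -> R * R -> R) (M : R)
    (f : R * R -> R) (C : R).
Local Notation stg := (germ_setting kappa lambda A psi U a gamma M).
Local Notation smooth := (smooth f U).

Lemma base_sum_le L s rho x y z : stg -> 0 < L -> 0 <= s -> s <= L -> 0 <= rho ->
  pdist y x <= L -> pdist z y = s * rho ->
  `|U x z - U x y - U y z + U y y - gamma x y * (z - y).1| <=
    cardA A * M * L `^ kappa * (1 + rho) ^+ 2.
Proof.
move=> [hk hA _ _ _ _ _ M0 _ hb] L0 s0 sL rho0 yx zy.
apply: le_trans (hb x y z) _.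
have -> : cardA A * M * L `^ kappa * (1 + rho) ^+ 2 =
  M * (cardA A * (L `^ kappa * (1 + rho) ^+ 2)) by ring.
apply: ler_wpM2l; first exact: ltW.
apply: sumA_le => [|b /hA bI]; first by rewrite mulr_ge0 ?powR_ge0 ?exprn_ge0 // addr_ge0.
by rewrite zy; apply: powR_mul_le => //; rewrite ?pdist_ge0 //; lra.
Qed.

Lemma smoothB s x y z : is_psi 1 f -> stg ->
  dil f s (s ^+ 2) (fun w => U x w - U y w) z = smooth s x z - smooth s y z.
Proof.
move=> hf [_ _ _ _ per cont _ _ _ _].
have [B UB] := periodic_bounded (per x) (@cont x).
have [B' UB'] := periodic_bounded (per y) (@cont y).
exact: dilB (is_psi_rapid hf) (@cont x) (@cont y) UB UB'.
Qed.

Lemma base_diff_periodic x y : stg -> Z2periodic (fun w => U x w - U y w).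
Proof. by move=> [_ _ _ _ per _ _ _ _ _] m n w; rewrite (per x m n w) (per y m n w). Qed.

Lemma base_diff_continuous x y : stg -> continuous (fun w => U x w - U y w).
Proof.
move=> [_ _ _ _ _ cont _ _ _ _].
by apply: ctsD; [exact: cont|apply: ctsN; exact: cont].
Qed.

(* Averaging over the reflection [w.1 -> - w.1] kills the [gamma] term. *)
Lemma base_diff_smooth_le s L x y : is_psi 1 f -> approx_const f C -> stg -> 0 < s -> s <= L ->
  pdist y x <= L ->
  `|(smooth s x y - smooth s y y) - (U x y - U y y)| <= C * (cardA A * M * L `^ kappa).
Proof.
move=> hf [C0 HC] st s0 sL yx.
rewrite -(smoothB s x y y hf st); apply: (HC _ _ (fun w => U x w - U y w)).
- exact: base_diff_periodic.
- exact: base_diff_continuous.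
move=> w; have L0 : 0 < L by exact: lt_le_trans sL.
have rho0 : 0 <= `|w.1| + Num.sqrt `|w.2| by rewrite addr_ge0 ?sqrtr_ge0.
have H (v : R * R) : `|v.1| = `|w.1| -> v.2 = w.2 ->
    `|U x (y.1 + s * v.1, y.2 + s ^+ 2 * v.2) - U x y
      - U y (y.1 + s * v.1, y.2 + s ^+ 2 * v.2) + U y y - gamma x y * (s * v.1)| <=
    cardA A * M * L `^ kappa * growth w.
  move=> v1 v2; have := @base_sum_le L s (`|w.1| + Num.sqrt `|w.2|) x y
    (y.1 + s * v.1, y.2 + s ^+ 2 * v.2) st L0 (ltW s0) sL rho0 yx.
  rewrite pdist_dilate // v1 v2 => /(_ erefl).
  have -> : ((y.1 + s * v.1, y.2 + s ^+ 2 * w.2) - y).1 = s * v.1.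
    by rewrite (_ : (_ - y).1 = y.1 + s * v.1 - y.1) // addrC addrA addNr add0r.
  by rewrite (addrA 1).
apply: (@average_le (U x (y.1 + s * w.1, y.2 + s ^+ 2 * w.2) - U y (y.1 + s * w.1, y.2 + s ^+ 2 * w.2)) _ (gamma x y * (s * w.1)) (U x y - U y y)).
  by have := H w erefl erefl; rewrite !ler_norml; lra.
have := H (- w.1, w.2) (normrN _) erefl.
by rewrite [(- w.1, w.2).1]/= [(- w.1, w.2).2]/= !mulrN !ler_norml; lra.
Qed.

(** The slope may depend on [x], [r] and [L]; slopes at different radii are reconciled only in
    [slope_cauchy]. *)
Definition admissible r N := forall x L, r <= L -> exists nu, forall y, pdist y x < L ->
  `|smooth r x y - smooth r x x - nu * (y.1 - x.1)| <= N * L `^ kappa.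

Lemma smooth_continuous s x : is_psi 1 f -> stg -> continuous (smooth s x).
Proof.
by move=> hf [_ _ _ _ per cont _ _ _ _]; apply: (dil_continuous hf (per x) (@cont x)).
Qed.

Lemma smooth_periodic s x : stg -> Z2periodic (smooth s x).
Proof. by move=> [_ _ _ _ per _ _ _ _ _]; apply: dil_periodic. Qed.

Lemma smooth_comp s r t x : is_psi 1 f -> stg -> t ^+ 4 = s ^+ 4 + r ^+ 4 ->
  dil f s (s ^+ 2) (smooth r x) = smooth t x.
Proof.
move=> hf [_ _ _ _ per cont _ _ _ _] E.
by apply: (dil_comp hf (per x) (@cont x)) => //; rewrite -!exprM.
Qed.

(** [smooth t y] is the average of [smooth r y] at scale [s]. For each [w], admissibility is applied
    on the ball of radius [s (1 + rho)], which is why it is required on arbitrarily large balls. The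
    points for [w] and its reflection lie in the same ball, so its slope cancels. *)
Lemma smooth_approx s r t N y : is_psi 1 f -> approx_const f C -> stg -> 0 < r -> r <= s ->
  t ^+ 4 = s ^+ 4 + r ^+ 4 -> 0 <= N -> admissible r N ->
  `|smooth t y y - smooth r y y| <= C * (N * s `^ kappa).
Proof.
move=> hf [C0 HC] st r0 rs E N0 adm; rewrite -(smooth_comp y hf st E).
apply: HC; [exact: smooth_periodic|exact: smooth_continuous|].
move=> w; have s0 : 0 < s by exact: lt_le_trans rs.
pose rho := `|w.1| + Num.sqrt `|w.2|.
have rho0 : 0 <= rho by rewrite addr_ge0 ?sqrtr_ge0.
have hk : 1 < kappa < 2 by case: st.
have rL : r <= s * (1 + rho).
  by apply: le_trans rs _; rewrite mulrDr mulr1 lerDl mulr_ge0 // ltW.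
have [nu Hnu] := adm y _ rL.
have GL : N * (s * (1 + rho)) `^ kappa <= N * s `^ kappa * growth w.
  rewrite -mulrA; apply: ler_wpM2l => //; rewrite powRM ?addr_ge0 ?(ltW s0) //.
  apply: ler_wpM2l; first exact: powR_ge0.
  rewrite /growth -(addrA 1) -/rho -powR_mulrn ?addr_ge0 //.
  by apply: ler_powR; [rewrite lerDl|lra].
have H (v : R * R) : `|v.1| = `|w.1| -> v.2 = w.2 ->
    `|smooth r y (y.1 + s * v.1, y.2 + s ^+ 2 * v.2) - smooth r y y - nu * (s * v.1)| <=
    N * s `^ kappa * growth w.
  move=> v1 v2; apply: le_trans GL.
  have := Hnu (y.1 + s * v.1, y.2 + s ^+ 2 * v.2).
  rewrite pdist_dilate // v1 v2 -/rho ltr_pM2l // ltrDr ltr01 => /(_ isT).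
  by rewrite [(_, _).1]/= (addrC y.1) addrK.
apply: (@average_le (smooth r y (y.1 + s * w.1, y.2 + s ^+ 2 * w.2)) _ (nu * (s * w.1))).

  by have := H w erefl erefl; rewrite !ler_norml; lra.
have := H (- w.1, w.2) (normrN _) erefl.
by rewrite [(- w.1, w.2).1]/= [(- w.1, w.2).2]/= !mulrN !ler_norml; lra.
Qed.

(** Smoothing errors are controlled by [smooth_approx] only at the base point itself, so the base is
    moved from [x] to [y]; each of the scales [t] and [r] costs one use of [base_diff_smooth_le]. *)
Lemma smooth_diff_le s r t L N x y : is_psi 1 f -> approx_const f C -> stg ->
  0 < r -> r <= s -> s <= t -> t <= L -> t ^+ 4 = s ^+ 4 + r ^+ 4 -> 0 <= N ->
  admissible r N -> pdist y x <= L ->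
  `|smooth t x y - smooth r x y| <= C * (N * s `^ kappa) + 2 * (C * (cardA A * M * L `^ kappa)).
Proof.
move=> hf hC st r0 rs stt tL E N0 adm yx.
have H1 := smooth_approx y hf hC st r0 rs E N0 adm.
have H2 := @base_diff_smooth_le t L x y hf hC st (ltac:(lra)) (ltac:(lra)) yx.
have H3 := @base_diff_smooth_le r L x y hf hC st (ltac:(lra)) (ltac:(lra)) yx.
by move: H1 H2 H3; rewrite !ler_norml; lra.
Qed.

End Consequences.
End ScaleComparison.

(** * Gain on small balls and change of base point *)

Section Steps.
Variable R : realType.
Implicit Types (L s t r N C M theta eps : R) (x y z w : R * R).

Section Consequences.
Variables (kappa lambda : R) (A : {fset R}) (psi : R -> R * R -> R)
    (U : R * R -> R * R -> R) (a : R * R -> R) (gamma : R * R -> R * R -> R) (M : R)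
    (f : R * R -> R) (C : R).
Local Notation stg := (germ_setting kappa lambda A psi U a gamma M).
Local Notation smooth := (smooth f U).
Local Notation n := (cardA A).

Lemma smooth_regular s x : is_psi 1 f -> stg -> 0 < s -> exists v1 v11 vt,
  regular (fun y t : R => smooth s x (y, t)) v1 v11 vt /\
  forall y t : R, parab (a x) (smooth s x) (y, t) = vt y t - a x * v11 y t.
Proof.
move=> hf st s0; have [_ _ _ hpsi per cont _ _ _ _] := st.
have s4 : 0 < s ^+ 4 by rewrite exprn_gt0.
have [v1 [v11 [vt [reg par]]]] := conv_regular hf (hpsi _ s4) s4 (per x) (@cont x).
exists v1, v11, vt; split; last by move=> y t; rewrite -(smoothE x hf st s0).
by move: reg; rewrite (smoothE x hf st s0).
Qed.

Definition step_error eps N := C * (N * eps `^ kappa) + 2 * (C * (n * M)).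

(** If [r] exceeds [eps L] it is itself comparable to [L], and [t = r] does. Otherwise t^4 = (eps
    L)^4 + r^4, and [eps <= 1/2] keeps t <= 2 eps L below [L]. *)
Lemma intermediate_scale r N eps L x : is_psi 1 f -> approx_const f C -> stg ->
  0 < r -> 0 <= N -> admissible kappa U f r N -> 0 < eps -> eps <= 1 / 2 -> r <= L ->
  exists2 t, eps * L <= t <= L &
    forall y, pdist y x <= L -> `|smooth t x y - smooth r x y| <= step_error eps N * L `^ kappa.
Proof.
move=> hf hC st r0 N0 adm e0 e2 rL.
have L0 : 0 < L by exact: lt_le_trans rL.
have eL0 : 0 < eps * L by rewrite mulr_gt0.
have eL : 2 * (eps * L) <= L by rewrite mulrA -[leRHS]mul1r; apply: ler_wpM2r; lra.
have LK : 0 <= L `^ kappa by exact: powR_ge0.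
have M0 : 0 <= M by apply: ltW; case: st.
have n0 : 0 <= n by apply: le_trans (cardA_ge1 A).
have C0 : 0 <= C by case: hC.
have err0 : 0 <= step_error eps N * L `^ kappa.
  by rewrite mulr_ge0 // addr_ge0 // !mulr_ge0 // powR_ge0.
have [re|er] := lerP r (eps * L); last first.
  exists r; first by rewrite rL ltW.
  by move=> y _; rewrite subrr normr0.
have [t /andP[t1 t2] t4] := root4_bound eL0 (ltW r0) re.
exists t; first by rewrite t1 (le_trans t2).
move=> y yx.
have := smooth_diff_le hf hC st r0 re t1 (le_trans t2 eL) t4 N0 adm yx.
rewrite (powRM kappa (ltW e0) (ltW L0)) /step_error.
have -> : C * (N * (eps `^ kappa * L `^ kappa)) + 2 * (C * (n * M * L `^ kappa)) =
  (C * (N * eps `^ kappa) + 2 * (C * (n * M))) * L `^ kappa by ring.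
by [].
Qed.

(** Admissibility on the larger ball of radius L / theta, moved to the scale [t], is the input of
    the interior estimate with ratio [theta]. This gains [theta^2], against the loss
    [theta^(-kappa)] from comparing the two radii. *)
Lemma small_scale_step r N eps theta L x : is_psi 1 f -> approx_const f C -> stg ->
  0 < r -> 0 <= N -> admissible kappa U f r N -> 0 < eps -> eps <= 1 / 2 ->
  0 < theta -> theta <= 1 / 8 -> r <= L -> L <= theta ->
  exists nu, forall y, pdist y x < L ->
    `|smooth r x y - smooth r x x - nu * (y.1 - x.1)| <=
      (870 / lambda ^+ 3 * ((N + 2 * step_error eps N + M) * theta ^+ 2 +
        2 * n * M * eps ^- 2) + 2 * step_error eps N) * (L / theta) `^ kappa.
Proof.
move=> hf hC st r0 N0 adm e0 e2 th0 th8 rL Lth.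
have L0 : 0 < L by exact: lt_le_trans rL.
pose L' := L / theta.
have L'0 : 0 < L' by rewrite divr_gt0.
have L'1 : L' <= 1 by rewrite ler_pdivrMr // mul1r.
have LE : L = theta * L' by rewrite mulrC divfK ?gt_eqF.
have LL' : L <= L' by rewrite LE -[leRHS]mul1r; apply: ler_wpM2r; lra.
have rL' := le_trans rL LL'.
have [hk _ hl _ _ _ ha M0 _ _] := st.
have [t /andP[t1 t2] tH] := intermediate_scale x hf hC st r0 N0 adm e0 e2 rL'.
have eL0 : 0 < eps * L' by rewrite mulr_gt0.
have t0 : 0 < t by exact: lt_le_trans t1.
have [c Hc] := smooth_equation x hf st t0 t2 L'1.
have [v1 [v11 [vt [reg par]]]] := smooth_regular x hf st t0.
have [nu Hnu] := adm x L' rL'.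
have X0 : 0 < L' `^ kappa by exact: powR_gt0.
set X := L' `^ kappa in tH Hc Hnu X0 *.
have M0' := ltW M0.
have n0 : 0 < n by apply: lt_le_trans (cardA_ge1 A).
have C0 : 0 <= C by case: hC.
have : 0 <= step_error eps N.
  by rewrite addr_ge0 // !mulr_ge0 ?powR_ge0 // ltW.
move: (step_error eps N) tH => e tH ee0.
pose F := 2 * n * M * ((eps * L') ^- 2 * X).
have F0 : 0 <= F by rewrite !mulr_ge0 ?invr_ge0 ?exprn_ge0 // ltW.
(* The interior estimate asks for a strictly positive [E], while [N] may vanish; hence the added
   [M]. *)
have E0 : 0 < (N + 2 * e + M) * X by rewrite mulr_gt0 //; lra.
have FH (y s : R) : pdist (y, s) x < L' -> `|vt y s - a x * v11 y s - c| <= F.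
  move=> yx; rewrite -par; apply: le_trans (Hc _ yx) _.
  apply: ler_wpM2l; first by rewrite !mulr_ge0 // ltW.
  apply: ler_wpM2r; first exact: ltW.
  by rewrite lef_pV2 ?posrE ?exprn_gt0 // ler_pXn2r // ?nnegrE ltW.
have [la1 la2] := andP (ha x); have [l0 l1] := andP hl.
have xx : pdist x x <= L' by rewrite /pdist !subrr normr0 sqrtr0 addr0 ltW.
have EH (y s : R) : pdist (y, s) x < L' ->
    `|smooth t x (y, s) - smooth t x (x.1, x.2) - nu * (y - x.1)| <= (N + 2 * e + M) * X.
  move=> yx; have H1 := Hnu _ yx; have H2 := tH _ (ltW yx); have H3 := tH _ xx.
  have MX : 0 <= M * X by rewrite mulr_ge0 // ltW.
  move: H1 H2 H3; rewrite -surjective_pairing [(y, s).1]/= !ler_norml.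
  by lra.
have [nu' Hnu'] := ball_affine_approx l0 (ltW l1) la1 la2 E0 F0 L'0 th0 th8 reg FH EH.
exists nu' => y yx; have := Hnu' y.1 y.2; rewrite -!surjective_pairing -LE => /(_ yx).
have -> : (N + 2 * e + M) * X * theta ^+ 2 + L' ^+ 2 * F =
    ((N + 2 * e + M) * theta ^+ 2 + 2 * n * M * eps ^- 2) * X.
  by rewrite /F; field; rewrite !gt_eqF.
have H2 := tH _ (le_trans (ltW yx) LL'); have H3 := tH _ xx.
rewrite mulrA; set Y := 870 / lambda ^+ 3 * _; move: H2 H3; rewrite !ler_norml.
by lra.
Qed.

Lemma powR_le_sqr b : 1 <= b -> stg -> b `^ kappa <= b ^+ 2.
Proof.
move=> b1 [hk _ _ _ _ _ _ _ _ _].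
by rewrite -powR_mulrn ?(le_trans ler01) //; apply: ler_powR => //; lra.
Qed.

(** For z = y + (1, 0) the four values of [U] cancel by periodicity and only [gamma x y] is left.
    The factor 36 is 3^2 from the radius times (1 + 1)^2. *)
Lemma gamma_le x y : stg -> pdist y x <= 3 -> `|gamma x y| <= 36 * (n * M).
Proof.
move=> st yx; have [_ _ _ _ per _ _ M0 _ _] := st.
have zy : pdist (y.1 + 1, y.2 + 0) y = 1 * 1.
  by rewrite pdist_shift normr1 normr0 sqrtr0 addr0 mulr1.
have := @base_sum_le _ _ _ _ _ _ _ _ _ 3 1 1 x y _ st _ _ _ _ yx zy.
have P v : U v (y.1 + 1, y.2 + 0) = U v y.
  by have := Z2periodicE (per v) 1 0 y.1 y.2; rewrite -surjective_pairing.
rewrite !P subrr add0r addNr add0r normrN.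
have -> : ((y.1 + 1, y.2 + 0) - y).1 = 1 by rewrite [LHS](_ : _ = y.1 + 1 - y.1) // (addrC y.1) addrK.
rewrite mulr1 => /(_ _ _ _ _)/le_trans; apply => //; first by lra.
have -> : 36 * (n * M) = n * M * (9 * 4) by ring.
have -> : n * M * 3 `^ kappa * (1 + 1) ^+ 2 = n * M * (3 `^ kappa * 4) by ring.
apply: ler_wpM2l; first by rewrite mulr_ge0 ?(ltW M0) // (le_trans ler01) // cardA_ge1.
apply: ler_wpM2r => //; have : 3 `^ kappa <= 3 ^+ 2 by apply: powR_le_sqr => //; lra.
lra.
Qed.

Lemma near_translate x y : exists p q : int,
  `|y.1 + p%:~R - x.1| <= 1 /\ `|y.2 + q%:~R - x.2| <= 1.
Proof.
have [p hp] := int_shift x.1 y.1; have [q hq] := int_shift x.2 y.2.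
by exists p, q; rewrite !ler_norml; lra.
Qed.

(** By periodicity [z] may be taken within distance 2 of [y]. There the three-point condition costs
    9 * 9 and the [gamma] term 36, in total 117. *)
Lemma base_oscillation_le x y z : stg -> pdist y x <= 3 ->
  `|U x z - U y z - (U x y - U y y)| <= 117 * (n * M).
Proof.
move=> st yx; have [_ _ _ _ per _ _ M0 _ _] := st.
have [p [q [h1 h2]]] := near_translate y z.
have P v : U v z = U v (z.1 + p%:~R, z.2 + q%:~R).
  by rewrite (Z2periodicE (per v)) -surjective_pairing.
rewrite !P; set z' := (_, _).
have zy : pdist z' y <= 2.
  have -> : 2 = 1 + 1 :> R by ring.
  by apply: pdist_le => //; rewrite expr1n.
have g := gamma_le st yx.
have z0 := pdist_ge0 z' y.
have n0 : 0 <= n * M by rewrite mulr_ge0 ?(ltW M0) // (le_trans ler01) // cardA_ge1.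
have := @base_sum_le _ _ _ _ _ _ _ _ _ 3 1 (pdist z' y) x y z' st _ _ _ z0 yx.
rewrite mul1r => /(_ _ _ _ erefl) H.
have {}H : `|U x z' - U x y - U y z' + U y y - gamma x y * (z' - y).1| <= 81 * (n * M).
  apply: le_trans (H _ _ _) _ => //; first by lra.
  have -> : 81 * (n * M) = n * M * (9 * 9) by ring.
  rewrite -mulrA; apply: ler_wpM2l => //; apply: ler_pM => //; rewrite ?powR_ge0 ?exprn_ge0 //.
  - by rewrite addr_ge0.
  - by have : 3 `^ kappa <= 3 ^+ 2; [apply: powR_le_sqr => //; lra|lra].
  have -> : 9 = 3 ^+ 2 :> R by ring.
  by rewrite ler_pXn2r ?nnegrE ?addr_ge0 //; lra.
have h : `|gamma x y * (z' - y).1| <= 36 * (n * M).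
  by rewrite normrM -[leRHS]mulr1; apply: ler_pM.
by move: H h; rewrite !ler_norml; lra.
Qed.

Lemma smooth_change_base C0 s x y : is_psi 1 f -> bound_const f C0 -> stg -> pdist y x <= 3 ->
  exists k, forall z, `|smooth s x z - smooth s y z - k| <= C0 * (117 * (n * M)).
Proof.
move=> hf [C00 H0] st yx; have [_ _ _ _ per cont _ _ _ _] := st.
pose d := U x y - U y y.
exists (dil f s (s ^+ 2) (fun=> d) (0, 0)) => z.
rewrite -(smoothB s x y z hf st).
have cD : continuous (fun w => U x w - U y w) by apply: base_diff_continuous st.
have cc : continuous (fun _ : R * R => d) by apply: cts_cst.
have [B DB] := periodic_bounded (base_diff_periodic x y st) cD.
rewrite -[dil f s _ (fun=> d) _]/(dil f s (s ^+ 2) (fun=> d) z).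
rewrite -(dilB s (s ^+ 2) z (is_psi_rapid hf) cD cc DB (fun=> lexx _)).
apply: H0; first by apply: ctsD => //; exact: ctsN.
by move=> w; exact: base_oscillation_le.
Qed.

End Consequences.
End Steps.

(** * Iteration of the gain *)

Section Iteration.
Variable R : realType.
Implicit Types (L s r N C M theta eps : R) (x : R * R).

Lemma powR_small (q b : R) : 0 < q -> 0 < b -> exists2 t, 0 < t <= 1 / 8 & t `^ q <= b.
Proof.
move=> q0 b0; exists (Num.min (1 / 8) (b `^ q^-1)).
  by rewrite lt_min powR_gt0 // andbT ge_min lexx /= andbT; lra.
have m0 : 0 <= Num.min (1 / 8) (b `^ q^-1) by rewrite le_min powR_ge0 andbT; lra.
apply: (@le_trans _ _ ((b `^ q^-1) `^ q)).
  by apply: ge0_ler_powR; rewrite ?nnegrE ?powR_ge0 ?(ltW q0) // ge_min lexx orbT.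
by rewrite -powRrM mulVf ?gt_eqF // powRr1 // ltW.
Qed.

Lemma eighth_le_half N : 0 <= N -> N * (1 / 8) <= N / 2.
Proof. by move=> N0; apply: ler_wpM2l => //; lra. Qed.

(* For these scales [N]-admissibility improves to [N / 2] plus a multiple of [M]. *)
Definition good_scales kappa lambda C theta eps := [/\ 0 < theta <= 1 / 8, 0 < eps <= 1 / 2,
  870 / lambda ^+ 3 * theta ^+ 2 * theta `^ (- kappa) <= 1 / 8,
  2 * (C * eps `^ kappa) <= 1 & 2 * (C * eps `^ kappa) * theta `^ (- kappa) <= 1 / 8].

(** [theta] is chosen first, with theta^(2 - kappa) small, which is where kappa < 2 is used; then
    [eps], with eps^kappa small compared with theta^kappa. *)
Lemma scales_exist kappa lambda C : 1 < kappa < 2 -> 0 < lambda -> 0 <= C ->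
  exists theta eps, good_scales kappa lambda C theta eps.
Proof.
move=> hk l0 C0; pose H := 870 / lambda ^+ 3.
have h870 : 0 < 870 :> R by rewrite ltr0n.
have H0 : 0 < H by apply: divr_gt0; [exact: h870|rewrite exprn_gt0].
have k0 : 0 < 2 - kappa by lra.
have b0 : 0 < 1 / 8 / H by apply: divr_gt0 => //; apply: divr_gt0.
have [t /andP[t0 t8] tH] := powR_small k0 b0.
have k1 : 0 < kappa by lra.
have tk0 : 0 < t `^ kappa by rewrite powR_gt0.
have c0 : 0 < 16 * (C + 1) by lra.
have [e /andP[e0 e8] eH] := powR_small k1 (divr_gt0 tk0 c0).
have tk1 : t `^ kappa <= 1.
  have -> : 1 = 1 `^ kappa by rewrite powR1.
  by apply: ge0_ler_powR; rewrite ?nnegrE; lra.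
have tE : t `^ (- kappa) * t `^ kappa = 1.
  by rewrite -powRD ?addNr ?powRr0 //; apply/implyP => _; rewrite gt_eqF.
have Cq : 2 * (C * e `^ kappa) <= t `^ kappa / 8.
  have : e `^ kappa * (16 * (C + 1)) <= t `^ kappa by rewrite -ler_pdivlMr.
  by have := powR_ge0 e kappa; lra.
exists t, e; split.
- by rewrite t0 t8.
- by rewrite e0; lra.
- have -> : 870 / lambda ^+ 3 * t ^+ 2 * t `^ (- kappa) = H * t `^ (2 - kappa).
    rewrite -mulrA; congr (_ * _); rewrite -powR_mulrn ?(ltW t0) // -powRD //.
    by apply/implyP => _; rewrite gt_eqF.
  by rewrite -ler_pdivlMl // mulrC.
- by lra.
have : 2 * (C * e `^ kappa) * t `^ (- kappa) <= t `^ kappa / 8 * t `^ (- kappa).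
  by apply: ler_wpM2r => //; exact: powR_ge0.
have -> : t `^ kappa / 8 * t `^ (- kappa) = t `^ (- kappa) * t `^ kappa / 8 by ring.
by rewrite tE.
Qed.

Lemma small_scale_arith (H C P T q E N M n : R) : 0 <= N -> 0 <= q -> 0 <= C ->
  0 <= H * T * P -> H * T * P <= 1 / 8 ->
  2 * (C * q) <= 1 -> 2 * (C * q) * P <= 1 / 8 ->
  (H * ((N + 2 * (C * (N * q) + 2 * (C * (n * M))) + M) * T + 2 * n * M * E) +
     2 * (C * (N * q) + 2 * (C * (n * M)))) * P <=
  N / 2 + P * (H * ((4 * C * n + 1) * T + 2 * n * E) + 4 * C * n) * M.
Proof.
move=> N0 q0 C0 u0 u1 c1 c2.
have -> : (H * ((N + 2 * (C * (N * q) + 2 * (C * (n * M))) + M) * T + 2 * n * M * E) +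
     2 * (C * (N * q) + 2 * (C * (n * M)))) * P =
  H * T * P * (N + 2 * (C * q) * N) + 2 * (C * q) * P * N +
  P * (H * ((4 * C * n + 1) * T + 2 * n * E) + 4 * C * n) * M by ring.
have h1 : 2 * (C * q) * N <= 1 * N by exact: ler_wpM2r.
have h2 : 2 * (C * q) * P * N <= 1 / 8 * N by exact: ler_wpM2r.
have h3 : 0 <= 2 * (C * q) * N by rewrite !mulr_ge0.
have h4 : H * T * P * (N + 2 * (C * q) * N) <= 1 / 8 * (N + 2 * (C * q) * N).
  by apply: ler_wpM2r => //; lra.
by rewrite lerD2r; lra.
Qed.

Section Consequences.
Variables (kappa lambda : R) (A : {fset R}) (psi : R -> R * R -> R)
    (U : R * R -> R * R -> R) (a : R * R -> R) (gamma : R * R -> R * R -> R) (M : R)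
    (f : R * R -> R) (C : R).
Local Notation stg := (germ_setting kappa lambda A psi U a gamma M).
Local Notation smooth := (smooth f U).
Local Notation n := (cardA A).

Lemma smooth_heat_family C0 s : is_psi 1 f -> bound_const f C0 -> stg -> 0 < s -> s <= 1 ->
  exists W1 W11 Wt, heat_family lambda (2 * n * M * s ^- 2) (C0 * (117 * (n * M)) + M) a
    (fun x (y t : R) => smooth s x (y, t)) W1 W11 Wt.
Proof.
move=> hf h0 st s0 s1; have [_ _ _ _ per cont ha M0 _ _] := st.
have [W1 H1] := choice (fun x => smooth_regular x hf st s0).
have [W11 H11] := choice H1.
have [Wt H] := choice H11.
exists W1, W11, Wt; split.
- by move=> x; have /andP[] := ha x.
- by move=> x; have [] := H x.
- by move=> x m y t; have := Z2periodicE (smooth_periodic f s x st) m 0 y t; rewrite addr0.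
- by move=> x m y t; have := Z2periodicE (smooth_periodic f s x st) 0 m y t; rewrite addr0.
- move=> x; have [c Hc] := smooth_equation x hf st s0 s1 (lexx 1).
  exists c => y t yt; have := Hc _ yt; rewrite powR1 mulr1.
  by have [_ ->] := H x.
- move=> x y h1 h2; have yx : pdist y x <= 3.
    have -> : 3 = 1 + 2 :> R by ring.
    apply: pdist_le => //; rewrite distrC //; apply: le_trans h2 _.
    have -> : 2 ^+ 2 = 4 :> R by ring.
    lra.
  have [k Hk] := smooth_change_base s hf h0 st yx.
  by exists k => z t; apply: le_trans (Hk (z, t)) _; rewrite lerDl ltW.
Qed.

(** At a scale [t] comparable to [eps] the equation on unit balls has a bounded right-hand side, so
    [global_oscillation_le] applies. The return to the scale [r] costs [smooth_diff_le] with radius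
    2, since every point has a translate that close to [x]. *)
Lemma large_scale_step C0 r N eps x y : is_psi 1 f -> approx_const f C -> bound_const f C0 ->
  stg -> 0 < r -> 0 <= N -> admissible kappa U f r N -> r <= eps -> eps <= 1 / 2 ->
  `|smooth r x y - smooth r x x| <=
    500 * (100 * ((2 * n * M * eps ^- 2 + (C0 * (117 * (n * M)) + M)) / lambda)) +
    2 * (C * (N * eps `^ kappa) + 8 * (C * (n * M))).
Proof.
move=> hf hC h0 st r0 N0 adm re e2.
have e0 : 0 < eps by exact: lt_le_trans re.
have [hk _ hl _ per _ _ M0 _ _] := st.
have [t /andP[t1 t2] t4] := root4_bound e0 (ltW r0) re.
have t0 : 0 < t by exact: lt_le_trans t1.
have tle1 : t <= 1 by apply: le_trans t2 _; lra.
have [W1 [W11 [Wt HF]]] := smooth_heat_family hf h0 st t0 tle1.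
have n0 : 0 < n by apply: lt_le_trans (cardA_ge1 A).
have C0' : 0 <= C by case: hC.
have nM0 : 0 < n * M by exact: mulr_gt0.
have [l0 l1] := andP hl.
have F0 : 0 < 2 * n * M * t ^- 2 by rewrite !mulr_gt0 ?invr_gt0 ?exprn_gt0.
(* The summand [M] ensures positivity even if [C0 = 0]. *)
have D0 : 0 < C0 * (117 * (n * M)) + M.
  by rewrite ltr_wpDl // !mulr_ge0 ?(ltW n0) ?(ltW M0) //; case: h0.
have diff z : `|smooth t x z - smooth r x z| <= C * (N * eps `^ kappa) + 8 * (C * (n * M)).
  have [p [q [d1 d2]]] := near_translate x z.
  have -> : smooth t x z = smooth t x (z.1 + p%:~R, z.2 + q%:~R).
    by rewrite (Z2periodicE (smooth_periodic f t x st)) -surjective_pairing.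
  have -> : smooth r x z = smooth r x (z.1 + p%:~R, z.2 + q%:~R).
    by rewrite (Z2periodicE (smooth_periodic f r x st)) -surjective_pairing.
  have zx : pdist (z.1 + p%:~R, z.2 + q%:~R) x <= 2.
    have -> : 2 = 1 + 1 :> R by ring.
    by apply: pdist_le => //; rewrite expr1n.
  have tle2 : t <= 2 by lra.
  apply: le_trans (smooth_diff_le hf hC st r0 re t1 tle2 t4 N0 adm zx) _.
  rewrite lerD2l.
  have -> : 8 * (C * (n * M)) = 2 * (C * (n * M * 4)) by ring.
  have k4 : 2 `^ kappa <= 4.
    have -> : 4 = 2 ^+ 2 :> R by ring.
    by apply: (powR_le_sqr _ st); lra.
  by apply: ler_wpM2l => //; apply: ler_wpM2l => //; apply: ler_wpM2l => //; exact: ltW.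
have osc := global_oscillation_le x y.1 y.2 x.1 x.2 l0 (ltW l1) F0 D0 HF.
rewrite -!surjective_pairing in osc.
have FF : 2 * n * M * t ^- 2 <= 2 * n * M * eps ^- 2.
  apply: ler_wpM2l; first by rewrite !mulr_ge0 // ltW.
  by rewrite lef_pV2 ?posrE ?exprn_gt0 // ler_pXn2r ?nnegrE ?(ltW e0) ?(ltW t0).
have osc' : `|smooth t x y - smooth t x x| <=
    500 * (100 * ((2 * n * M * eps ^- 2 + (C0 * (117 * (n * M)) + M)) / lambda)).
  apply: le_trans osc _; apply: ler_wpM2l; first by lra.
  apply: ler_wpM2l; first by lra.
  by apply: ler_wpM2r; [rewrite invr_ge0 ltW|rewrite lerD2r].
move: {osc FF} osc' (diff x) (diff y); set K := 500 * _.
by rewrite !ler_norml; lra.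
Qed.

Definition iteration_const C0 theta eps := theta `^ (- kappa) *
  (870 / lambda ^+ 3 * ((4 * C * n + 1) * theta ^+ 2 + 2 * n * eps ^- 2) + 4 * C * n +
   (500 * (100 * ((2 * n * eps ^- 2 + (C0 * (117 * n) + 1)) / lambda)) + 16 * C * n)).

(** Balls of radius at most [theta] are treated by the interior estimate. On larger ones the slope 0
    suffices, because 1 <= (L / theta)^kappa turns the absolute oscillation bound into a multiple of
    [L^kappa]. *)
Lemma admissible_improve C0 theta eps r N : is_psi 1 f -> approx_const f C -> bound_const f C0 ->
  stg -> good_scales kappa lambda C theta eps ->
  0 < r -> r <= eps -> 0 <= N -> admissible kappa U f r N ->
  admissible kappa U f r (N / 2 + iteration_const C0 theta eps * M).
Proof.
move=> hf hC h0 st [/andP[th0 th8] /andP[e0 e2] g1 g2 g3] r0 re N0 adm x L rL.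
have [_ _ hl _ _ _ _ M0 _ _] := st; have [l0 l1] := andP hl.
have L0 : 0 < L by exact: lt_le_trans rL.
have C00 : 0 <= C by case: hC.
have C000 : 0 <= C0 by case: h0.
have n0 : 0 <= n by apply: le_trans (cardA_ge1 A).
have Y0 : 0 <= L `^ kappa by exact: powR_ge0.
have q0 : 0 <= eps `^ kappa by exact: powR_ge0.
have P0 : 0 <= theta `^ (- kappa) by exact: powR_ge0.
have PE : (L / theta) `^ kappa = theta `^ (- kappa) * L `^ kappa.
  rewrite powRM ?(ltW L0) ?invr_ge0 ?(ltW th0) // mulrC; congr (_ * _).
  by rewrite -powR_inv1 ?(ltW th0) // -powRrM mulN1r.
have h870 : 0 <= 870 :> R by rewrite ler0n.
have H0 : 0 <= 870 / lambda ^+ 3.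
  by apply: mulr_ge0; [exact: h870|rewrite invr_ge0 exprn_ge0 // ltW].
have E0 : 0 <= eps ^- 2 by rewrite invr_ge0 exprn_ge0 // ltW.
have T0 : 0 <= theta ^+ 2 by rewrite exprn_ge0 // ltW.
set K1 := 870 / lambda ^+ 3 * ((4 * C * n + 1) * theta ^+ 2 + 2 * n * eps ^- 2) + 4 * C * n.
set K2 := 500 * (100 * ((2 * n * eps ^- 2 + (C0 * (117 * n) + 1)) / lambda)) + 16 * C * n.
have KE : iteration_const C0 theta eps = theta `^ (- kappa) * (K1 + K2) by [].
have K10 : 0 <= K1.
  apply: addr_ge0; last by rewrite !mulr_ge0.
  apply: mulr_ge0 => //; apply: addr_ge0; last by rewrite !mulr_ge0.
  by apply: mulr_ge0 => //; apply: addr_ge0 => //; rewrite !mulr_ge0.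
have K20 : 0 <= K2.
  apply: addr_ge0; last by rewrite !mulr_ge0.
  apply: mulr_ge0; first exact: ler0n.
  apply: mulr_ge0; first exact: ler0n.
  apply: mulr_ge0; last by rewrite invr_ge0 ltW.
  apply: addr_ge0; first by rewrite !mulr_ge0.
  have h117 : 0 <= 117 :> R by rewrite ler0n.
  by apply: addr_ge0 => //; apply: mulr_ge0 => //; exact: mulr_ge0.
have M0' := ltW M0.
have PK1 : 0 <= theta `^ (- kappa) * K1 * M by rewrite !mulr_ge0.
have PK2 : 0 <= theta `^ (- kappa) * K2 * M by rewrite !mulr_ge0.
have PKE : theta `^ (- kappa) * (K1 + K2) * M =
    theta `^ (- kappa) * K1 * M + theta `^ (- kappa) * K2 * M by rewrite mulrDr mulrDl.
rewrite KE PKE; have [Lth|thL] := lerP L theta.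
  have [nu Hnu] := small_scale_step x hf hC st r0 N0 adm e0 e2 th0 th8 rL Lth.
  exists nu => y yx; apply: le_trans (Hnu y yx) _; rewrite PE mulrA.
  apply: ler_wpM2r => //; rewrite /step_error.
  have u0 : 0 <= 870 / lambda ^+ 3 * theta ^+ 2 * theta `^ (- kappa).
    by apply: mulr_ge0; [apply: mulr_ge0; [exact: H0|exact: T0]|exact: P0].
  apply: le_trans (small_scale_arith _ _ _ N0 q0 C00 u0 g1 g2 g3) _.
  by rewrite -/K1 lerD2l lerDl.
exists 0 => y yx; rewrite mul0r subr0.
apply: le_trans (large_scale_step x y hf hC h0 st r0 N0 adm re e2) _.
have -> : 500 * (100 * ((2 * n * M * eps ^- 2 + (C0 * (117 * (n * M)) + M)) / lambda)) +
    2 * (C * (N * eps `^ kappa) + 8 * (C * (n * M))) = 2 * (C * eps `^ kappa) * N + K2 * M.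
  by rewrite /K2; field; rewrite !gt_eqF.
have PY : 1 <= theta `^ (- kappa) * L `^ kappa.
  have -> : 1 = 1 `^ kappa :> R by rewrite powR1.
  have k0 : 0 <= kappa.
    by have [/andP[k1 _] _ _ _ _ _ _ _ _ _] := st; exact: le_trans (ltW k1).
  have t1 : 1 <= L / theta by rewrite ler_pdivlMr // mul1r ltW.
  by rewrite -PE; apply: ge0_ler_powR; rewrite ?nnegrE // divr_ge0 // ltW.
have h1 : 0 <= 2 * (C * eps `^ kappa) * N + K2 * M by rewrite addr_ge0 // !mulr_ge0.
apply: (@le_trans _ _ ((2 * (C * eps `^ kappa) * N + K2 * M) *
  (theta `^ (- kappa) * L `^ kappa))).
  by rewrite -[leLHS]mulr1; apply: ler_wpM2l.
rewrite mulrA; apply: ler_wpM2r => //.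
have h2 : 2 * (C * eps `^ kappa) * theta `^ (- kappa) * N <= 1 / 8 * N by exact: ler_wpM2r.
have -> : (2 * (C * eps `^ kappa) * N + K2 * M) * theta `^ (- kappa) =
  2 * (C * eps `^ kappa) * theta `^ (- kappa) * N + theta `^ (- kappa) * K2 * M.
  rewrite mulrDl; congr (_ + _); first exact: mulrAC.
  by rewrite mulrC mulrA.
have := eighth_le_half N0.
move: h2 PK1; set X := _ * N; set Y1 := _ * K1 * M; set Y2 := _ * K2 * M.
by lra.
Qed.

Lemma admissible_le r N N' : N <= N' -> admissible kappa U f r N -> admissible kappa U f r N'.
Proof.
move=> NN adm x L rL; have [nu H] := adm x L rL.
exists nu => y yx; apply: le_trans (H y yx) _.
by apply: ler_wpM2r => //; exact: powR_ge0.
Qed.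

Lemma admissible_bounded C0 B r : bound_const f C0 -> stg -> 0 < r ->
  (forall x y, `|U x y| <= B) -> admissible kappa U f r (2 * (C0 * B) * r `^ (- kappa)).
Proof.
move=> [C00 h0] st r0 UB x L rL; have [hk _ _ _ _ cont _ _ _ _] := st.
have b y : `|smooth r x y| <= C0 * B by apply: h0; [exact: cont|exact: UB].
have B0 : 0 <= C0 * B by apply: le_trans (b x).
exists 0 => y _; rewrite mul0r subr0.
have PY : 1 <= r `^ (- kappa) * L `^ kappa.
  have -> : 1 = r `^ (- kappa) * r `^ kappa.
    by rewrite -powRD ?addNr ?powRr0 //; apply/implyP => _; rewrite gt_eqF.
  apply: ler_wpM2l; first exact: powR_ge0.
  by apply: ge0_ler_powR; rewrite ?nnegrE; lra.
apply: (@le_trans _ _ (2 * (C0 * B) * 1)).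
  by have := b x; have := b y; rewrite mulr1 !ler_norml; lra.
by rewrite -[leRHS]mulrA; apply: ler_wpM2l => //; rewrite mulr_ge0.
Qed.

Lemma admissible_uniform C0 theta eps B K r : is_psi 1 f -> approx_const f C ->
  bound_const f C0 -> stg -> good_scales kappa lambda C theta eps ->
  (forall x y, `|U x y| <= B) -> iteration_const C0 theta eps <= K -> 0 < K -> 0 < r -> r <= eps ->
  admissible kappa U f r (3 * K * M).
Proof.
move=> hf hC h0 st gs UB KK K0 r0 re.
have [_ _ _ _ _ _ _ M0 _ _] := st.
have KM0 : 0 < K * M by rewrite mulr_gt0.
have adm0 := admissible_bounded h0 st r0 UB.
set N0 := 2 * (C0 * B) * r `^ (- kappa) in adm0.
have N0' : 0 <= `|N0| by [].
have {}adm0 := admissible_le (ler_norm N0) adm0.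
(* [2 K M] is the fixed point of N -> N / 2 + K M. The excess over it is halved each time and falls
   below [K M] after finitely many steps, whose number may depend on [r]. *)
have admk (k : nat) : admissible kappa U f r (`|N0| / 2 ^+ k + 2 * (K * M)).
  elim: k => [|k IH].
    by apply: admissible_le adm0; rewrite expr0 divr1 lerDl mulr_ge0 // ltW.
  have p0 : 0 <= `|N0| / 2 ^+ k + 2 * (K * M).
    apply: addr_ge0; last by apply: mulr_ge0; [exact: ler0n|exact: ltW].
    by apply: divr_ge0; [exact: N0'|apply: exprn_ge0; exact: ler0n].
  apply: admissible_le (admissible_improve hf hC h0 st gs r0 re p0 IH).
  have KM : iteration_const C0 theta eps * M <= K * M by apply: ler_wpM2r => //; exact: ltW.
  rewrite exprS invfM; move: KM; move: (iteration_const _ _ _ * M) => z0; move: (K * M) (`|N0|) (2 ^+ k) => z1 z2 z3; lra.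
have [k hk] : exists k : nat, `|N0| / 2 ^+ k <= K * M.
  exists (Num.bound (`|N0| / (K * M))).
  rewrite ler_pdivrMr; last by apply: exprn_gt0; exact: ltr0n.
  rewrite mulrC -ler_pdivrMr; last exact: KM0.
  have /ltW/le_trans := archi_boundP (divr_ge0 N0' (ltW KM0)); apply.
  by rewrite -natrX ler_nat ltnW // ltn_expl.
apply: admissible_le (admk k).
by rewrite -mulrA; move: hk; move: (K * M) (`|N0| / 2 ^+ k) => z1 z2; lra.
Qed.

End Consequences.
End Iteration.

(** * Modelling by slopes *)

Section Campanato.
Variable R : realType.
Implicit Types (L K kappa d : R) (x y : R * R) (u : R * R -> R).

(** The chord has length [L / 2], so that its end lies inside the open ball of radius [L]. Being
    expressed by values of [u], this slope passes to the limit, unlike an existential one. *)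
Definition slope u x L := (u (x.1 + L / 2, x.2) - u x) * 2 / L.

Lemma pdist_eq0 x y : pdist x y <= 0 -> x = y.
Proof.
case: x y => x1 x2 [y1 y2] /= h.
have s0 : 0 <= Num.sqrt `|x2 - y2| by exact: sqrtr_ge0.
have h1 : `|x1 - y1| <= 0 by apply: le_trans h; rewrite /pdist /= lerDl.
have h2 : Num.sqrt `|x2 - y2| <= 0 by apply: le_trans h; rewrite /pdist /= lerDr.
have e1 : x1 = y1 by apply/eqP; rewrite -subr_eq0 -normr_le0.
have : `|x2 - y2| == 0.
  by rewrite eq_le normr_ge0 andbT -sqrtr_eq0 eq_le h2 s0.
by rewrite normr_eq0 subr_eq0 => /eqP e2; rewrite e1 e2.
Qed.

Lemma powR_succ kappa d : 0 < d -> d `^ kappa = d * d `^ (kappa - 1).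
Proof.
move=> d0; rewrite -[X in X * _](powRr1 (ltW d0)) -powRD ?subrKC //.
by apply/implyP => _; rewrite gt_eqF.
Qed.

Lemma slope_step u x kappa K L L' : 0 <= K -> 0 < L' -> L' <= L -> L / 2 <= L' ->
  (forall y, pdist y x < L -> `|u y - u x - slope u x L * (y.1 - x.1)| <= K * L `^ kappa) ->
  `|slope u x L' - slope u x L| <= 4 * K * L `^ (kappa - 1).
Proof.
move=> K0 L'0 LL L2 H; have L0 : 0 < L by exact: lt_le_trans LL.
have Y0 : 0 <= K * L `^ (kappa - 1) by rewrite mulr_ge0 ?powR_ge0.
have := H (x.1 + L' / 2, x.2).
have -> : pdist (x.1 + L' / 2, x.2) x = L' / 2.
  by have := pdist_shift x (L' / 2) 0; rewrite addr0 normr0 sqrtr0 addr0 gtr0_norm // divr_gt0.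
have -> : (x.1 + L' / 2, x.2).1 - x.1 = L' / 2 by rewrite [LHS]addrC addrA addNr add0r.
have -> : u (x.1 + L' / 2, x.2) - u x = slope u x L' * (L' / 2).
  by rewrite /slope; field; rewrite gt_eqF.
have L'2 : L' / 2 < L by lra.
rewrite -mulrBl => /(_ L'2).
rewrite normrM (gtr0_norm (x := L' / 2)) ?divr_gt0 // => h.
rewrite powR_succ // in h.
rewrite -(ler_pM2r (x := L' / 2)) ?divr_gt0 //; apply: le_trans h _.
have -> : K * (L * L `^ (kappa - 1)) = K * L `^ (kappa - 1) * L by ring.
have -> : 4 * K * L `^ (kappa - 1) * (L' / 2) = K * L `^ (kappa - 1) * (2 * L') by field.
by apply: ler_wpM2l => //; lra.
Qed.

(** The sum of the geometric series 4 q^j with q = 2^-(kappa - 1), which adds up the changes of the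
    slope under repeated halving of the radius. *)
Definition slope_const kappa : R := 4 / (1 - 2^-1 `^ (kappa - 1)).

Lemma half_powR kappa : 1 < kappa -> (2^-1 : R) `^ (kappa - 1) < 1.
Proof.
move=> k1; have k0 : 0 < kappa - 1 by lra.
have := gt0_ltr_powR k0 (x := 2^-1) (y := 1); rewrite powR1; apply; rewrite ?nnegrE //; lra.
Qed.

Lemma slope_const_ge4 kappa : 1 < kappa -> 4 <= slope_const kappa.
Proof.
move=> k1; have := half_powR k1; have := powR_ge0 2^-1 (kappa - 1).
by rewrite /slope_const; move: (_ `^ _) => q q0 q1; rewrite ler_pdivlMr; lra.
Qed.

Lemma slope_constE kappa : 1 < kappa ->
  slope_const kappa = 4 + slope_const kappa * 2^-1 `^ (kappa - 1).
Proof.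
move=> k1; rewrite /slope_const; have := half_powR k1.
by move: (_ `^ _) => q q1; field; rewrite subr_eq0 eq_sym lt_eqF.
Qed.

Lemma slope_cauchy u x kappa K : 1 < kappa -> 0 <= K ->
  (forall L y, 0 < L -> pdist y x < L ->
    `|u y - u x - slope u x L * (y.1 - x.1)| <= K * L `^ kappa) ->
  forall L L', 0 < L' -> L' <= L ->
  `|slope u x L' - slope u x L| <= slope_const kappa * K * L `^ (kappa - 1).
Proof.
move=> k1 K0 H L L' L'0 LL.
have G4 := slope_const_ge4 k1; have G0 := le_trans (ler0n R 4) G4.
have [k hk] : exists k : nat, L / 2 ^+ k <= L'.
  exists (Num.bound (L / L')).
  rewrite ler_pdivrMr ?exprn_gt0 // mulrC -ler_pdivrMr //.
  have L0 : 0 <= L by exact: le_trans (ltW L'0) LL.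
  have /ltW/le_trans := archi_boundP (divr_ge0 L0 (ltW L'0)); apply.
  by rewrite -natrX ler_nat ltnW // ltn_expl.
elim: k L LL hk => [|k IH] L LL hk; have L0 : 0 < L by exact: lt_le_trans LL.
  have -> : L = L' by apply/le_anti; rewrite LL andbT; move: hk; rewrite expr0 divr1.
  by rewrite subrr normr0; apply: mulr_ge0 (powR_ge0 _ _); exact: mulr_ge0.
have Y0 : 0 <= K * L `^ (kappa - 1) by rewrite mulr_ge0 ?powR_ge0.
have stp L1 : 0 < L1 -> L1 <= L -> L / 2 <= L1 ->
    `|slope u x L1 - slope u x L| <= 4 * (K * L `^ (kappa - 1)).
  move=> L10 L11 L12; rewrite mulrA.
  by apply: (slope_step K0 L10 L11 L12) => y; exact: H.
have [h|h] := lerP (L / 2) L'.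
  apply: le_trans (stp L' L'0 LL h) _; rewrite -mulrA.
  by apply: ler_wpM2r.
have L20 : 0 < L / 2 by rewrite divr_gt0.
have := IH (L / 2) (ltW h).
have -> : L / 2 / 2 ^+ k = L / 2 ^+ k.+1 by rewrite exprS invfM mulrA.
have Lh : L / 2 <= L by lra.
move=> /(_ hk); have := stp (L / 2) L20 Lh (lexx _).
have -> : slope_const kappa * K * (L / 2) `^ (kappa - 1) =
    slope_const kappa * 2^-1 `^ (kappa - 1) * (K * L `^ (kappa - 1)).
  by rewrite powRM ?(ltW L0) ?invr_ge0 //; ring.
have GE := slope_constE k1.
rewrite -[slope_const kappa * K * L `^ _]mulrA.
have -> : slope_const kappa * (K * L `^ (kappa - 1)) = 4 * (K * L `^ (kappa - 1)) +
    slope_const kappa * 2^-1 `^ (kappa - 1) * (K * L `^ (kappa - 1)) by rewrite -mulrDl -GE.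
by rewrite !ler_norml; lra.
Qed.

Lemma slope_limit u x kappa K : 1 < kappa < 2 -> 0 <= K ->
  (forall L y, 0 < L -> pdist y x < L ->
    `|u y - u x - slope u x L * (y.1 - x.1)| <= K * L `^ kappa) ->
  exists nu, forall y, `|u y - u x - nu * (y.1 - x.1)| <=
    (4 + 2 * slope_const kappa) * K * pdist y x `^ kappa.
Proof.
move=> /andP[k1 k2] K0 H; have G4 := slope_const_ge4 k1; have G0 := le_trans (ler0n R 4) G4.
have C := slope_cauchy k1 K0 H.
pose g L := slope_const kappa * K * L `^ (kappa - 1).
have g0 L : 0 <= g L by apply: mulr_ge0 (powR_ge0 _ _); exact: mulr_ge0.
(* By [slope_cauchy] each left end [slope - g] lies below each right end [slope + g], so the
   supremum of the left ends belongs to all these intervals and serves as the limit slope. *)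
pose S := [set slope u x L - g L | L in [set L | 0 < L]].
have ubS L : 0 < L -> ubound S (slope u x L + g L).
  move=> L0 _ [L' /= L'0 <-].
  have := g0 L; have := g0 L'; have [h|h] := leP L L'.
    by have := C _ _ L0 h; rewrite -/(g L') ler_norml; lra.
  by have := C _ _ L'0 (ltW h); rewrite -/(g L) ler_norml; lra.
have S0 : S !=set0 by exists (slope u x 1 - g 1), 1 => //=.
exists (sup S) => y; have [h|d0] := leP (pdist y x) 0.
  by rewrite (pdist_eq0 h) !subrr mulr0 subr0 normr0; apply: mulr_ge0 (powR_ge0 _ _); apply: mulr_ge0 => //; lra.
set d := pdist y x in d0 *.
have L0 : 0 < 2 * d by rewrite mulr_gt0.
have s1 : sup S <= slope u x (2 * d) + g (2 * d) by apply: ge_sup => //; exact: ubS.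
have s2 : slope u x (2 * d) - g (2 * d) <= sup S.
  by apply: ub_le_sup; [exists (slope u x 1 + g 1); exact: ubS|exists (2 * d)].
have yd : pdist y x < 2 * d by rewrite -/d; lra.
have h1 := H _ _ L0 yd.
have h2 : `|(sup S - slope u x (2 * d)) * (y.1 - x.1)| <= g (2 * d) * d.
  rewrite normrM; apply: ler_pM => //; first by rewrite ler_norml; lra.
  by rewrite /d /pdist lerDl sqrtr_ge0.
have dk : 0 <= K * d `^ kappa by rewrite mulr_ge0 ?powR_ge0.
have h3 : K * (2 * d) `^ kappa <= 4 * (K * d `^ kappa).
  rewrite powRM ?(ltW d0) //.
  have -> : 4 * (K * d `^ kappa) = K * (4 * d `^ kappa) by ring.
  apply: ler_wpM2l => //; apply: ler_wpM2r; first exact: powR_ge0.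
  have -> : 4 = 2 `^ 2%:R :> R by rewrite powR_mulrn //; ring.
  by apply: ler_powR; [rewrite ler1n|exact: ltW].
have h4 : g (2 * d) * d <= 2 * slope_const kappa * (K * d `^ kappa).
  have -> : g (2 * d) * d = slope_const kappa * K * (2 `^ (kappa - 1) * d `^ kappa).
    by rewrite /g powRM ?(ltW d0) // (powR_succ kappa d0); ring.
  have -> : 2 * slope_const kappa * (K * d `^ kappa) =
    slope_const kappa * K * (2 * d `^ kappa) by ring.
  apply: ler_wpM2l; first exact: mulr_ge0.
  apply: ler_wpM2r; first exact: powR_ge0.
  by rewrite -[leRHS](powRr1 (ler0n R 2)); apply: ler_powR; [rewrite ler1n|lra].
have -> : (4 + 2 * slope_const kappa) * K * d `^ kappa =
  4 * (K * d `^ kappa) + 2 * slope_const kappa * (K * d `^ kappa) by ring.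
have -> : u y - u x - sup S * (y.1 - x.1) = u y - u x - slope u x (2 * d) * (y.1 - x.1) -
  (sup S - slope u x (2 * d)) * (y.1 - x.1) by ring.
apply: le_trans (ler_normB _ _) _; apply: lerD.
  exact: le_trans h1 h3.
exact: le_trans h2 h4.
Qed.

End Campanato.

Section Limit.
Variable R : realType.
Implicit Types (L K N e : R) (x y : R * R).

(** The slope supplied by admissibility varies with [r]. It is eliminated by evaluating the estimate
    at the end of the chord and multiplying by [t], where |t| <= 2; this costs two further copies of
    [N L^kappa], hence the factor 3. *)
Lemma smoothing_limit (kappa lambda : R) (A : {fset R}) psi U a gamma (M : R) f eps N :
  is_psi 1 f -> germ_setting kappa lambda A psi U a gamma M -> 0 < eps -> 0 <= N ->
  (forall r, 0 < r -> r <= eps -> admissible kappa U f r N) ->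
  forall x L y, 0 < L -> pdist y x < L ->
  `|U x y - U x x - slope (U x) x L * (y.1 - x.1)| <= 3 * N * L `^ kappa.
Proof.
move=> hf st e0 N0 adm x L y L0 yx; have [_ _ _ _ per cont _ _ _ _] := st.
apply/ler_addgt0Pr => e epos; have e6 : 0 < e / 6 by rewrite divr_gt0.
pose y0 := (x.1 + L / 2, x.2).
have [r1 r10 h1] := dil_limit hf y (per x) (@cont x) e6.
have [r2 r20 h2] := dil_limit hf x (per x) (@cont x) e6.
have [r3 r30 h3] := dil_limit hf y0 (per x) (@cont x) e6.
have [s [s0 se sL s1 [sr1 sr2 sr3]]] : exists s, [/\ 0 < s, s <= eps, s <= L, s <= 1 &
    [/\ s <= r1, s <= r2 & s <= r3]].
  exists (Num.min (Num.min eps L) (Num.min 1 (Num.min r1 (Num.min r2 r3)))).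
  by rewrite !lt_min !ge_min !lexx !orbT e0 L0 ltr01 r10 r20 r30.
have s2s : s ^+ 2 <= s by rewrite expr2 -[leRHS]mulr1; apply: ler_wpM2l => //; exact: ltW.
have ab r : s <= r -> `|s| <= r /\ `|s ^+ 2| <= r.
  by move=> sr; rewrite !ger0_norm ?exprn_ge0 ?(ltW s0) //; split => //; exact: le_trans sr.
have {h1} := h1 _ _ (ab _ sr1).1 (ab _ sr1).2.
have {h2} := h2 _ _ (ab _ sr2).1 (ab _ sr2).2.
have {h3} := h3 _ _ (ab _ sr3).1 (ab _ sr3).2.
rewrite -/(smooth f U s x).
have [nu Hnu] := adm s s0 se x L sL.
have := Hnu _ yx; have := Hnu y0.
have -> : pdist y0 x = L / 2.
  by have := pdist_shift x (L / 2) 0; rewrite addr0 normr0 sqrtr0 addr0 gtr0_norm // divr_gt0.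
have L2 : L / 2 < L by lra.
have -> : y0.1 - x.1 = L / 2 by rewrite [LHS]addrC addrA addNr add0r.
move=> /(_ L2).
pose t := (y.1 - x.1) * 2 / L.
have tL : t * (L / 2) = y.1 - x.1 by rewrite /t; field; rewrite gt_eqF.
have t2 : `|t| <= 2.
  rewrite /t normrM normfV (gtr0_norm L0) ler_pdivrMr // normrM (ger0_norm (ler0n R 2)) mulrC.
  apply: ler_wpM2l => //; apply: le_trans (ltW yx).
  by rewrite /pdist lerDl sqrtr_ge0.
have -> : slope (U x) x L * (y.1 - x.1) = t * (U x y0 - U x x).
  by rewrite -tL /slope -/y0; field; rewrite gt_eqF.
rewrite -tL -[3 * N * _]mulrA; set Y := N * _.
have Y0 : 0 <= Y by rewrite mulr_ge0 // powR_ge0.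
set S := smooth f U s x => H1 H2 H3 H4 H5.
have -> : U x y - U x x - t * (U x y0 - U x x) =
  (S y - S x - nu * (t * (L / 2))) - t * (S y0 - S x - nu * (L / 2)) +
  (- (S y - U x y) + (S x - U x x) + t * ((S y0 - U x y0) - (S x - U x x))) by ring.
have T1 : `|t * (S y0 - S x - nu * (L / 2))| <= 2 * Y by rewrite normrM; exact: ler_pM.
have T2 : `|t * ((S y0 - U x y0) - (S x - U x x))| <= 2 * (e / 6 + e / 6).
  by rewrite normrM; apply: ler_pM => //; apply: le_trans (ler_normB _ _) _; exact: lerD.
move: T1 T2 H2 H4 H5; set q1 := t * (S y0 - S x - _); set q2 := t * (_ - (S x - _)).
by rewrite !ler_norml; lra.
Qed.

End Limit.

(** * Increments of the slope and final assembly *)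

Section Conclusion.
Variable R : realType.
Implicit Types (L K N e : R) (x y : R * R) (U gamma : R * R -> R * R -> R) (nu : R * R -> R).

Lemma inf_const_le (B : set (R * R)) (g : R * R -> R) (s S X : R) : 0 < s ->
  (s%:E * inf_const B g <= S%:E)%E -> S < X -> exists c, forall y, B y -> s * `|g y - c| <= X.
Proof.
move=> s0 H SX.
have : (inf_const B g < (X / s)%:E)%E.
  move: H; rewrite -lee_pdivlMl // -EFinM => H; apply: le_lt_trans H _.
  by rewrite lte_fin mulrC ltr_pM2r ?invr_gt0.
move=> /ereal_inf_lt[_ [c _ <-] /ltW Hc]; exists c => y By.
rewrite mulrC -ler_pdivlMr // -lee_fin; apply: le_trans Hc.
by apply: ereal_sup_ubound; exists y.
Qed.

Lemma pdist_powR_cancel (kappa : R) x y : x <> y ->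
  pdist y x `^ (- kappa) * pdist y x `^ kappa = 1.
Proof.
move=> xy; rewrite -powRD ?addNr ?powRr0 //; apply/implyP => _.
by apply/eqP => h; apply: xy; apply/esym/pdist_eq0; rewrite h.
Qed.

Lemma scaled_le (kappa : R) x y (X m : R) : x <> y -> X <= m * pdist y x `^ kappa ->
  pdist y x `^ (- kappa) * X <= m.
Proof.
move=> xy H; have -> : m = pdist y x `^ (- kappa) * (m * pdist y x `^ kappa).
  by rewrite mulrCA pdist_powR_cancel // mulr1.
by apply: ler_wpM2l H; exact: powR_ge0.
Qed.

Lemma le_scaled (kappa : R) x y (X m : R) : x <> y ->
  pdist y x `^ (- kappa) * X <= m -> X <= m * pdist y x `^ kappa.
Proof.
move=> xy H; have -> : X = pdist y x `^ (- kappa) * X * pdist y x `^ kappa.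
  by rewrite mulrAC pdist_powR_cancel // mul1r.
by apply: ler_wpM2r H; exact: powR_ge0.
Qed.

(** For z = y + (d, 0) with d the distance of [x] and [y], three modelling estimates and the
    three-point condition combine to (nu y - nu x + gamma x y) d. Since [z] is within 2 d of [x],
    the estimates cost 4 m, m and m. *)
Lemma slope_increment_le (kappa : R) (A : {fset R}) U gamma nu m M2 x y :
  1 < kappa < 2 -> (forall beta, beta \in A -> 0 <= beta < kappa) -> 0 <= m -> 0 <= M2 ->
  (forall x y z, `|U x z - U x y - U y z + U y y - gamma x y * (z - y).1| <=
     M2 * \sum_(beta <- A) pdist y x `^ beta * pdist z y `^ (kappa - beta)) ->
  (forall x y, `|U x y - U x x - nu x * (y.1 - x.1)| <= m * pdist y x `^ kappa) ->
  x <> y -> `|nu y - nu x + gamma x y| <= (6 * m + cardA A * M2) * pdist y x `^ (kappa - 1).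
Proof.
move=> hk hA m0 M20 hU H xy; set d := pdist y x.
have d0 : 0 < d.
  by rewrite lt_neqAle pdist_ge0 andbT; apply/eqP => h; apply: xy; apply/esym/pdist_eq0; rewrite -/d -h.
have dk : 0 <= d `^ kappa by exact: powR_ge0.
pose z := (y.1 + d, y.2).
have zy : pdist z y = d.
  by have := pdist_shift y d 0; rewrite addr0 normr0 sqrtr0 addr0 gtr0_norm.
have zx : pdist z x <= 2 * d.
  have t1 : `|z.1 - x.1| <= d + `|y.1 - x.1|.
    rewrite -(gtr0_norm d0); apply: le_trans (ler_normD _ _).
    by rewrite [z.1]/= addrAC addrC addrA.
  rewrite /pdist [z.2]/=; move: t1; rewrite {2}/d /pdist.
  set q := Num.sqrt _; set p := `|y.1 - _|; set w := `|z.1 - _|.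
  have : d = p + q by []. lra.
have k0 : 0 <= kappa by case/andP: hk => k1 _; exact: le_trans (ltW k1).
have S : \sum_(beta <- A) d `^ beta * d `^ (kappa - beta) <= cardA A * d `^ kappa.
  apply: sumA_le => // b /hA/andP[b0 bk].
  exact: powR_split_le b0 (ltW bk) (ltW d0) (lexx _) d0.
have z2 : pdist z x `^ kappa <= 4 * d `^ kappa.
  apply: (@le_trans _ _ ((2 * d) `^ kappa)).
    by apply: ge0_ler_powR; rewrite ?nnegrE ?pdist_ge0 // mulr_ge0 // ltW.
  rewrite powRM ?(ltW d0) //; apply: ler_wpM2r => //.
  have -> : 4 = 2 `^ 2%:R :> R by rewrite powR_mulrn //; ring.
  by apply: ler_powR; [rewrite ler1n|case/andP: hk => _ /ltW].
have h1 := H x z; have h2 := H x y; have h3 := H y z; have h4 := hU x y z.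
have {}h1 : `|U x z - U x x - nu x * (z.1 - x.1)| <= m * (4 * d `^ kappa).
  by apply: le_trans h1 _; exact: ler_wpM2l.
have {}h4 : `|U x z - U x y - U y z + U y y - gamma x y * d| <= M2 * (cardA A * d `^ kappa).
  have zd : (z - y).1 = d by rewrite [LHS](_ : _ = y.1 + d - y.1) // (addrC y.1) addrK.
  rewrite -{1}zd; apply: le_trans h4 _; apply: ler_wpM2l; first exact: M20.
  by rewrite zy; exact: S.
rewrite -/d in h2; rewrite zy in h3.
have e3 : z.1 - y.1 = d by rewrite [LHS]addrC addrA addNr add0r.
have e1 : z.1 - x.1 = y.1 - x.1 + d by rewrite [z.1]/=; ring.
rewrite e1 in h1; rewrite e3 in h3.
rewrite -(ler_pM2r d0).
have -> : (6 * m + cardA A * M2) * d `^ (kappa - 1) * d = (6 * m + cardA A * M2) * d `^ kappa.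
  by rewrite (powR_succ kappa d0); ring.
rewrite -{1}(gtr0_norm d0) -normrM.
have -> : (nu y - nu x + gamma x y) * d =
  (U x z - U x x - nu x * (y.1 - x.1 + d)) - (U x y - U x x - nu x * (y.1 - x.1)) -
  (U y z - U y y - nu y * d) -
  (U x z - U x y - U y z + U y y - gamma x y * d) by ring.
set q1 := U x z - U x x - _ in h1 *; set q2 := U x y - U x x - _ in h2 *.
set q3 := U y z - U y y - _ in h3 *; set q4 := _ - gamma x y * d in h4 *.
move: h1 h2 h3 h4; move: q1 q2 q3 q4 => q1 q2 q3 q4.
by rewrite !ler_norml; lra.
Qed.

Lemma germ_setting_of_bounds (kappa lambda : R) (A : {fset R}) (psi : R -> R * R -> R) U a gamma (M1 M2 eta : R) :
  1 < kappa < 2 -> (forall beta, beta \in A -> 0 <= beta < kappa) -> 0 < lambda < 1 ->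
  (forall T : R, 0 < T -> is_psi T (psi T)) -> (forall x, Z2periodic (U x)) ->
  (forall x, continuous (U x)) -> (forall x, lambda <= a x <= lambda^-1) -> 0 <= M1 ->
  (forall x (L T : R), 0 < L -> L <= 1 -> 0 < T -> T `^ 4^-1 <= 1 ->
    (((T `^ 4^-1) ^+ 2)%:E *
      inf_const (pball x L) (parab (a x) (convolution2 (psi T) (U x)))
      <= (M1 * \sum_(beta <- A) (T `^ 4^-1) `^ beta * L `^ (kappa - beta))%:E)%E) ->
  0 <= M2 ->
  (forall x y z, `|U x z - U x y - U y z + U y y - gamma x y * (z - y).1| <=
     M2 * \sum_(beta <- A) pdist y x `^ beta * pdist z y `^ (kappa - beta)) ->
  0 < eta -> germ_setting kappa lambda A psi U a gamma (M1 + M2 + eta).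
Proof.
move=> hk hA hl hpsi per cont ha M10 hU1 M20 hU2 e0; split => //.
- by lra.
- move=> x L T L0 L1 T0 T1.
  have t0 : 0 < (T `^ 4^-1) ^+ 2 by rewrite exprn_gt0 // powR_gt0.
  set S := \sum_(beta <- A) _.
  have S0 : 0 <= S by apply: sumr_ge0 => b _; rewrite mulr_ge0 ?powR_ge0.
  have LK : 0 < L `^ kappa by rewrite powR_gt0.
  have h1 : M1 * S <= (M1 + M2 + eta) * S by apply: ler_wpM2r => //; lra.
  have h2 : 0 < (M1 + M2 + eta) * L `^ kappa by apply: mulr_gt0 => //; lra.
  have h3 : M1 * S < (M1 + M2 + eta) * (S + L `^ kappa) by rewrite mulrDr; lra.
  have [c Hc] := inf_const_le t0 (hU1 x L T L0 L1 T0 T1) h3.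
  exists c => y yx; have yB : pball x L y by rewrite /pball /= pdistC.
  exact: Hc yB.
move=> x y z; apply: le_trans (hU2 x y z) _; apply: ler_wpM2r; last by lra.
by apply: sumr_ge0 => b _; rewrite mulr_ge0 ?powR_ge0.
Qed.

End Conclusion.

Section Estimate.
Variable R : realType.

(** [K] is fixed by kappa, lambda, [A] and [f] before the data appear. The auxiliary [eta], which
    kept the constant strictly positive, is removed here. *)
Lemma slope_estimate (kappa lambda : R) (A : {fset R}) (f : R * R -> R) :
  1 < kappa < 2 -> 0 < lambda < 1 -> is_psi 1 f -> exists K, 0 < K /\
  forall (psi : R -> R * R -> R) (U : R * R -> R * R -> R) (a : R * R -> R)
    (gamma : R * R -> R * R -> R) (M : R),
  (exists B, forall x y, `|U x y| <= B) -> 0 <= M ->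
  (forall eta, 0 < eta -> germ_setting kappa lambda A psi U a gamma (M + eta)) ->
  exists nu : R * R -> R, forall x y,
    `|U x y - U x x - nu x * (y.1 - x.1)| <= K * M * pdist y x `^ kappa.
Proof.
move=> hk hl hf; have [C hC] := dil_approx hf.
have [C0 h0] := dil_bound (is_psi_rapid hf).
have [theta [eps gs]] := scales_exist hk (andP hl).1 hC.1.
pose K := `|iteration_const kappa lambda A C C0 theta eps| + 1.
have K0 : 0 < K by rewrite ltr_wpDl.
have KK : iteration_const kappa lambda A C C0 theta eps <= K by apply: le_trans (ler_norm _) _; rewrite lerDl.
have e0 : 0 < eps by case: gs => _ /andP[].
have k1 : 1 < kappa by lra.
have G4 := slope_const_ge4 k1.
exists ((4 + 2 * slope_const kappa) * (9 * K)); split.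
  by apply: mulr_gt0; [lra|apply: mulr_gt0].
move=> psi U a gamma M [B UB] M0 st.
have H (x : R * R) (L : R) y : 0 < L -> pdist y x < L ->
    `|U x y - U x x - slope (U x) x L * (y.1 - x.1)| <= 9 * K * M * L `^ kappa.
  move=> L0 yx; apply/ler_addgt0Pr => e epos.
  have LK : 0 < L `^ kappa by rewrite powR_gt0.
  have D0 : 0 < 9 * K * L `^ kappa by apply: mulr_gt0 => //; apply: mulr_gt0.
  (* With this [eta] the bound of [smoothing_limit] becomes exactly 9 K M L^kappa + e, where 9 = 3 *
     3 combines that lemma with [admissible_uniform]. *)
  have eta0 : 0 < e / (9 * K * L `^ kappa) by rewrite divr_gt0.
  have N0 : 0 <= 3 * K * (M + e / (9 * K * L `^ kappa)).
    by apply: mulr_ge0; [apply: mulr_ge0 => //; exact: ltW|apply: addr_ge0 => //; exact: ltW].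
  have adm r : 0 < r -> r <= eps -> admissible kappa U f r (3 * K * (M + e / (9 * K * L `^ kappa))).
    exact: (admissible_uniform hf hC h0 (st _ eta0) gs UB KK K0).
  apply: le_trans (smoothing_limit hf (st _ eta0) e0 N0 adm L0 yx) _.
  have E (k q : R) : 0 < k -> 0 < q ->
      3 * (3 * k * (M + e / (9 * k * q))) * q = 9 * k * M * q + e.
    by move=> k0 q0; field; rewrite !gt_eqF.
  by rewrite E.
have KM0 : 0 <= 9 * K * M by apply: mulr_ge0 => //; apply: mulr_ge0 => //; exact: ltW.
have [nu Hnu] := choice (fun x => slope_limit hk KM0 (H x)).
by exists nu => x y; rewrite -!mulrA; have := Hnu x y; rewrite -!mulrA.
Qed.

End Estimate.
Theorem proposition2 (R : realType) (kappa lambda : R) (A : {fset R})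
    (hkappa : 1 < kappa < 2)
    (hA : forall beta : R, beta \in A -> 0 <= beta < kappa)
    (hlambda : 0 < lambda < 1) :
  exists C : R, 0 < C /\
  forall (psi : R -> R * R -> R)
    (hpsi : forall T : R, 0 < T -> is_psi T (psi T))
    (U : R * R -> R * R -> R)
    (hUbounded : exists K : R, forall x y, `|U x y| <= K)
    (hUperiodic : forall x, Z2periodic (U x))
    (hUcont : forall x, continuous (U x))
    (a : R * R -> R) (ha : forall x, lambda <= a x <= lambda^-1)
    (M1 : R) (hM1 : 0 <= M1)
    (hU1 : forall (x : R * R) (L T : R), 0 < L -> L <= 1 ->
       0 < T -> T `^ 4^-1 <= 1 ->
       (((T `^ 4^-1) ^+ 2)%:E *
        inf_const (pball x L) (parab (a x) (convolution2 (psi T) (U x)))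
        <= (M1 * \sum_(beta <- A)
                   (T `^ 4^-1) `^ beta * L `^ (kappa - beta))%:E)%E)
    (gamma : R * R -> R * R -> R)
    (hgamma : continuous (fun p : (R * R) * (R * R) => gamma p.1 p.2))
    (M2 : R) (hM2 : 0 <= M2)
    (hU2 : forall x y z : R * R,
       `|U x z - U x y - U y z + U y y - gamma x y * (z - y).1|
       <= M2 * \sum_(beta <- A)
                 pdist y x `^ beta * pdist z y `^ (kappa - beta)),
  exists nu : R * R -> R,
    [/\ (modelling_sup kappa U nu <= (C * (M1 + M2))%:E)%E,
        (supnorm [set: R * R] nu <= modelling_sup kappa U nu)%E,
        (sup_offdiag (fun x y => pdist y x `^ (- (kappa - 1)) *
                                 `|nu y - nu x + gamma x y|)%R
         <= C%:E * (modelling_sup kappa U nu + M2%:E))%E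
      & (modelling_sup kappa U nu + M2%:E <= (C * (M1 + M2))%:E)%E].
Proof.
(* The constant precedes [psi], so a kernel [f] with the transform of psi_1 is selected beforehand;
   if there is none, the hypothesis on [psi] cannot hold. *)
have [[f hf]|nf] := pselect (exists f, is_psi (1 : R) f); last first.
  by exists 1; split=> // psi hpsi; case: nf; exists (psi 1); exact: hpsi.
have [K [K0 HK]] := @slope_estimate R kappa lambda A f hkappa hlambda hf.
have n1 := cardA_ge1 A.
(* [K] bounds the modelling supremum; 6 and [cardA A] are the constants of [slope_increment_le]. *)
exists (K + 6 + cardA A); split; first by lra.
move=> psi hpsi U hUb per cont a ha M1 M10 hU1 gamma _ M2 M20 hU2.
have M12 : 0 <= M1 + M2 by exact: addr_ge0.
have [nu Hnu] := HK psi U a gamma (M1 + M2) hUb M12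
  (fun eta => @germ_setting_of_bounds R _ _ _ _ _ _ _ M1 M2 eta hkappa hA hlambda hpsi per cont ha
     M10 hU1 M20 hU2).
exists nu.
have up : (modelling_sup kappa U nu <= (K * (M1 + M2))%:E)%E.
  apply: ge_ereal_sup => _ [[x y] /= xy <-]; rewrite lee_fin.
  exact: scaled_le (Hnu x y).
(* At y = x + (1, 0) the distance is 1 and the values of [U] cancel by periodicity, so the quantity
   under the supremum is [|nu x|]. *)
have nu_le x : (`|nu x|%:E <= modelling_sup kappa U nu)%E.
  apply: ereal_sup_ubound; exists (x, (x.1 + 1, x.2)) => /=.
    move=> h; have := congr1 fst h => /= /eqP.
    by rewrite eq_sym addrC -subr_eq0 addrK oner_eq0.
  have -> : pdist (x.1 + 1, x.2) x = 1.
    by have := pdist_shift x 1 0; rewrite addr0 normr0 sqrtr0 addr0 normr1.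
  have -> : U x (x.1 + 1, x.2) = U x x.
    by have := Z2periodicE (per x) 1 0 x.1 x.2; rewrite addr0 -surjective_pairing.
  by rewrite subrr sub0r normrN powR1 mul1r (addrC x.1) addrK mulr1.
have fm : modelling_sup kappa U nu \is a fin_num.
  rewrite ge0_fin_numE; first exact: le_lt_trans up (ltry _).
  by apply: le_trans (nu_le (0, 0)); rewrite lee_fin.
have m0 : 0 <= fine (modelling_sup kappa U nu).
  by apply: fine_ge0; apply: le_trans (nu_le (0, 0)); rewrite lee_fin.
move: (fineK fm) m0; set m := fine _ => mE m0.
rewrite -mE in up nu_le *; rewrite lee_fin in up.
have Hm x y : `|U x y - U x x - nu x * (y.1 - x.1)| <= m * pdist y x `^ kappa.
  have [->|/eqP xy] := eqVneq x y.
    by rewrite !subrr mulr0 subr0 normr0 mulr_ge0 // powR_ge0.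
  apply: le_scaled => //; rewrite -lee_fin mE.
  by apply: ereal_sup_ubound; exists (x, y).
have KM : K * (M1 + M2) + M2 <= (K + 6 + cardA A) * (M1 + M2).
  have : 1 * (M1 + M2) <= cardA A * (M1 + M2) by exact: ler_wpM2r.
  have -> : (K + 6 + cardA A) * (M1 + M2) =
    K * (M1 + M2) + 6 * (M1 + M2) + cardA A * (M1 + M2) by ring.
  by move=> h; lra.
split.
- by rewrite lee_fin; lra.
- by apply: ge_ereal_sup => _ [x _ <-].
- rewrite -EFinD -EFinM; apply: ge_ereal_sup => _ [[x y] /= xy <-]; rewrite lee_fin.
  apply: scaled_le => //.
  apply: le_trans (slope_increment_le hkappa hA m0 M20 hU2 Hm xy) _.
  apply: ler_wpM2r; first exact: powR_ge0.
  have : 0 <= K * m + K * M2 + 6 * M2 + cardA A * m.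
    have n0 : 0 <= cardA A by lra.
    by rewrite !addr_ge0 ?mulr_ge0 // ltW.
  by rewrite !mulrDr !mulrDl; lra.
by rewrite -EFinD lee_fin; lra.
Qed.
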